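(* Let $\Omega,\omega,D_\varepsilon$ be as in the context. There exists a constant $\beta>0$, depending only on the geometry of $\Omega$, $\omega$ and $Y$ (in particular independent of $\varepsilon\in(0,1)$), such that $$\inf_{\psi\in L^2(D_\varepsilon)\setminus\{0\}}\ \sup_{\mathbf v\in V^\varepsilon\setminus\{0\}}\ \frac{\int_{D_\varepsilon}(\nabla\cdot\mathbf v)\,\psi\,dx}{\|\mathbf v\|_{H^1(\Omega)}\,\|\psi\|_{L^2(D_\varepsilon)}}\ \ge\ \beta .$$
   Context: Geometry. $d\ge2$; $\Omega\subset\mathbb R^d$ is a bounded connected open set with connected $C^\infty$ boundary. $Y=(-\frac12,\frac12)^d$; $\omega\subset Y$ is open, simply connected, with connected $C^\infty$ boundary and $\mathrm{dist}(\omega,\partial Y)>0$. For $\varepsilon\in(0,1)$, $\Pi_\varepsilon=\{\mathbf n\in\mathbb Z^d:\overline{\varepsilon(\mathbf n+Y)}\subset\Omega\}$ and $D_\varepsilon=\bigcup_{\mathbf n\in\Pi_\varepsilon}\varepsilon(\mathbf n+\omega)$; $\Omega\setminus\overline{D_\varepsilon}$ is connected. Spaces. $\mathcal R$ is the space of rigid motions, i.e. vector fields $\mathbf r$ on $\mathbb R^d$ with $\frac12(\nabla\mathbf r+\nabla\mathbf r^T)=0$. $H^{1/2}_{\mathcal R}(\partial\Omega)$ is the subspace of $\phi\in H^{1/2}(\partial\Omega;\mathbb R^d)$ with $\int_{\partial\Omega}\phi\cdot\mathbf r\,dS=0$ for all $\mathbf r\in\mathcal R$. $V^\varepsilon=\{\mathbf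 v\in H^1(\Omega;\mathbb R^d):\mathbf v|_{\partial\Omega}\in H^{1/2}_{\mathcal R}(\partial\Omega)\}$. *)

(* Defs.v *)
From HB Require Import structures.
From mathcomp Require Import all_boot all_order all_algebra.
From mathcomp Require Import all_classical all_reals all_analysis.

Set Implicit Arguments.
Unset Strict Implicit.
Unset Printing Implicit Defensive.

Import Order.TTheory GRing.Theory Num.Theory.
Import numFieldNormedType.Exports.

Local Open Scope classical_set_scope.
Local Open Scope ring_scope.

Definition rV_display : measure_display. Proof. exact. Qed.

Section measurable_rV.
Context {R : realType} (n : nat).

(* The product sigma-algebra, which is the Borel sigma-algebra of R^n. *)
Let rV_measurable : set (set 'rV[R]_n) :=
  g_sigma_preimage (fun (i : 'I_n) (x : 'rV[R]_n) => x ord0 i : measurableTypeR R).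

Let rV_set0 : rV_measurable set0.
Proof. exact: sigma_algebra0. Qed.

Let rV_setC A : rV_measurable A -> rV_measurable (~` A).
Proof. exact: sigma_algebraC. Qed.

Let rV_bigcup (F : (set 'rV[R]_n)^nat) :
  (forall k, rV_measurable (F k)) -> rV_measurable (\bigcup_k F k).
Proof. exact: sigma_algebra_bigcup. Qed.

HB.instance Definition _ := @isMeasurable.Build rV_display 'rV[R]_n
  rV_measurable rV_set0 rV_setC rV_bigcup.

End measurable_rV.

Lemma measurable_rV_coord (R : realType) n (i : 'I_n) :
  measurable_fun setT (fun x : 'rV[R]_n => x ord0 i : measurableTypeR R).
Proof.
move=> _ Y mY; rewrite setTI; apply: sub_sigma_algebra => /=.
rewrite -bigcup_seq/=; exists i => /=; first by rewrite mem_index_enum.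
by exists Y => //; rewrite setTI.
Qed.

Lemma measurable_fun_rVP d (T : measurableType d) (R : realType) n
    (f : T -> 'rV[R]_n) :
  (forall i, measurable_fun setT (fun t => f t ord0 i : measurableTypeR R)) ->
  measurable_fun setT f.
Proof.
move=> mf.
apply: (@measurability _ _ _ _ setT f
  (\big[setU/set0]_(i < n) preimage_set_system setT
    (fun x : 'rV[R]_n => x ord0 i : measurableTypeR R) measurable)).
  by [].
move=> _ [B +] <-; rewrite -bigcup_seq => -[i _ [C mC <-]].
by rewrite [in X in _ @^-1` X]setTI; exact: (mf i measurableT C mC).
Qed.

Section lebesgue_rV_step.
Context {R : realType} (n : nat).
Variable m : {sigma_finite_measure set 'rV[R]_n -> \bar R}.
Local Open Scope ereal_scope.

Let glue (p : measurableTypeR R * 'rV[R]_n) : 'rV[R]_n.+1 :=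
  row_mx (p.1%:M : 'rV_1) p.2.

Let unglue (x : 'rV[R]_n.+1) : measurableTypeR R * 'rV[R]_n :=
  ((x : 'rV_(1 + n)) ord0 (lshift n ord0), rsubmx (x : 'rV_(1 + n))).

Let glueK : cancel glue unglue.
Proof.
move=> [a y]; rewrite /unglue /glue/= row_mxKr; congr pair.
by rewrite (row_mxEl (a%:M : 'rV_1) y) mxE eqxx.
Qed.

Let mglue : measurable_fun setT glue.
Proof.
apply: measurable_fun_rVP => i; rewrite /glue.
case: (@splitP 1 n i) => j ij.
  rewrite (_ : i = lshift n j); last exact/val_inj.
  under eq_fun do rewrite (@row_mxEl _ _ 1) mxE !ord1 eqxx mulr1n.
  exact: measurable_fst.
rewrite (_ : i = rshift 1 j); last exact/val_inj.
under eq_fun do rewrite (@row_mxEr _ _ 1).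
exact: (measurableT_comp (@measurable_rV_coord R n j) measurable_snd).
Qed.

Let munglue : measurable_fun setT unglue.
Proof.
apply/measurable_fun_pairP; split; first exact: measurable_rV_coord.
apply: measurable_fun_rVP => i.
under eq_fun do rewrite /unglue /= mxE.
exact: measurable_rV_coord.
Qed.

Definition lebesgue_rV_step : set 'rV[R]_n.+1 -> \bar R :=
  pushforward (@lebesgue_measure R \x m) glue.

Let pm : {measure set 'rV[R]_n.+1 -> \bar R} :=
  @measure_function_pushforward__canonical__measure_function_Measure
    _ _ _ _ R (@lebesgue_measure R \x m) glue mglue.

HB.instance Definition _ := isMeasure.Build _ _ _ lebesgue_rV_step
  (measure0 pm) (measure_ge0 pm) (@measure_semi_sigma_additive _ _ _ pm).

Let sigma_finite_step : sigma_finite setT lebesgue_rV_step.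
Proof.
have /sigma_finiteP[F [TF ndF Foo]] := sigma_finiteT (@lebesgue_measure R).
have /sigma_finiteP[G [TG ndG Goo]] := sigma_finiteT m.
exists (fun k => unglue @^-1` (F k `*` G k)).
  rewrite -preimage_bigcup (_ : \bigcup_k _ = setT) ?preimage_setT//.
  apply/seteqP; split => // -[x y] _.
  have [i _ Fx] : (\bigcup_k F k) x by rewrite -TF.
  have [j _ Gy] : (\bigcup_k G k) y by rewrite -TG.
  exists (maxn i j) => //; split => /=.
    by move: x Fx; exact/subsetPset/ndF/leq_maxl.
  by move: y Gy; exact/subsetPset/ndG/leq_maxr.
move=> k; have [mF Fk] := Foo k; have [mG Gk] := Goo k; split.
  by rewrite -[X in measurable X]setTI; apply: munglue => //; exact: measurableX.
rewrite /lebesgue_rV_step /pushforward -comp_preimage.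
rewrite (_ : unglue \o glue = id) ?preimage_id; last first.
  by apply/funext => p /=; rewrite glueK.
by rewrite product_measure1E// lte_mul_pinfty// ge0_fin_numE.
Qed.

HB.instance Definition _ := Measure_isSigmaFinite.Build _ _ _
  lebesgue_rV_step sigma_finite_step.

End lebesgue_rV_step.

(* Unit mass on the one-point space R^0; R^(n+1) is identified with R x R^n. *)
Fixpoint lebesgue_rV {R : realType} (n : nat) :
    {sigma_finite_measure set 'rV[R]_n -> \bar R} :=
  match n with
  | 0 => \d_(0 : 'rV[R]_0)
  | n'.+1 => lebesgue_rV_step (lebesgue_rV n')
  end.

(* The norm `|x| of the library on 'rV[R]_n is the sup norm. *)
Definition enorm {R : realType} {n : nat} (x : 'rV[R]_n) : R :=
  Num.sqrt (\sum_(i < n) x ord0 i ^+ 2).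

Definition diam {R : realType} {n : nat} (F : set 'rV[R]_n) : \bar R :=
  ereal_sup [set (enorm (p.1 - p.2))%:E | p in F `*` F].

Definition distance {R : realType} {n : nat} (A B : set 'rV[R]_n) : \bar R :=
  ereal_inf [set (enorm (p.1 - p.2))%:E | p in A `*` B].

Section hausdorff.
Context {R : realType} {n : nat} (s : nat).
Local Open Scope ereal_scope.

(* A set of diameter at most delta weighs as much as an s-dimensional ball of
   the same diameter, so that the s-dimensional Hausdorff measure is normalised
   to be the surface area on s-dimensional submanifolds. *)
Definition hausdorff_weight (delta : R) (F : set 'rV[R]_n) : \bar R :=
  if F == set0 then 0
  else if diam F <= delta%:E
  then @lebesgue_rV R s [set y | (2 * enorm y)%:E <= diam F]
  else +oo.

(* mu_ext takes the infimum over countable covers by measurable sets only. It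
   is the same as over all covers, as a set and its closure have the same
   diameter. *)
Definition hausdorff (A : set 'rV[R]_n) : \bar R :=
  ereal_sup [set mu_ext (hausdorff_weight delta) A |
             delta in [set delta | (0 < delta)%R]].

Let weight0 delta : hausdorff_weight delta set0 = 0.
Proof. by rewrite /hausdorff_weight eqxx. Qed.

Let weight_ge0 delta F : 0 <= hausdorff_weight delta F.
Proof.
rewrite /hausdorff_weight.
by case: ifPn => // _; case: ifPn => // _.
Qed.

Let hausdorff0 : hausdorff set0 = 0.
Proof.
rewrite /hausdorff (_ : [set _ | _ in _] = [set 0]) ?ereal_sup1//.
apply/seteqP; split => [_ [delta _ <-]|_ ->] /=; first exact: mu_ext0.
by exists 1%R => //; exact: mu_ext0.
Qed.

Let hausdorff_ge0 A : 0 <= hausdorff A.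
Proof.
apply: (@le_trans _ _ (mu_ext (hausdorff_weight 1) A)).
  exact/mu_ext_ge0/weight_ge0.
by apply: ereal_sup_ubound; exists 1%R => /=.
Qed.

Let le_hausdorff : {homo hausdorff : A B / A `<=` B >-> A <= B}.
Proof.
move=> A B AB; apply: ge_ereal_sup => _ [delta d0 <-].
apply: (@le_trans _ _ (mu_ext (hausdorff_weight delta) B)).
  exact: le_mu_ext.
by apply: ereal_sup_ubound; exists delta.
Qed.

Let hausdorff_sigma_subadditive : sigma_subadditive hausdorff.
Proof.
move=> F; apply: ge_ereal_sup => _ [delta d0 <-].
apply: (@le_trans _ _ (\sum_(i <oo) mu_ext (hausdorff_weight delta) (F i))).
  by apply: mu_ext_sigma_subadditive => //; exact: weight_ge0.
apply: lee_nneseries => i _ *; first exact: mu_ext_ge0.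
by apply: ereal_sup_ubound; exists delta.
Qed.

HB.instance Definition _ := isOuterMeasure.Build R 'rV[R]_n hausdorff
  hausdorff0 hausdorff_ge0 le_hausdorff hausdorff_sigma_subadditive.

End hausdorff.

Definition surface_outer (R : realType) (d : nat) :
    {outer_measure set 'rV[R]_d -> \bar R} :=
  @hausdorff R d d.-1.

(* The surface measure dS on hypersurfaces of R^d, defined on the
   Caratheodory-measurable sets. *)
Definition surface {R : realType} {d : nat} :
    {measure set (caratheodory_type (surface_outer R d)) -> \bar R} :=
  surface_outer R d.

Section smooth.
Context {R : realType} {n : nat}.

Definition basis_vec (i : 'I_n) : 'rV[R]_n := delta_mx ord0 i.

Fixpoint Cclass (k : nat) (f : 'rV[R]_n -> R) : Prop :=
  match k with
  | 0 => continuous f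
  | k'.+1 => continuous f /\ forall i : 'I_n,
      (forall x, derivable f x (basis_vec i)) /\
      Cclass k' ('D_(basis_vec i) f)
  end.

Definition Cinfty (f : 'rV[R]_n -> R) : Prop := forall k, Cclass k f.

Definition test_function (O : set 'rV[R]_n) (f : 'rV[R]_n -> R) : Prop :=
  Cinfty f /\
  exists K, [/\ compact K, K `<=` O & forall x, ~ K x -> f x = 0].

End smooth.

Section domains.
Context {R : realType} {d : nat}.
Implicit Types A O : set 'rV[R]_d.

Definition frontier A := closure A `\` interior A.

(* Near each boundary point, and up to relabelling and reorienting the axes, O
   is the region above the graph of a smooth function of d - 1 variables. *)
Definition smooth_boundary O := forall x, frontier O x ->
  exists (r : R) (i : 'I_d) (b : bool) (g : 'rV[R]_d.-1 -> R),
    [/\ 0 < r, Cinfty g & forall y, enorm (y - x) < r ->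
      O y <-> 0 < (-1) ^+ b * (y ord0 i - g (col' i y))].

Definition path_in A (f : R -> 'rV[R]_d) :=
  {within `[0, 1], continuous f} /\ f @` `[0, 1] `<=` A.

Definition null_homotopic A (f : R -> 'rV[R]_d) :=
  exists h : R * R -> 'rV[R]_d,
    [/\ {within `[0, 1] `*` `[0, 1], continuous h},
        h @` (`[0, 1] `*` `[0, 1]) `<=` A,
        forall t, t \in `[0, 1] -> h (0, t) = f t /\ h (1, t) = f 0 &
        forall s, s \in `[0, 1] -> h (s, 0) = f 0 /\ h (s, 1) = f 0].

Definition simply_connected A :=
  [/\ A !=set0,
      forall x y, A x -> A y -> exists f, [/\ path_in A f, f 0 = x & f 1 = y] &
      forall f, path_in A f -> f 0 = f 1 -> null_homotopic A f].

End domains.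

Section L2.
Context {dsp} {T : measurableType dsp} {R : realType}.
Variables (mu : {measure set T -> \bar R}) (A : set T).

Definition L2 (f : T -> R) : Prop := f \_ A \in Lfun mu 2%:E.

Definition L2norm (f : T -> R) : R := fine ('N[mu]_2%:E[EFin \o (f \_ A)])%E.

End L2.

Section sobolev.
Context {R : realType} {d : nat}.
Local Notation E := 'rV[R]_d.
Local Notation leb := (@lebesgue_rV R d).
Implicit Types (O : set E) (u : E -> R) (v phi : E -> E).

Definition coord_fun v (j : 'I_d) : E -> R := fun x => v x ord0 j.

Definition is_weak_partial O (i : 'I_d) u (g : E -> R) : Prop :=
  L2 leb O g /\
  forall f, test_function O f ->
    \int[leb]_(x in O) (u x * 'D_(basis_vec i) f x) =
    - \int[leb]_(x in O) (g x * f x).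

Definition H1 O u : Prop :=
  L2 leb O u /\ forall i, exists g, is_weak_partial O i u g.

(* The weak derivative, unique up to a null set, or 0 if there is none. *)
Definition weak_partial O (i : 'I_d) u : E -> R :=
  xget (cst 0) [set g | is_weak_partial O i u g].

Definition H1vec O v : Prop := forall j, H1 O (coord_fun v j).

Definition weak_div O v : E -> R :=
  fun x => \sum_(i < d) weak_partial O i (coord_fun v i) x.

Definition H1norm O v : R :=
  Num.sqrt (\sum_(j < d) (L2norm leb O (coord_fun v j) ^+ 2 +
    \sum_(i < d) L2norm leb O (weak_partial O i (coord_fun v j)) ^+ 2)).

(* phi is the trace on the boundary of O of v in H^1(O; R^d): the limit in
   L^2(dS) of the restrictions to the boundary of smooth vector fields that
   converge to v in H^1(O; R^d). *)
Definition is_trace O v phi : Prop :=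
  exists w : nat -> E -> E,
    [/\ forall k j, Cinfty (coord_fun (w k) j),
        (fun k => H1norm O (fun x => w k x - v x)) @ \oo --> (0 : R),
        forall j, L2 surface (frontier O) (coord_fun phi j) &
        forall j, (fun k => L2norm surface (frontier O)
          (fun x => coord_fun (w k) j x - coord_fun phi j x)) @ \oo --> (0 : R)].

(* Sobolev-Slobodeckij space of the (d - 1)-dimensional boundary of O. *)
Definition H12 O phi : Prop :=
  (forall j, L2 surface (frontier O) (coord_fun phi j)) /\
  (\int[surface]_(x in frontier O) \int[surface]_(y in frontier O)
     (enorm (phi x - phi y) ^+ 2 / enorm (x - y) ^+ d)%:E < +oo)%E.

Definition rigid_motion (r : E -> E) : Prop :=
  (forall x, differentiable r x) /\
  forall x, 2^-1 *: (jacobian r x + (jacobian r x)^T) = 0.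

Definition H12R O phi : Prop :=
  H12 O phi /\
  forall r, rigid_motion r ->
    \int[surface]_(x in frontier O) (\sum_(j < d) phi x ord0 j * r x ord0 j)
    = 0.

Definition Vspace O : set (E -> E) :=
  [set v | H1vec O v /\ exists phi, is_trace O v phi /\ H12R O phi].

End sobolev.

Section geometry.
Context {R : realType} {d : nat}.
Implicit Types (Omega omega A : set 'rV[R]_d).

Definition Ycell : set 'rV[R]_d :=
  [set x | forall i, - 2^-1 < x ord0 i < 2^-1].

Definition rescale (eps : R) (z : 'rV[int]_d) A : set 'rV[R]_d :=
  [set eps *: (map_mx intr z + y) | y in A].

Definition cells Omega (eps : R) : set 'rV[int]_d :=
  [set z | closure (rescale eps z Ycell) `<=` Omega].

Definition inclusions Omega omega (eps : R) : set 'rV[R]_d :=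
  \bigcup_(z in cells Omega eps) rescale eps z omega.

Definition admissible_domain Omega : Prop :=
  [/\ bounded_set Omega, connected Omega, open Omega,
      connected (frontier Omega) & smooth_boundary Omega].

Definition admissible_inclusion omega : Prop :=
  [/\ omega `<=` Ycell /\ open omega, simply_connected omega,
      connected (frontier omega), smooth_boundary omega &
      (0 < distance omega (frontier Ycell))%E].

Definition ae_zero {U : zmodType} A (f : 'rV[R]_d -> U) : Prop :=
  {ae @lebesgue_rV R d, forall x, A x -> f x = 0}.

(* Both spaces consist of functions up to almost everywhere equality. *)
Definition infsup_div Omega (D : set 'rV[R]_d) : \bar R :=
  ereal_inf [set
    ereal_sup [set
      (\int[@lebesgue_rV R d]_(x in D) (weak_div Omega v x * psi x) /
        (H1norm Omega v * L2norm (@lebesgue_rV R d) D psi))%:E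
      | v in [set v | Vspace Omega v /\ ~ ae_zero Omega v]]
    | psi in [set psi | L2 (@lebesgue_rV R d) D psi /\ ~ ae_zero D psi]].

End geometry.

(* Main.v *)
Require Import Defs.
From mathcomp Require Import all_boot all_order all_algebra.
From mathcomp Require Import all_classical all_reals all_analysis.
From mathcomp Require Import measurable_realfun zify ring lra.
Set Implicit Arguments.
Unset Strict Implicit.
Unset Printing Implicit Defensive.
Import Order.TTheory GRing.Theory Num.Theory numFieldNormedType.Exports.
Local Open Scope classical_set_scope.
Local Open Scope ring_scope.

(** Only the divergence on the inclusions matters, and each inclusion stays at a
    distance of order eps from the boundary of its cell. So a test field for a
    given psi in L^2 of the inclusions can be built cell by cell, and no boundary
    value problem on Omega has to be solved.

    In a cell Q of side eps, psi is extended by 0 and approximated in L^2(Q),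
    within half of its norm, by a finite sum P of products of sines. These
    products are the Dirichlet eigenfunctions of the Laplacian on Q; dividing the
    coefficients of P by the eigenvalues solves the Poisson equation, and the
    gradient w of the solution satisfies div w = P. The derivatives of w are sums
    of orthogonal waves, too (ip_wave), and comparing coefficients gives
    |D w| <= |P| and |w| <= eps |P| in L^2(Q). Let chi be a smooth cutoff which is
    1 on the inclusion and 0 outside of Q. Then div (chi w) = P on the inclusion,
    and as |D chi| <= C / eps, the factors eps and 1 / eps cancel:
    |D (chi w)| <= C' |P|, where C' depends only on the distance of omega to the
    boundary of Y (cell_field).

    The sum v of these fields over the finitely many cells is smooth with compact
    support in Omega. Its trace is 0, so that v lies in V (Vspace_vfield). No two
    of the summands are nonzero at the same point; hence the estimates add up to
    a lower bound 3/8 |psi|^2 for the integral of psi div v and to an upper bound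
    for |v|^2 in H^1 by a multiple of |psi|^2 that does not involve eps
    (test_field). Dividing one by the other gives beta.

    Three facts carry this argument. Sine sums are dense in L^2(Q)
    (sine_sums_dense): by a general criterion (approximable_weight), it is enough
    to approximate indicators of octants times the lowest sine, and products of
    the lowest sine with polynomials in cosines do this. The weak derivatives of v
    are its classical ones (weak_partial_test), by integration by parts
    (ip_derive), which Fubini reduces to the fundamental theorem of calculus, and
    by the uniqueness of weak derivatives, which is the fundamental lemma of the
    calculus of variations (ae_eq0_test). The cutoffs are made from the function
    exp (- 1 / t), which belongs to a family of functions whose derivatives are
    combinations of members of the family (Cclass_jet). *)

(** * Square-integrable functions *)
Section square_integrable.
Context {dsp} {T : measurableType dsp} {R : realType}.
Variable mu : {measure set T -> \bar R}.
Implicit Types f g h : T -> R.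

(** Functions and not classes of functions, so that pointwise formulas for
    derivatives and cutoffs apply without choosing representatives. *)
Definition sqint f :=
  measurable_fun setT f /\ mu.-integrable setT (fun x => (f x ^+ 2)%:E).

(** The inner product of L^2. *)
Definition ip f g : R := \int[mu]_x (f x * g x).

Lemma sqint_measurable f : sqint f -> measurable_fun setT f.
Proof. by case. Qed.

Lemma sqint_le f g : measurable_fun setT f -> sqint g ->
  (forall x, `|f x| <= `|g x|) -> sqint f.
Proof.
move=> mf [mg ig] fg; split => //.
apply: (le_integrable _ _ _ ig) => //.
  by apply/measurable_EFinP; exact: measurable_funX.
by move=> x _; rewrite /= lee_fin !normrX lerXn2r ?nnegrE.
Qed.

Lemma integrable_sqintM f g : sqint f -> sqint g ->
  mu.-integrable setT (fun x => (f x * g x)%:E).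
Proof.
move=> [mf jf] [mg jg].
apply: (le_integrable _ _ _ (integrableD _ jf jg)) => //.
  by apply/measurable_EFinP; exact: measurable_funM.
move=> x _; rewrite /= lee_fin [leRHS]ger0_norm ?addr_ge0 ?sqr_ge0//.
by rewrite ler_norml; apply/andP; split; nra.
Qed.

Lemma sqint0 : sqint (fun=> 0).
Proof.
split; first exact: measurable_cst.
by under eq_fun do rewrite expr0n/=; exact: integrable0.
Qed.

Lemma sqintZ a f : sqint f -> sqint (fun x => a * f x).
Proof.
move=> [mf jf]; split; first exact: measurable_funM.
under eq_fun do rewrite exprMn EFinM.
by apply: integrableZl.
Qed.

Lemma sqintD f g : sqint f -> sqint g -> sqint (fun x => f x + g x).
Proof.
move=> sf sg; have [mf jf] := sf; have [mg jg] := sg.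
split; first exact: measurable_funD.
rewrite [X in _.-integrable _ X](_ : _ =
  (fun x => (f x ^+ 2)%:E + ((g x ^+ 2)%:E + 2%:E * (f x * g x)%:E))%E).
  apply: integrableD => //; apply: integrableD => //.
  by apply: integrableZl => //; exact: integrable_sqintM.
by apply/funext => x; rewrite -EFinM -!EFinD; congr EFin; ring.
Qed.

Lemma sqintB f g : sqint f -> sqint g -> sqint (fun x => f x - g x).
Proof.
move=> sf sg; rewrite (_ : (fun x => _) = (fun x => f x + (-1) * g x)).
  exact/sqintD/sqintZ.
by apply/funext => x; rewrite mulN1r.
Qed.

Lemma sqint_sum (I : Type) (r : seq I) (P : pred I) (F : I -> T -> R) :
  (forall i, P i -> sqint (F i)) -> sqint (fun x => \sum_(i <- r | P i) F i x).
Proof.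
move=> sF; elim: r => [|i r ih].
  by under eq_fun do rewrite big_nil; exact: sqint0.
under eq_fun do rewrite big_cons.
by case Pi: (P i) => //; apply: sqintD => //; exact: sF.
Qed.

Lemma ipC f g : ip f g = ip g f.
Proof. by apply: eq_Rintegral => x _; rewrite mulrC. Qed.

Lemma ipZl a f g : sqint f -> sqint g -> ip (fun x => a * f x) g = a * ip f g.
Proof.
move=> sf sg; rewrite /ip; under eq_Rintegral do rewrite -mulrA.
by apply: RintegralZl => //; exact: integrable_sqintM.
Qed.

Lemma ipDl f g h : sqint f -> sqint g -> sqint h ->
  ip (fun x => f x + g x) h = ip f h + ip g h.
Proof.
move=> sf sg sh; rewrite /ip; under eq_Rintegral do rewrite mulrDl.
by apply: RintegralD => //; exact: integrable_sqintM.
Qed.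

Lemma ipBl f g h : sqint f -> sqint g -> sqint h ->
  ip (fun x => f x - g x) h = ip f h - ip g h.
Proof.
move=> sf sg sh; rewrite /ip; under eq_Rintegral do rewrite mulrBl.
by apply: RintegralB => //; exact: integrable_sqintM.
Qed.

Lemma ip0l h : ip (fun=> 0) h = 0.
Proof.
rewrite /ip; under eq_Rintegral do rewrite mul0r.
by rewrite Rintegral_cst ?mul0r.
Qed.

Lemma ip_suml (I : Type) (r : seq I) (P : pred I) (F : I -> T -> R) h :
  (forall i, P i -> sqint (F i)) -> sqint h ->
  ip (fun x => \sum_(i <- r | P i) F i x) h = \sum_(i <- r | P i) ip (F i) h.
Proof.
move=> sF sh; elim: r => [|i r ih].
  by under eq_fun do rewrite big_nil; rewrite ip0l big_nil.
under eq_fun do rewrite big_cons.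
rewrite big_cons; case Pi: (P i) => //.
by rewrite ipDl ?ih//; [exact: sF|exact: sqint_sum].
Qed.

Lemma ip_sumr (I : Type) (r : seq I) (P : pred I) (F : I -> T -> R) h :
  (forall i, P i -> sqint (F i)) -> sqint h ->
  ip h (fun x => \sum_(i <- r | P i) F i x) = \sum_(i <- r | P i) ip h (F i).
Proof.
by move=> sF sh; rewrite ipC ip_suml//; apply: eq_bigr => i _; rewrite ipC.
Qed.

Lemma ip_ge0 f : 0 <= ip f f.
Proof. by apply: Rintegral_ge0 => x _; rewrite -expr2 sqr_ge0. Qed.

Lemma le_ip f g : sqint f -> sqint g -> (forall x, `|f x| <= `|g x|) ->
  ip f f <= ip g g.
Proof.
move=> sf sg fg; apply: le_Rintegral => //; try exact: integrable_sqintM.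
move=> x _; rewrite -!expr2 -(real_normK (num_real (f x))).
by rewrite -(real_normK (num_real (g x))) lerXn2r ?nnegrE.
Qed.

(** Cauchy-Schwarz, from the positivity of the inner square of every linear
    combination of f and g. *)
Lemma ip_CS f g : sqint f -> sqint g -> ip f g ^+ 2 <= ip f f * ip g g.
Proof.
move=> sf sg.
have P a b : 0 <= a ^+ 2 * ip f f + 2 * (a * b) * ip f g + b ^+ 2 * ip g g.
  have := ip_ge0 (fun x => a * f x + b * g x).
  rewrite ipDl; try (by do ?[apply: sqintZ|apply: sqintD]).
  rewrite !ipZl; try (by do ?[apply: sqintZ|apply: sqintD => //; apply: sqintZ]).
  rewrite (ipC f) (ipC g) !ipDl; try (by do ?[apply: sqintZ|apply: sqintD]).
  rewrite !ipZl// (ipC g f); congr (_ <= _); ring.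
have [/eqP g0|g0] := boolP (ip g g == 0).
  have [->|fg0] := eqVneq (ip f g) 0; first by rewrite expr0n g0 mulr0.
  have := P (ip f g) (- (ip f f + 1)).
  have := ip_ge0 f; rewrite g0.
  have : 0 < ip f g ^+ 2 by rewrite exprn_even_gt0.
  by nra.
have {}g0 : 0 < ip g g by rewrite lt_neqAle eq_sym g0 ip_ge0.
have := P (ip g g) (- ip f g).
rewrite [X in 0 <= X](_ : _ = ip g g * (ip f f * ip g g - ip f g ^+ 2)); last ring.
by rewrite pmulr_rge0// subr_ge0.
Qed.

Lemma ip_sqrB f g : sqint f -> sqint g ->
  ip (fun x => f x - g x) (fun x => f x - g x) = ip f f - 2 * ip f g + ip g g.
Proof.
move=> sf sg; have sfg := sqintB sf sg.
rewrite ipBl// (ipC f) (ipC g) !ipBl// (ipC g f); ring.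
Qed.

Lemma ip_sqrD f g : sqint f -> sqint g ->
  ip (fun x => f x + g x) (fun x => f x + g x) <= 2 * ip f f + 2 * ip g g.
Proof.
move=> sf sg.
have := ip_ge0 (fun x => f x - g x); rewrite ip_sqrB// => H.
have sfg := sqintD sf sg.
by rewrite ipDl// (ipC f) (ipC g) !ipDl// (ipC g f); lra.
Qed.

Lemma ip_eq0_ae f : sqint f -> ip f f = 0 -> {ae mu, forall x, f x = 0}.
Proof.
move=> sf f0; have /= := integrable_sqintM sf sf.
move=> jf; have jf' := measurable_int _ jf.
have : (\int[mu]_x `|(f x * f x)%:E|)%E = 0%E.
  have fin := integrable_fin_num measurableT jf.
  under eq_integral do rewrite gee0_abs ?lee_fin -?expr2 ?sqr_ge0//.
  by rewrite -(fineK fin); congr EFin.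
move/(ae_eq_integral_abs mu measurableT jf'); apply: filterS => x /(_ I)/= [].
by move/eqP; rewrite mulf_eq0 orbb => /eqP.
Qed.

Lemma ip_ae_eq f f' g : measurable_fun setT f -> measurable_fun setT f' ->
  measurable_fun setT g -> {ae mu, forall x, f x = f' x} -> ip f g = ip f' g.
Proof.
move=> mf mf' mg ff'; congr fine; apply: ae_eq_integral => //.
- by apply/measurable_EFinP; exact: measurable_funM.
- by apply/measurable_EFinP; exact: measurable_funM.
by apply: filterS ff' => x -> _.
Qed.

End square_integrable.

Import HBNNSimple.

(** * A density criterion in L^2 *)
Section density.
Context {dsp} {T : measurableType dsp} {R : realType}.
Variable mu : {measure set T -> \bar R}.
Implicit Types (f g h : T -> R) (S : set (T -> R)).

Lemma ip_dominated (f_ : nat -> T -> R) f g :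
  (forall n, measurable_fun setT (f_ n)) -> measurable_fun setT f ->
  sqint mu g -> (forall x, f_ ^~ x @ \oo --> f x) ->
  (forall n x, `|f_ n x| <= g x) ->
  sqint mu f /\
  (fun n => ip mu (fun x => f x - f_ n x) (fun x => f x - f_ n x)) @ \oo --> 0.
Proof.
move=> mf_ mf sg f_f f_g.
have fg x : `|f x| <= g x.
  have nf : (fun n => `|f_ n x|) @ \oo --> `|f x| by exact: cvg_norm (f_f x).
  rewrite -(cvg_lim _ nf)//.
  by apply: limr_le; [exact: cvgP nf|exact: nearW].
have g0 x : 0 <= g x := le_trans (normr_ge0 _) (fg x).
have sf : sqint mu f.
  by apply: (sqint_le mf sg) => x; rewrite [leRHS]ger0_norm.
split => //; have [mg _] := sg.
pose h n x := ((f x - f_ n x) * (f x - f_ n x))%:E.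
have mh n : measurable_fun setT (h n).
  by apply/measurable_EFinP/measurable_funM; exact: measurable_funB.
have ig : mu.-integrable setT (fun x => ((2 * g x) * (2 * g x))%:E).
  by apply: integrable_sqintM; exact: sqintZ.
have := @dominated_convergence _ _ _ mu _ measurableT h (cst 0%E)
  (fun x => ((2 * g x) * (2 * g x))%:E) mh (measurable_cst _).
case=> //.
- apply: aeW => x _; rewrite /h /=; apply/cvg_EFin; first exact: nearW.
  rewrite -[X in _ --> X](mulr0 0) /=.
  have c0 : (fun n => f x - f_ n x) @ \oo --> 0.
    by rewrite -[X in _ --> X](subrr (f x)); apply: cvgB => //; exact: cvg_cst.
  exact: cvgM.
- apply: aeW => x n _; rewrite /h /= lee_fin normrM ler_pM//;
    rewrite (le_trans (ler_normB _ _))// mulr2n mulrDl mul1r lerD//.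
move=> _ _; rewrite integral0 => h0; rewrite /ip /Rintegral.
by apply: fine_cvg; exact: h0.
Qed.

(** Membership in the L^2-closure of S. *)
Definition approximable S f :=
  sqint mu f /\ forall delta, 0 < delta ->
    exists2 s, S s & ip mu (fun x => f x - s x) (fun x => f x - s x) <= delta.

Section linear_class.
Variable S : set (T -> R).
Hypothesis S0 : S (fun=> 0).
Hypothesis Slin : forall a f g, S f -> S g -> S (fun x => a * f x + g x).
Hypothesis Ssq : S `<=` sqint mu.

Lemma approximable_mem f : S f -> approximable S f.
Proof.
move=> Sf; split; first exact: Ssq.
move=> delta d0; exists f => //.
under eq_fun do rewrite subrr.
by rewrite ip0l ltW.
Qed.

Lemma approximable_lin a f g : approximable S f -> approximable S g ->
  approximable S (fun x => a * f x + g x).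
Proof.
move=> [sf af] [sg ag]; split; first by apply: sqintD => //; exact: sqintZ.
move=> delta d0.
have c0 : 0 < 4 * (a ^+ 2 + 1) by rewrite mulr_gt0// ltr_wpDl// sqr_ge0.
have [s Ss fs] := af (delta / (4 * (a ^+ 2 + 1))) (divr_gt0 d0 c0).
have [t St gt] := ag (delta / 4) (divr_gt0 d0 (ltr0n _ 4)).
exists (fun x => a * s x + t x); first exact: Slin.
have [ss st] := (Ssq Ss, Ssq St).
rewrite (_ : (fun x => _) =
  (fun x => a * (f x - s x) + (g x - t x))); last by apply/funext => x; ring.
have sfs : sqint mu (fun x => f x - s x) by exact: sqintB.
have sgt : sqint mu (fun x => g x - t x) by exact: sqintB.
have safs := sqintZ a sfs.
apply: (le_trans (ip_sqrD safs sgt)).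
rewrite ipZl// (ipC _ (fun x => f x - s x)) ipZl//.
rewrite ler_pdivlMr// in fs.
have := ip_ge0 mu (fun x => f x - s x).
have := sqr_ge0 a.
by rewrite expr2 in fs *; nra.
Qed.

Lemma approximable_sum (I : Type) (r : seq I) (F : I -> T -> R) (a : I -> R) :
  (forall i, approximable S (F i)) ->
  approximable S (fun x => \sum_(i <- r) a i * F i x).
Proof.
move=> aF; elim: r => [|i r ih].
  by under eq_fun do rewrite big_nil; exact: approximable_mem.
by under eq_fun do rewrite big_cons; exact: approximable_lin.
Qed.

Lemma approximable_closed f : sqint mu f ->
  (forall delta, 0 < delta -> exists2 g, approximable S g &
     ip mu (fun x => f x - g x) (fun x => f x - g x) <= delta) ->
  approximable S f.
Proof.
move=> sf af; split => // delta d0.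
have d4 : 0 < delta / 4 by rewrite divr_gt0.
have [g [sg ag] fg] := af _ d4.
have [s Ss gs] := ag _ d4.
exists s => //; have ss := Ssq Ss.
rewrite (_ : (fun x => _) =
  (fun x => (f x - g x) + (g x - s x))); last by apply/funext => x; ring.
apply: (le_trans (ip_sqrD _ _)); try exact: sqintB.
by lra.
Qed.

(** Dominated convergence makes the class stable under pointwise limits. *)
Lemma approximable_dominated (f_ : nat -> T -> R) f g :
  (forall n, approximable S (f_ n)) -> measurable_fun setT f ->
  sqint mu g -> (forall x, f_ ^~ x @ \oo --> f x) ->
  (forall n x, `|f_ n x| <= g x) -> approximable S f.
Proof.
move=> af mf sg f_f f_g.
have mf_ n : measurable_fun setT (f_ n) by case: (af n) => -[].
have [sf f0] := ip_dominated mf_ mf sg f_f f_g.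
apply: approximable_closed => // delta d0.
have /cvgrPdist_le/(_ _ d0)[n _ /(_ n (leqnn _))] := f0.
rewrite sub0r normrN => H; exists (f_ n) => //.
exact: le_trans (ler_norm _) H.
Qed.

Variables (G : set (set T)) (e : T -> R).
Hypothesis Ggen : @measurable _ T = <<s G >>.
Hypothesis GI : setI_closed G.
Hypothesis se : approximable S e.
Hypothesis e0 : forall x, 0 <= e x.
Hypothesis eG : forall A, G A -> approximable S (fun x => e x * \1_A x).

Let sqe : sqint mu e. Proof. by case: se. Qed.

(** The sets A for which this holds form a lambda-system: complements by
    linearity, countable disjoint unions by dominated convergence. *)
Lemma approximable_indic A : measurable A ->
  approximable S (fun x => e x * \1_A x).
Proof.
move=> mA; have sA : <<s G >> A by rewrite -Ggen.
move: A sA {mA}; apply: dynkin_induction Ggen GI _ eG _ _.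
- by under eq_fun do rewrite indicT mulr1.
- move=> A mA aA.
  have := approximable_lin (-1) aA se; congr (approximable S).
  apply/funext => x; rewrite !indicE in_setC; case: (_ \in _); rewrite /=; ring.
- move=> F mF tF aF.
  apply: (@approximable_dominated
    (fun n x => \sum_(k <- iota 0 n) 1 * (e x * \1_(F k) x)) _ e) => //.
  + by move=> n; exact: (@approximable_sum _ _ (fun k x => e x * \1_(F k) x) (fun=> 1)).
  + apply: measurable_funM; first exact: sqint_measurable sqe.
    by apply: measurable_indic; exact: bigcup_measurable.
  + move=> x; apply: (@cvg_trans _ (\sum_(0 <= k < n) e x * \1_(F k) x @[n --> \oo])).
      apply: near_eq_cvg; apply: nearW => n.
      by rewrite /index_iota subn0; apply: eq_bigr => k _; rewrite mul1r.
    have [[m _ Fm]|nF] := pselect ((\bigcup_k F k) x).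
      apply: cvg_near_cst; exists m.+1 => // n /= mn.
      rewrite (bigD1_seq m) ?mem_index_iota ?iota_uniq//=.
      rewrite big1 ?addr0.
        by rewrite !indicE !mem_set//; exists m.
      move=> k km; rewrite indicE memNset ?mulr0// => Fk.
      by move/eqP: km; apply; apply: (tF k m I I); exists x.
    apply: cvg_near_cst; apply: nearW => n.
    rewrite big1 => [|k _]; first by rewrite indicE memNset ?mulr0.
    by rewrite indicE memNset ?mulr0// => Fk; apply: nF; exists k.
  + move=> n x; rewrite -mulr_sumr mul1r.
    have -> : \sum_(k <- iota 0 n) e x * \1_(F k) x =
        e x * \1_(\big[setU/set0]_(k < n) F k) x.
      rewrite -mulr_sumr; congr (_ * _).
      rewrite -(big_mkord xpredT F) /index_iota subn0.
      have [[k kn Fk]|xF] := pselect (exists2 k, (k \in iota 0 n) & F k x).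
        rewrite (bigD1_seq k) ?iota_uniq//= big1 ?addr0.
          rewrite !indicE !mem_set// -bigcup_seq; by exists k.
        move=> j jk; rewrite indicE memNset// => Fj.
        by move/eqP: jk; apply; apply: (tF j k I I); exists x.
      rewrite big_seq big1 => [|k kn].
        rewrite indicE memNset// -bigcup_seq => -[k kn Fk].
        by apply: xF; exists k.
      by rewrite indicE memNset// => Fk; apply: xF; exists k.
    rewrite indicE normrM ger0_norm// ler_piMr//.
    by case: (_ \in _); rewrite /= ?normr1 ?normr0.
Qed.

(** A weight e with e 1_A in the closure of S for the sets A of a generating
    pi-system makes everything supported in {e > 0} approximable. For f >= 0,
    the quotient f / e is the increasing limit of simple functions, and
    multiplying them by e gives combinations of the functions e 1_A, dominated
    by f. The weight allows for sine sums, which all vanish on the boundary of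
    the cell. *)
Theorem approximable_weight f : sqint mu f ->
  (forall x, e x = 0 -> f x = 0) -> approximable S f.
Proof.
suff P h : sqint mu h -> (forall x, 0 <= h x) ->
    (forall x, e x = 0 -> h x = 0) -> approximable S h.
  move=> sf f0; have [mf _] := sf.
  have sfp : sqint mu (fun x => Num.max (f x) 0).
    apply: (sqint_le _ sf) => [|x]; first exact: measurable_maxr.
    by rewrite maxEle; case: ifP => //; rewrite normr0.
  have sfn : sqint mu (fun x => Num.max (- f x) 0).
    apply: (sqint_le _ sf) => [|x].
      by apply: measurable_maxr => //; exact: measurableT_comp.
    by rewrite maxEle; case: ifP; rewrite ?normrN// normr0.
  have := approximable_lin (-1) (P _ sfn _ _) (P _ sfp _ _).
  rewrite (_ : (fun x => _) = f).
    by apply => x; rewrite ?le_max ?lexx ?orbT// => /f0 ->; rewrite ?oppr0 maxxx.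
  by apply/funext => x; rewrite !maxEle; case: ifP; case: ifP => *; lra.
move=> sh h0 eh; have [mh _] := sh; have [me _] := sqe.
have mg : measurable_fun setT (fun x => (h x / e x)%:E).
  apply/measurable_EFinP; apply: measurable_funM => //.
  under eq_fun do rewrite -powR_inv1//.
  exact: (measurableT_comp (measurable_powR _)).
pose g := nnsfun_approx measurableT mg.
have g0 x : (0 <= (h x / e x)%:E)%E by rewrite lee_fin divr_ge0.
have gcvg x : (fun n => g n x) @ \oo --> h x / e x.
  have /= gg := cvg_nnsfun_approx measurableT mg (fun x _ => g0 x) (I : setT x).
  by have /fine_cvgP[] := gg.
have gh n x : g n x <= h x / e x.
  rewrite -(cvg_lim _ (gcvg x))//; apply: nondecreasing_cvgn_le; last first.
    exact: cvgP (gcvg x).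
  by move=> m k mk; have /lefP := nd_nnsfun_approx measurableT mg mk; apply.
apply: (@approximable_dominated (fun n x => e x * g n x) _ h) => //.
- move=> n.
  rewrite (_ : (fun x => _) = (fun x =>
    \sum_(y <- finmap.enum_fset (fset_set (range (g n)))) y * (e x * \1_(g n @^-1` [set y]) x))).
    by apply: approximable_sum => y; exact: approximable_indic.
  apply/funext => x; rewrite fimfunE fsbig_finite//= mulr_sumr.
  by apply: eq_bigr => y _; rewrite mulrCA.
- move=> x; have [ex|ex] := eqVneq (e x) 0.
    rewrite ex eh//; under eq_fun do rewrite mul0r; exact: cvg_cst.
  rewrite [X in _ --> X](_ : _ = e x * (h x / e x)); last by rewrite mulrCA divff ?mulr1.
  by apply: cvgM => //; exact: cvg_cst.
- move=> n x; rewrite ger0_norm ?mulr_ge0//; have [ex|ex] := eqVneq (e x) 0.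
    by rewrite ex mul0r.
  have {}ex : 0 < e x by rewrite lt_neqAle eq_sym ex e0.
  by rewrite mulrC -ler_pdivlMr.
Qed.

End linear_class.
End density.

(** * Boxes and the Borel sets of R^n *)
Section borel.
Context {R : realType} {n : nat}.
Local Notation E := 'rV[R]_n.
Implicit Types (a b x y : E) (A : set E).

Definition octant a : set E := [set x | forall i, a ord0 i < x ord0 i].
Definition obox a b : set E := [set x | forall i, a ord0 i < x ord0 i < b ord0 i].
Definition cbox a b : set E := [set x | forall i, a ord0 i <= x ord0 i <= b ord0 i].

Lemma measurable_forall dsp (T : measurableType dsp) (I : countType)
    (P : I -> set T) :
  (forall i, measurable (P i)) -> measurable [set x | forall i, P i x].
Proof.
move=> mP; rewrite (_ : [set x | _] = ~` \bigcup_i ~` P i).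
  apply: measurableC; apply: countable_bigcupT_measurable => // i.
  exact: measurableC.
apply/seteqP; split => x /=; first by move=> Px [i _]; exact.
by move=> nP i; apply: contrapT => nPi; apply: nP; exists i.
Qed.

Lemma measurable_coord_preimage (i : 'I_n) (C : set R) :
  measurable (C : set (measurableTypeR R)) -> measurable [set x : E | C (x ord0 i)].
Proof.
move=> mC; rewrite -[X in measurable X]setTI.
exact: (@measurable_rV_coord R n i measurableT C).
Qed.

Lemma measurable_octant a : measurable (octant a).
Proof.
apply: measurable_forall => i.
rewrite (_ : (fun x => _) = [set x : E | `]a ord0 i, +oo[%classic (x ord0 i)]).
  by apply: measurable_coord_preimage; exact: measurable_itv.
by apply/funext => x; rewrite /= in_itv/= andbT.
Qed.

Lemma measurable_obox a b : measurable (obox a b).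
Proof.
apply: measurable_forall => i.
rewrite (_ : (fun x => _) = [set x : E | `]a ord0 i, b ord0 i[%classic (x ord0 i)]).
  by apply: measurable_coord_preimage; exact: measurable_itv.
by apply/funext => x; rewrite /= in_itv/=.
Qed.

Lemma measurable_cbox a b : measurable (cbox a b).
Proof.
apply: measurable_forall => i.
rewrite (_ : (fun x => _) = [set x : E | `[a ord0 i, b ord0 i]%classic (x ord0 i)]).
  by apply: measurable_coord_preimage; exact: measurable_itv.
by apply/funext => x; rewrite /= in_itv/=.
Qed.

Lemma octantI : setI_closed (range octant).
Proof.
move=> _ _ [a _ <-] [b _ <-].
exists (\row_i Num.max (a ord0 i) (b ord0 i)) => //.
apply/seteqP; split => x /=.
  by move=> H; split => i; have := H i; rewrite mxE gt_max => /andP[].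
by move=> [H K] i; rewrite mxE gt_max H K.
Qed.

(** The half space x_i > r is the union of the octants whose other bounds are
    -m, and the half lines generate the Borel sets of the line. *)
Lemma octant_generates : @measurable _ E = <<s range octant >>.
Proof.
apply/seteqP; split.
  apply: smallest_sub; first exact: smallest_sigma_algebra.
  move=> A; rewrite -bigcup_seq => -[i _ [C mC <-]]; rewrite setTI.
  have saG := smallest_sigma_algebra [set: E] (range octant).
  have := sigma_algebra_image (fun x : E => x ord0 i) saG.
  rewrite /image_set_system => saC.
  suff : <<s @RGenOInfty.G R >> `<=`
      [set B : set R | <<s range octant >> ([set: E] `&` (fun x => x ord0 i) @^-1` B)].
    move=> /(_ C) /=; rewrite setTI; apply.
    by move: mC; rewrite [X in X C -> _]RGenOInfty.measurableE.
  apply: smallest_sub => // _ [r ->] /=; rewrite setTI.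
  rewrite (_ : _ @^-1` _ = \bigcup_(m : nat)
      octant (\row_j (if j == i then r else - m%:R))).
    by case: saG => _ _; apply => m; apply: sub_gen_smallest; exists (\row_j (if j == i then r else - m%:R)).
  apply/seteqP; split => x /=; rewrite in_itv/= andbT.
    move=> rx.
    exists (Num.bound (\sum_j `|x ord0 j|)) => // j; rewrite mxE.
    case: eqP => [->//|_]; rewrite ltrNl.
    apply: le_lt_trans (archi_boundP _); last by apply: sumr_ge0.
    rewrite (bigD1 j)//= (le_trans (ler_norm _))// normrN lerDl.
    by apply: sumr_ge0.
  by move=> [m _ /(_ i)]; rewrite mxE eqxx.
apply: smallest_sub; first exact: sigma_algebra_measurable.
by move=> _ [a _ <-]; exact: measurable_octant.
Qed.

Lemma nbhs_cbox_rat x A : nbhs x A -> exists p q : 'rV[rat]_n,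
  obox (map_mx ratr p) (map_mx ratr q) x /\
  cbox (map_mx ratr p) (map_mx ratr q) `<=` A.
Proof.
move=> /nbhs_ballP[e /= e0 xA].
have /choice[p pP] (i : 'I_n) : exists q : rat, x ord0 i - e < ratr q < x ord0 i.
  have /rat_in_itvoo[q] : x ord0 i - e < x ord0 i by rewrite ltrBlDr ltrDl.
  by rewrite in_itv/=; exists q.
have /choice[q qP] (i : 'I_n) : exists q : rat, x ord0 i < ratr q < x ord0 i + e.
  have /rat_in_itvoo[q] : x ord0 i < x ord0 i + e by rewrite ltrDl.
  by rewrite in_itv/=; exists q.
exists (\row_i p i), (\row_i q i); split.
  by move=> i; rewrite !mxE; have /andP[_ ->] := pP i; have /andP[->] := qP i.
move=> y yb; apply: xA; split => // i j; rewrite ord1 /ball/=.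
have := yb j; have := pP j; have := qP j; rewrite !mxE => *.
rewrite ltr_norml; lra.
Qed.

(** Boxes whose closure stays in A, since only those carry test functions on A;
    rational corners make the union countable. *)
Lemma open_bigcup_obox A : open A ->
  A = \bigcup_(pq in [set pq : 'rV[rat]_n * 'rV[rat]_n |
        cbox (map_mx ratr pq.1) (map_mx ratr pq.2) `<=` A])
      obox (map_mx ratr pq.1) (map_mx ratr pq.2).
Proof.
move=> oA; apply/seteqP; split => [x Ax|x [[p q]/= pqA xpq]].
  have [p [q [xpq pqA]]] := nbhs_cbox_rat (open_nbhs_nbhs (conj oA Ax)).
  by exists (p, q).
by apply: pqA => i; have /andP[/ltW -> /ltW ->] := xpq i.
Qed.

Lemma open_measurable_rV A : open A -> measurable A.
Proof.
move=> oA; rewrite (open_bigcup_obox oA) bigcup_mkcond.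
apply: countable_bigcupT_measurable; first exact: countableP.
by move=> pq; case: ifP => // _; exact: measurable_obox.
Qed.

Lemma continuous_measurable_rV (f : E -> R) :
  continuous f -> measurable_fun setT f.
Proof.
move=> /continuousP cf; apply: (measurability _ (RGenOpens.measurableE R)).
move=> _ [_ [a [b ->] <-]]; rewrite setTI.
by apply: open_measurable_rV; apply: cf; exact: interval_open.
Qed.

Lemma compact_cbox a b : compact (cbox a b).
Proof.
have := @rV_compact R n (fun i => `[a ord0 i, b ord0 i]%classic).
rewrite (_ : [set v | _] = cbox a b); last first.
  by apply/seteqP; split => x /= H i; have := H i; rewrite in_itv.
by apply => i; exact: segment_compact.
Qed.

End borel.

(** * Fubini in coordinates *)

(** The chain rule along an affine line, for functions that are only known to
    have a directional derivative. *)
Lemma is_derive_affine (R : numFieldType) (V V' W : normedModType R)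
    (f : V -> W) (gamma : V' -> V) (a v' : V') (v : V) (l : W) :
  (forall h : R, gamma (h *: v' + a) = h *: v + gamma a) ->
  is_derive (gamma a) v f l -> is_derive a v' (f \o gamma) l.
Proof.
move=> gE [df fl].
have E : (fun h => h^-1 *: (((f \o gamma) \o shift a) (h *: v') - (f \o gamma) a)) =
         (fun h => h^-1 *: ((f \o shift (gamma a)) (h *: v) - f (gamma a))).
  by apply/funext => h; rewrite /= gE.
apply: DeriveDef; first by rewrite /derivable E.
by rewrite /derive E.
Qed.

Lemma continuous_rV (T : topologicalType) (R : realType) n (f : T -> 'rV[R]_n) :
  (forall i, continuous (fun t => f t ord0 i)) -> continuous f.
Proof.
move=> cf t; apply/cvg_ballP => e e0.
have : \forall s \near t, forall i : 'I_n, ball (f t ord0 i) e (f s ord0 i).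
  apply: filter_forall => i; move: e e0; apply/cvg_ballP; exact: cf.
by apply: filterS => s H; split => // i j; rewrite ord1.
Qed.

Section glue.
Context {R : realType} {n : nat}.
Implicit Types (t : R) (y : 'rV[R]_n).

(** R x R^n -> R^(n+1), along which Lebesgue measure is defined recursively. *)
Definition glue t y : 'rV[R]_n.+1 := row_mx (t%:M : 'rV_1) y.

Lemma glue0 t y : glue t y ord0 ord0 = t.
Proof.
have -> : (ord0 : 'I_n.+1) = @lshift 1 n ord0 by exact: val_inj.
by rewrite /glue (row_mxEl (t%:M : 'rV_1)) mxE eqxx.
Qed.

Lemma glueS t y j : glue t y ord0 (lift ord0 j) = y ord0 j.
Proof.
have -> : lift ord0 j = @rshift 1 n j by exact: val_inj.
by rewrite /glue (row_mxEr (t%:M : 'rV_1)).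
Qed.

Lemma glue_shift0 h t y :
  glue (h *: 1 + t) y = h *: basis_vec ord0 + glue t y.
Proof.
apply/rowP => i; rewrite [RHS]mxE; case: (unliftP ord0 i) => [j ->|->].
  by rewrite !glueS mxE mxE eqxx /= mulr0 add0r.
by rewrite !glue0 mxE mxE !eqxx.
Qed.

Lemma glue_shiftS h t y j :
  glue t (h *: basis_vec j + y) = h *: basis_vec (lift ord0 j) + glue t y.
Proof.
apply/rowP => i; rewrite [RHS]mxE; case: (unliftP ord0 i) => [k ->|->].
  by rewrite !glueS !mxE eqxx /= (inj_eq lift_inj).
by rewrite !glue0 mxE mxE eqxx /= mulr0 add0r.
Qed.

Lemma continuous_glue1 y : continuous (glue ^~ y).
Proof.
apply: continuous_rV => i; case: (unliftP ord0 i) => [k ->|->].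
  by under eq_fun do rewrite glueS; exact: cst_continuous.
by under eq_fun do rewrite glue0; move=> t; exact: cvg_id.
Qed.

Lemma continuous_glue2 t : continuous (glue t).
Proof.
apply: continuous_rV => i; case: (unliftP ord0 i) => [k ->|->].
  by under eq_fun do rewrite glueS; exact: coord_continuous.
by under eq_fun do rewrite glue0; exact: cst_continuous.
Qed.

Lemma measurable_glue :
  measurable_fun setT (fun p : measurableTypeR R * 'rV[R]_n => glue p.1 p.2).
Proof.
apply: measurable_fun_rVP => i; case: (unliftP ord0 i) => [k ->|->].
  under eq_fun do rewrite glueS.
  exact: (measurableT_comp (@measurable_rV_coord R n k) measurable_snd).
by under eq_fun do rewrite glue0; exact: measurable_fst.
Qed.

Local Open Scope ereal_scope.

Lemma ge0_integral_rVS (f : 'rV[R]_n.+1 -> \bar R) :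
  measurable_fun setT f -> (forall x, 0 <= f x) ->
  \int[lebesgue_rV n.+1]_x f x =
  \int[@lebesgue_measure R \x lebesgue_rV n]_p f (glue p.1 p.2).
Proof.
move=> mf f0.
exact: (ge0_integral_pushforward measurable_glue
  (@lebesgue_measure R \x lebesgue_rV n) measurableT mf).
Qed.

Lemma integrable_rVS (f : 'rV[R]_n.+1 -> \bar R) :
  (lebesgue_rV n.+1).-integrable setT f <->
  measurable_fun setT f /\ (@lebesgue_measure R \x lebesgue_rV n).-integrable setT
    (fun p => f (glue p.1 p.2)).
Proof.
split.
  move=> /integrableP[mf fy]; split => //; apply/integrableP; split.
    exact: (measurableT_comp mf measurable_glue).
  rewrite -(ge0_integral_rVS (f := fun x => `|f x|))//.
  exact: measurableT_comp.
move=> [mf] /integrableP[_ fy]; apply/integrableP; split => //.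
by rewrite ge0_integral_rVS//; exact: measurableT_comp.
Qed.

Lemma integral_rVS (f : 'rV[R]_n.+1 -> \bar R) :
  (lebesgue_rV n.+1).-integrable setT f ->
  \int[lebesgue_rV n.+1]_x f x =
  \int[@lebesgue_measure R \x lebesgue_rV n]_p f (glue p.1 p.2).
Proof.
move=> jf; have [mf jg] := (integrable_rVS f).1 jf.
exact: (integral_pushforward measurable_glue
  (mu := (@lebesgue_measure R \x lebesgue_rV n)) mf jg measurableT).
Qed.

End glue.

Section product_integral.
Context {R : realType}.
Local Notation leb1 := (@lebesgue_measure R).

Lemma integral_prod_coord n (f : 'I_n -> R -> R) :
  (forall i, leb1.-integrable setT (EFin \o f i)) ->
  (lebesgue_rV n).-integrable setT (fun x => (\prod_i f i (x ord0 i))%:E) /\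
  \int[lebesgue_rV n]_x (\prod_i f i (x ord0 i)) = \prod_i \int[leb1]_t f i t.
Proof.
elim: n f => [|n ih] f jf.
  under eq_fun do rewrite big_ord0.
  under eq_Rintegral do rewrite big_ord0.
  rewrite big_ord0 /Rintegral /=; split.
    apply/integrableP; split; first exact: measurable_cst.
    by rewrite integral_dirac// diracT mul1e abse1 ltry.
  by rewrite integral_dirac// diracT mul1e.
have [jg IH] := ih (fun i => f (lift ord0 i)) (fun i => jf _).
pose g (y : 'rV[R]_n) := \prod_i f (lift ord0 i) (y ord0 i).
rewrite -/g in jg IH.
have jf0 := jf ord0; have mf i := measurable_int _ (jf i).
have mg := measurable_int _ jg.
have glueE t y : \prod_i f i (glue t y ord0 i) = f ord0 t * g y.
  rewrite big_ord_recl glue0; congr (_ * _).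
  by apply: eq_bigr => i _; rewrite glueS.
pose F (p : measurableTypeR R * 'rV[R]_n) := (f ord0 p.1 * g p.2)%:E.
have mF : measurable_fun setT F.
  apply/measurable_EFinP; apply: measurable_funM.
    by apply: (measurableT_comp _ measurable_fst); apply/measurable_EFinP.
  by apply: (measurableT_comp _ measurable_snd); apply/measurable_EFinP.
have jF : (leb1 \x lebesgue_rV n)%E.-integrable setT F.
  apply/integrable12ltyP => //.
  have /integrableP[_ gy] := jg.
  have /integrableP[_ fy] := jf0.
  under eq_integral => t _.
    under eq_integral => y _ do rewrite /F /= normrM EFinM.
    rewrite ge0_integralZl//; last first.
      by apply/measurable_EFinP; apply: measurableT_comp => //; apply/measurable_EFinP.
    over.
  rewrite ge0_integralZr//.
  - have f0 : (0 <= \int[leb1]_x `|(f ord0 x)%:E|)%E by exact: integral_ge0.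
    by apply: lte_mul_pinfty => //; rewrite ge0_fin_numE.
  - apply/measurable_EFinP; apply: measurableT_comp => //.
    exact/measurable_EFinP.
  - by apply: integral_ge0.
have jH : (lebesgue_rV n.+1).-integrable setT (fun x => (\prod_i f i (x ord0 i))%:E).
  apply/integrable_rVS; split.
    apply/measurable_EFinP; apply: measurable_prod => i _.
    by apply: (measurableT_comp _ (measurable_rV_coord i)); apply/measurable_EFinP.
  by under eq_fun do rewrite glueE.
split => //; rewrite /Rintegral integral_rVS//.
under eq_integral do rewrite glueE.
rewrite -integral12_prod_meas1// /fubini_F /=.
under eq_integral => t _.
  under eq_integral => y _ do rewrite EFinM.
  rewrite integralZl//. over.
have fin := integrable_fin_num measurableT jg.
rewrite -(fineK fin) integralZr// fineM//.
  by rewrite big_ord_recl -IH.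
exact: integrable_fin_num.
Qed.

End product_integral.

(** * Functions with bounded support *)
Section compact_support.
Context {R : realType}.
Local Notation leb1 := (@lebesgue_measure R).

Definition cube (n : nat) (M : R) : set 'rV[R]_n := [set x | forall i, `|x ord0 i| <= M].

Lemma cubeE n (M : R) : cube M = cbox (const_mx (- M)) (const_mx M) :> set 'rV[R]_n.
Proof.
by apply/seteqP; split => x H i; have := H i; rewrite !mxE ler_norml.
Qed.

Lemma prod_indic_cbox n (a b x : 'rV[R]_n) :
  \prod_i \1_(`[a ord0 i, b ord0 i]%classic) (x ord0 i) = \1_(cbox a b) x :> R.
Proof.
rewrite [RHS]indicE; have [/set_mem xab|/negP xab] := boolP (x \in cbox a b).
  rewrite big1 // => i _; rewrite indicE mem_set//=; have := xab i.
  by rewrite in_itv.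
have /existsNP[i xi] : ~ cbox a b x by move=> H; apply: xab; exact: mem_set.
by rewrite (bigD1 i)//= indicE memNset ?mul0r//= in_itv.
Qed.

Lemma integrable_indic_cbox n (a b : 'rV[R]_n) :
  (lebesgue_rV n).-integrable setT (fun x => (\1_(cbox a b) x)%:E).
Proof.
have [] := @integral_prod_coord R n (fun i => \1_(`[a ord0 i, b ord0 i]%classic)).
  move=> i; apply: integrable_indic_itv.
by under eq_fun do rewrite prod_indic_cbox.
Qed.

Lemma bounded_cbox n (a b : 'rV[R]_n) (f : 'rV[R]_n -> R) : continuous f ->
  exists2 B : R, 0 <= B & forall x, cbox a b x -> `|f x| <= B.
Proof.
move=> cf; have cK : compact (f @` cbox a b).
  apply: continuous_compact; last exact: compact_cbox.
  exact: continuous_subspaceT.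
have [M [_ fM]] := compact_bounded cK.
exists (`|M| + 1); first by rewrite addr_ge0.
move=> x xab; apply: (fM (`|M| + 1)); last by exists x.
by rewrite (le_lt_trans (ler_norm _))// ltrDl.
Qed.

Lemma sqint_bounded_cbox n (a b : 'rV[R]_n) (f : 'rV[R]_n -> R) (B : R) :
  measurable_fun setT f -> (forall x, cbox a b x -> `|f x| <= B) ->
  (forall x, ~ cbox a b x -> f x = 0) -> sqint (lebesgue_rV n) f.
Proof.
move=> mf fB f0; apply: (@sqint_le _ _ _ _ _ (fun x => B * \1_(cbox a b) x)) => //.
  apply: sqintZ; split.
    by apply: measurable_indic; exact: measurable_cbox.
  under eq_fun do rewrite indicE -natrX -mulnn mulnb andbb -indicE.
  exact: integrable_indic_cbox.
move=> x; have [xab|xab] := pselect (cbox a b x).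
  rewrite indicE mem_set// mulr1; exact: le_trans (fB _ xab) (ler_norm _).
by rewrite f0// normr0.
Qed.

Lemma integrable_continuous_cbox n (a b : 'rV[R]_n) (f : 'rV[R]_n -> R) :
  continuous f -> (forall x, ~ cbox a b x -> f x = 0) ->
  (lebesgue_rV n).-integrable setT (EFin \o f).
Proof.
move=> cf f0; have [B B0 fB] := bounded_cbox a b cf.
apply: (le_integrable measurableT _ _
  (integrableZl measurableT B (integrable_indic_cbox a b))).
  by apply/measurable_EFinP; exact: continuous_measurable_rV.
move=> x _; rewrite /= lee_fin.
have [xab|xab] := pselect (cbox a b x).
  rewrite indicE mem_set// mulr1; exact: le_trans (fB _ xab) (ler_norm _).
by rewrite f0// normr0.
Qed.

(** The line version of integral_derive_0: the fundamental theorem of calculus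
    on an interval that contains the support in its interior. *)
Lemma integral_derive1_0 (M : R) (F G : R -> R) :
  continuous G -> (forall t : R, is_derive t (1 : R) F (G t)) ->
  (forall t, M < `|t| -> F t = 0 /\ G t = 0) ->
  (\int[leb1]_t (G t)%:E = 0)%E.
Proof.
move=> cG dF FG0; pose N : R := `|M| + 1.
have MN : M < N by rewrite /N (le_lt_trans (ler_norm _))// ltrDl.
have N0 : 0 < N by rewrite ltr_wpDl.
have cF : continuous F.
  move=> t; apply: differentiable_continuous; apply/derivable1_diffP.
  by case: (dF t).
have -> : (\int[leb1]_t (G t)%:E = \int[leb1]_(t in `[(- N)%R, N]) (G t)%:E)%E.
  rewrite [RHS]integral_mkcond; apply: eq_integral => t _.
  rewrite patchE; case: ifPn => //; rewrite notin_setE/= in_itv/= -ler_norml => /negP.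
  by rewrite -ltNge => Nt; have [_ ->] := FG0 t (lt_trans MN Nt).
rewrite (@continuous_FTC2 _ G F); last first.
- by move=> t _; rewrite derive1E; case: (dF t).
- split; first by move=> t _; case: (dF t).
  + exact: cvg_at_right_filter (cF _).
  + exact: cvg_at_left_filter (cF _).
- exact: continuous_subspaceT.
- by rewrite gtrN.
have [-> _] := FG0 N (lt_le_trans MN (ler_norm _)).
have [-> _] : F (- N) = 0 /\ G (- N) = 0.
  by apply: FG0; rewrite normrN (lt_le_trans MN (ler_norm _)).
by rewrite subee.
Qed.

(** Fubini reduces to the line: along the axis of differentiation the integral
    vanishes by the fundamental theorem of calculus. *)
Lemma integral_derive_0 n (i : 'I_n) (M : R) (F G : 'rV[R]_n -> R) :
  continuous F -> continuous G -> (forall x, is_derive x (basis_vec i) F (G x)) ->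
  (forall x, ~ cube M x -> F x = 0 /\ G x = 0) ->
  (\int[lebesgue_rV n]_x (G x)%:E = 0)%E.
Proof.
elim: n i F G => [[]//|n ih] i F G cF cG dF FG0.
have jG : (lebesgue_rV n.+1).-integrable setT (EFin \o G).
  apply: (integrable_continuous_cbox (a := const_mx (- M)) (b := const_mx M)) => //.
  by move=> x; rewrite -cubeE => /FG0[].
have [_ jGg] := (integrable_rVS _).1 jG.
rewrite integral_rVS//.
case: (unliftP ord0 i) => [j ij|i0].
  rewrite -integral12_prod_meas1// /fubini_F /=.
  rewrite integral0_eq// => t _.
  apply: (ih j (F \o glue t) (G \o glue t)).
  - by move=> y; apply: continuous_comp; [exact: continuous_glue2|exact: cF].
  - by move=> y; apply: continuous_comp; [exact: continuous_glue2|exact: cG].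
  - move=> y; apply: (@is_derive_affine _ _ _ _ F (glue t) _ _ (basis_vec (lift ord0 j))).
      by move=> h; exact: glue_shiftS.
    by rewrite -ij; exact: dF.
  - move=> y yM; apply: FG0 => H; apply: yM => k.
    by have := H (lift ord0 k); rewrite glueS.
rewrite -integral21_prod_meas1// /fubini_G /=.
rewrite integral0_eq// => y _.
apply: (@integral_derive1_0 M (F \o glue ^~ y) (G \o glue ^~ y)).
- by move=> t; apply: continuous_comp; [exact: continuous_glue1|exact: cG].
- move=> t; apply: (@is_derive_affine _ _ _ _ F (glue ^~ y) _ _ (basis_vec ord0)).
    by move=> h; exact: glue_shift0.
  by rewrite -i0; exact: dF.
- move=> t Mt; apply: FG0 => H.
  by have := H ord0; rewrite glue0 leNgt Mt.
Qed.

End compact_support.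

(** * Calculus of smooth functions *)
Section pointwise_derivatives.
Context {R : realType} {V : normedModType R}.
Implicit Types (f g : V -> R) (x v : V).

Lemma is_derive_add f g x v df dg : is_derive x v f df -> is_derive x v g dg ->
  is_derive x v (fun y => f y + g y) (df + dg).
Proof. by move=> *; apply: is_deriveD. Qed.

Lemma is_derive_mul f g x v df dg : is_derive x v f df -> is_derive x v g dg ->
  is_derive x v (fun y => f y * g y) (df * g x + f x * dg).
Proof.
move=> Hf Hg; apply: (is_derive_eq (is_deriveM Hf Hg)).
by rewrite addrC; congr (_ + _); exact: mulrC.
Qed.

Lemma is_derive_inv f x v df : f x != 0 -> is_derive x v f df ->
  is_derive x v (fun y => (f y)^-1) (- (f x)^-1 * (f x)^-1 * df).
Proof.
move=> fx0 [dfx dE]; apply: DeriveDef; first exact: derivableV.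
by rewrite deriveV // dE expr2 invfM mulNr.
Qed.

Lemma is_derive_sum_seq (I : Type) (r : seq I) (F : I -> V -> R) (dF : I -> R) x v :
  (forall i, is_derive x v (F i) (dF i)) ->
  is_derive x v (fun y => \sum_(i <- r) F i y) (\sum_(i <- r) dF i).
Proof.
move=> H; elim: r => [|i r ih].
  under eq_fun do rewrite big_nil; rewrite big_nil; exact: is_derive_cst.
under eq_fun do rewrite big_cons.
by rewrite big_cons; exact: is_derive_add.
Qed.

End pointwise_derivatives.

Section pointwise_continuity.
Context {R : realType} {T : topologicalType}.
Implicit Types f g : T -> R.

Lemma continuous_add f g : continuous f -> continuous g ->
  continuous (fun x => f x + g x).
Proof. by move=> cf cg x; apply: cvgD; [exact: cf|exact: cg]. Qed.

Lemma continuous_mul f g : continuous f -> continuous g ->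
  continuous (fun x => f x * g x).
Proof. by move=> cf cg x; apply: cvgM; [exact: cf|exact: cg]. Qed.

Lemma continuous_inv f : (forall x, f x != 0) -> continuous f ->
  continuous (fun x => (f x)^-1).
Proof. by move=> f0 cf x; apply: cvgV; [exact: f0|exact: cf]. Qed.

End pointwise_continuity.

Section smooth_functions.
Context {R : realType} {n : nat}.
Local Notation E := 'rV[R]_n.
Implicit Types (f g : E -> R) (x : E).

Lemma Cclass_continuous k f : Cclass k f -> continuous f.
Proof. by case: k => [|k] //= []. Qed.

Lemma Cclass_intro k f (df : 'I_n -> E -> R) : continuous f ->
  (forall i x, is_derive x (basis_vec i) f (df i x)) ->
  (forall i, Cclass k (df i)) -> Cclass k.+1 f.
Proof.
move=> cf dfE cdf; split => // i; split; first by move=> x; case: (dfE i x).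
rewrite (_ : 'D_(basis_vec i) f = df i); first exact: cdf.
by apply/funext => x; case: (dfE i x).
Qed.

Lemma Cclass_elim k f : Cclass k.+1 f ->
  forall i, (forall x, is_derive x (basis_vec i) f ('D_(basis_vec i) f x)) /\
            Cclass k ('D_(basis_vec i) f).
Proof.
by move=> [_ H] i; have [d c] := H i; split => // x; apply/derivableP.
Qed.

Lemma CclassS k f : Cclass k.+1 f -> Cclass k f.
Proof.
elim: k f => [|k ih] f; first by case.
move=> H; have cf := Cclass_continuous H; have := Cclass_elim H => {}H.
apply: (Cclass_intro cf) => i; first by have [] := H i.
by apply: ih; have [] := H i.
Qed.

Lemma Cclass_cst k (c : R) : Cclass k (fun _ : E => c).
Proof.
elim: k c => [|k ih] c; first exact: cst_continuous.
apply: (Cclass_intro (df := fun _ _ => 0)).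
- exact: cst_continuous.
- by move=> i; exact: ih.
Qed.

Lemma CclassD k f g : Cclass k f -> Cclass k g -> Cclass k (fun x => f x + g x).
Proof.
elim: k f g => [|k ih] f g Hf Hg.
  exact: continuous_add Hf Hg.
have cf := Cclass_continuous Hf; have cg := Cclass_continuous Hg.
have {}Hf := Cclass_elim Hf; have {}Hg := Cclass_elim Hg.
apply: (Cclass_intro (df := fun i x => 'D_(basis_vec i) f x + 'D_(basis_vec i) g x)).
- exact: continuous_add.
- by move=> i x; apply: is_derive_add; [have [] := Hf i|have [] := Hg i].
- by move=> i; apply: ih; [have [] := Hf i|have [] := Hg i].
Qed.

Lemma CclassM k f g : Cclass k f -> Cclass k g -> Cclass k (fun x => f x * g x).
Proof.
elim: k f g => [|k ih] f g Hf Hg.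
  exact: continuous_mul Hf Hg.
have cf := Cclass_continuous Hf; have cg := Cclass_continuous Hg.
have {}sf := CclassS Hf; have {}sg := CclassS Hg.
have {}Hf := Cclass_elim Hf; have {}Hg := Cclass_elim Hg.
apply: (Cclass_intro
  (df := fun i x => 'D_(basis_vec i) f x * g x + f x * 'D_(basis_vec i) g x)).
- exact: continuous_mul.
- by move=> i x; apply: is_derive_mul; [have [] := Hf i|have [] := Hg i].
- move=> i; apply: CclassD; apply: ih => //; [by have [] := Hf i|by have [] := Hg i].
Qed.

Lemma Cclass_sum (I : Type) (r : seq I) (F : I -> E -> R) k :
  (forall i, Cclass k (F i)) -> Cclass k (fun x => \sum_(i <- r) F i x).
Proof.
move=> HF; elim: r => [|i r ih].
  by under eq_fun do rewrite big_nil; exact: Cclass_cst.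
by under eq_fun do rewrite big_cons; exact: CclassD.
Qed.

Lemma Cclass_prod (I : Type) (r : seq I) (F : I -> E -> R) k :
  (forall i, Cclass k (F i)) -> Cclass k (fun x => \prod_(i <- r) F i x).
Proof.
move=> HF; elim: r => [|i r ih].
  by under eq_fun do rewrite big_nil; exact: Cclass_cst.
by under eq_fun do rewrite big_cons; exact: CclassM.
Qed.

(** The derivative of 1/f is a product of two copies of 1/f and of a derivative
    of f, which are all one class lower, so that induction applies. *)
Lemma CclassV k f : (forall x, f x != 0) -> Cclass k f ->
  Cclass k (fun x => (f x)^-1).
Proof.
move=> f0; elim: k => [|k ih] Hf.
  exact: continuous_inv.
have cf := Cclass_continuous Hf; have sf := CclassS Hf.
have {}Hf := Cclass_elim Hf.
apply: (Cclass_intro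
  (df := fun i x => - (f x)^-1 * (f x)^-1 * 'D_(basis_vec i) f x)).
- exact: continuous_inv.
- by move=> i x; apply: is_derive_inv => //; have [] := Hf i.
- move=> i; apply: CclassM; last by have [] := Hf i.
  apply: CclassM; last exact: ih.
  rewrite (_ : (fun x => _) = (fun x => -1 * (f x)^-1)); last first.
    by apply/funext => x; rewrite mulN1r.
  by apply: CclassM; [exact: Cclass_cst|exact: ih].
Qed.

Lemma is_derive_coord (h : R -> R) (i j : 'I_n) x (dh : R) :
  is_derive (x ord0 i) (1 : R) h dh ->
  is_derive x (basis_vec j) (fun y => h (y ord0 i)) ((i == j)%:R * dh).
Proof.
move=> dhE.
have := @is_derive_affine R _ _ _ h (fun y : E => y ord0 i) x (basis_vec j)
  ((i == j)%:R : R) ((i == j)%:R * dh).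
apply; first by move=> t; rewrite !mxE eqxx.
case: (i == j); first by rewrite mul1r.
by rewrite mul0r; exact: is_derive0.
Qed.

(** In direction j, only the j-th factor varies. *)
Lemma is_derive_prod_coord (h : 'I_n -> R -> R) (dh : R -> R) (j : 'I_n) x :
  is_derive (x ord0 j) (1 : R) (h j) (dh (x ord0 j)) ->
  is_derive x (basis_vec j) (fun y => \prod_i h i (y ord0 i))
    (\prod_i (if i == j then dh else h i) (x ord0 i)).
Proof.
move=> dhE; rewrite (bigD1 j)//= eqxx.
rewrite (eq_bigr (fun i => h i (x ord0 i))); last by move=> i /negbTE ->.
set C := \prod_(i | _) _.
(* along the line through x in direction j, all the other factors are frozen *)
have lineE t : \prod_i h i ((t *: basis_vec j + x) ord0 i) =
    h j (t * 1 + x ord0 j) * C.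
  rewrite (bigD1 j)//= !mxE !eqxx; congr (_ * _).
  apply: eq_bigr => i /negbTE ij; rewrite !mxE eqxx ij /= mulr0 add0r //.
have E0 : (fun t : R => t^-1 *: (((fun y => \prod_i h i (y ord0 i)) \o shift x)
     (t *: basis_vec j) - \prod_i h i (x ord0 i))) =
   (fun t : R => t^-1 *: ((h j \o shift (x ord0 j)) (t *: (1 : R)) - h j (x ord0 j))
     * C).
  apply/funext => t; rewrite /= lineE -[in X in _ - X](add0r x) -(scale0r (basis_vec j)).
  by rewrite lineE mul0r add0r -mulrBl scalerAl.
have {}dhE : (fun t : R => t^-1 *: ((h j \o shift (x ord0 j)) (t *: (1 : R)) -
    h j (x ord0 j)) * C) @ 0^' --> dh (x ord0 j) * C.
  case: dhE => dhj <-; apply: cvgM; last exact: cvg_cst.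
  exact: dhj.
apply: DeriveDef; first by rewrite /derivable E0; apply: cvgP dhE.
by rewrite /derive E0; exact: cvg_lim dhE.
Qed.

End smooth_functions.

Section real_derivatives.
Context {R : realType}.
Implicit Types (a b t : R).

Lemma is_derive_comp_affine (h : R -> R) (dh a b t : R) :
  is_derive (a * t + b) (1 : R) h dh ->
  is_derive t (1 : R) (fun s => h (a * s + b)) (a * dh).
Proof.
move=> dhE.
have dg : is_derive t (1 : R) (fun s => a * s + b) a.
  have := @is_derive_add R R (fun s => a * s) (fun=> b) t 1 (a * 1) 0.
  rewrite addr0 mulr1; apply.
  have := @is_deriveZ R R R id a t 1 1; rewrite /GRing.scale /= mulr1; apply.
by have := @is_derive1_comp R h (fun s => a * s + b) t dh a dhE dg; rewrite mulrC.
Qed.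

(** The phase counts quarter periods, so that differentiating a mode only
    raises its phase: sines and cosines need no separate treatment. *)
Definition tmode a b (m : nat) (t : R) : R := sin (a * (t - b) + m%:R * (pi / 2)).

Lemma is_derive_tmode a b m t :
  is_derive t (1 : R) (tmode a b m) (a * tmode a b m.+1 t).
Proof.
have E s p : a * (s - b) + p = a * s + (p - a * b) by ring.
rewrite /tmode -[m.+1%:R]natr1 (mulrDl m%:R) mul1r addrA sinDpihalf E.
under [X in is_derive _ _ X]eq_fun do rewrite E.
exact: is_derive_comp_affine (is_derive_sin _).
Qed.

Lemma tmode_add2 a b m t : tmode a b m.+2 t = - tmode a b m t.
Proof.
rewrite /tmode -addn2 natrD (mulrDl m%:R) [2 * _]mulrC divfK ?pnatr_eq0// addrA.
by rewrite sinDpi.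
Qed.

Lemma continuous_tmode a b m : continuous (tmode a b m).
Proof.
by move=> t; apply: differentiable_continuous; apply/derivable1_diffP;
  case: (is_derive_tmode a b m t).
Qed.

End real_derivatives.

Section smooth_coordinate.
Context {R : realType} {n : nat}.
Implicit Types i : 'I_n.

(** A family of functions of one variable that is closed under differentiation,
    up to operations that preserve smoothness, consists of smooth functions. *)
Lemma Cclass_jet (I : Type) (h : I -> R -> R) (dh : I -> R -> R) k :
  (forall m t, is_derive t (1 : R) (h m) (dh m t)) ->
  (forall k i, (forall m, Cclass k (fun x : 'rV[R]_n => h m (x ord0 i))) ->
     forall m, Cclass k (fun x : 'rV[R]_n => dh m (x ord0 i))) ->
  forall m i, Cclass k (fun x : 'rV[R]_n => h m (x ord0 i)).
Proof.
move=> hdh closed.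
have ch m i : continuous (fun x : 'rV[R]_n => h m (x ord0 i)).
  move=> x; apply: (@continuous_comp _ _ _ (fun x : 'rV[R]_n => x ord0 i) (h m)).
    exact: coord_continuous.
  by apply: differentiable_continuous; apply/derivable1_diffP; case: (hdh m (x ord0 i)).
elim: k => [|k ih] m i; first exact: ch.
apply: (Cclass_intro (df := fun j x => (i == j)%:R * dh m (x ord0 i))).
- exact: ch.
- by move=> j x; exact: is_derive_coord.
- by move=> j; apply: CclassM; [exact: Cclass_cst|apply: closed => m'; exact: ih].
Qed.

Lemma Cclass_tmode k (a b : R) m i :
  Cclass k (fun x : 'rV[R]_n => tmode a b m (x ord0 i)).
Proof.
apply: (Cclass_jet (h := tmode a b) (dh := fun m t => a * tmode a b m.+1 t)).
  exact: is_derive_tmode.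
by move=> k' i' H m'; apply: CclassM; [exact: Cclass_cst|exact: H].
Qed.

End smooth_coordinate.

(** * A smooth step and smooth cutoffs *)
Section flat.
Context {R : realType}.
Implicit Types (t : R) (m : nat).

(** exp (- 1 / t), continued by 0, and its multiples by powers of 1 / t: the
    derivatives of all of them are combinations of such multiples. *)
Definition flat m t : R := if 0 < t then t^-1 ^+ m * expR (- t^-1) else 0.

Lemma flat_ge0 m t : 0 <= flat m t.
Proof.
rewrite /flat; case: ifPn => // t0.
by rewrite mulr_ge0 ?expR_ge0// exprn_ge0// invr_ge0 ltW.
Qed.

Lemma flat_le0 m t : t <= 0 -> flat m t = 0.
Proof. by rewrite /flat ltNge => ->. Qed.

Lemma flat_gt0 m t : 0 < t -> 0 < flat m t.
Proof.
by move=> t0; rewrite /flat t0 mulr_gt0 ?expR_gt0// exprn_gt0// invr_gt0.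
Qed.

(** Powers lose against the exponential. *)
Lemma flat_le m t : flat m t <= m`!%:R.
Proof.
rewrite /flat; case: ifPn => // t0.
have y0 : 0 < t^-1 by rewrite invr_gt0.
rewrite expRN ler_pdivrMr ?expR_gt0// mulrC -ler_pdivrMr ?ltr0n ?fact_gt0//.
case: m => [|m].
  by rewrite expr0 fact0 divr1 -[leLHS]expR0 ler_expR ltW.
by apply: le_trans (expR_ge1Dxn m (ltW y0)); rewrite lerDr.
Qed.

Lemma flatS m t : 0 < t -> flat m t = t * flat m.+1 t.
Proof.
by move=> t0; rewrite /flat t0 exprS !mulrA divff ?mul1r// gt_eqF.
Qed.

Let is_derive_flat0 m : is_derive (0 : R) (1 : R) (flat m) 0.
Proof.
have H : (fun h : R => h^-1 *: ((flat m \o shift 0) (h *: (1 : R)) - flat m 0)) @ 0^' --> (0 : R).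
  apply/cvgrPdist_le => /= e e0; near=> h.
  rewrite sub0r normrN (flat_le0 m (lexx 0)) subr0 /= addr0.
  rewrite /GRing.scale /= mulr1.
  have [h0|h0] := leP h 0.
    by rewrite flat_le0// mulr0 normr0 ltW.
  rewrite (flatS m h0) mulKf ?gt_eqF//.
  rewrite (flatS m.+1 h0) ger0_norm ?mulr_ge0 ?flat_ge0 ?ltW//.
  apply: (le_lt_trans (ler_wpM2l (ltW h0) (flat_le _ _))).
  rewrite -ltr_pdivlMr ?ltr0n ?fact_gt0//; apply: (le_lt_trans (ler_norm _)).
  near: h; apply: dnbhs0_lt.
  by rewrite divr_gt0// ltr0n fact_gt0.
apply: DeriveDef; first exact: cvgP H.
exact: cvg_lim H.
Unshelve. all: by end_near. Qed.

(** Away from 0 by the product rule; at 0 the difference quotient is the next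
    function of the family, which tends to 0. *)
Lemma is_derive_flat m t :
  is_derive t (1 : R) (flat m) (flat m.+2 t - m%:R * flat m.+1 t).
Proof.
have [t0|t0|->] := ltgtP t 0; last first.
- rewrite !flat_le0// mulr0 subr0; exact: is_derive_flat0.
- have E : \forall s \near t, flat m s = s^-1 ^+ m * expR (- s^-1).
    near=> s; rewrite /flat ifT//.
    by near: s; exact: lt_nbhsr.
  have H : is_derive t (1 : R) (fun s => s^-1 ^+ m * expR (- s^-1))
      (flat m.+2 t - m%:R * flat m.+1 t).
    have dV : is_derive t (1 : R) (fun s : R => s^-1) (- t^-1 * t^-1 * 1).
      apply: is_derive_inv; by rewrite gt_eqF.
    have dX := @is_deriveX _ _ _ m _ _ _ dV.
    have dN := is_deriveN dV.
    have dE := @is_derive1_comp R expR _ t _ _ (is_derive_expR _) dN.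
    rewrite exprfctE in dX.
    apply: (is_derive_eq (is_derive_mul dX dE)).
    rewrite /flat t0 /GRing.scale /=.
    case: m {E dX} => [|m]; first by rewrite !mul0r !expr0; ring.
    by rewrite /= !exprS; ring.
  by apply: near_eq_is_derive H; apply: filterS E => s ->.
- have E : \forall s \near t, flat m s = cst 0 s.
    near=> s; rewrite flat_le0//; apply: ltW.
    by near: s; exact: lt_nbhsl.
  have := @is_derive_cst R R R 0 t 1.
  rewrite !(flat_le0 _ (ltW t0)) mulr0 subr0 => H.
  by apply: near_eq_is_derive H; apply: filterS E => s ->.
Unshelve. all: by end_near. Qed.

End flat.

Section step.
Context {R : realType}.
Implicit Types (t : R).

Let den t : R := flat 0 t + flat 0 (1 - t).

Let den_ge t : expR (- 2) <= den t.
Proof.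
have P s : 2^-1 <= s -> expR (- 2) <= flat 0 s :> R.
  move=> s2; have s0 : 0 < s by apply: lt_le_trans s2; rewrite invr_gt0.
  rewrite /flat s0 expr0 mul1r ler_expR lerN2.
  by rewrite -[leRHS]invrK lef_pV2// posrE invr_gt0.
have [t2|t2] := leP 2^-1 t.
  by apply: le_trans (P _ t2) _; rewrite lerDl flat_ge0.
apply: le_trans (P (1 - t) _) _; last by rewrite lerDr flat_ge0.
by lra.
Qed.

Let den_gt0 t : 0 < den t.
Proof. exact: lt_le_trans (expR_gt0 _) (den_ge t). Qed.

(** The denominator has no zero, since t and 1 - t are not both
    nonpositive. *)
Definition step t : R := flat 0 t / den t.

Definition dstep t : R := flat 2 t * (den t)^-1 +
  flat 0 t * (- (den t)^-1 * (den t)^-1 * (flat 2 t - flat 2 (1 - t))).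

Lemma step_ge0 t : 0 <= step t.
Proof. by rewrite divr_ge0 ?flat_ge0 ?ltW. Qed.

Lemma step_le1 t : step t <= 1.
Proof. by rewrite ler_pdivrMr// mul1r lerDl flat_ge0. Qed.

Lemma step_le0 t : t <= 0 -> step t = 0.
Proof. by move=> t0; rewrite /step flat_le0// mul0r. Qed.

Lemma step_ge1 t : 1 <= t -> step t = 1.
Proof.
move=> t1; rewrite /step /den (flat_le0 _ (t := 1 - t)) ?subr_le0// addr0 divff//.
by rewrite gt_eqF// flat_gt0// (lt_le_trans _ t1).
Qed.

Lemma dstep_le0 t : t <= 0 -> dstep t = 0.
Proof. by move=> t0; rewrite /dstep !(flat_le0 _ t0) !mul0r addr0. Qed.

Lemma dstep_ge1 t : 1 <= t -> dstep t = 0.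
Proof.
move=> t1; rewrite /dstep /den !(flat_le0 _ (t := 1 - t)) ?subr_le0// addr0 subr0.
have t0 : flat 0 t != 0 by rewrite gt_eqF// flat_gt0// (lt_le_trans _ t1).
by field.
Qed.

Lemma dstep_bounded : exists2 L : R, 0 <= L & forall t, `|dstep t| <= L.
Proof.
pose c : R := expR (- 2); have c0 : 0 < c := expR_gt0 _.
exists (2 * c^-1 + c^-1 * c^-1 * 2).
  by rewrite addr_ge0// ?mulr_ge0 ?invr_ge0 ?ltW.
move=> t; have f2 s : `|flat 2 s| <= 2 :> R by rewrite ger0_norm ?flat_ge0 ?flat_le.
have f0 : `|flat 0 t| <= 1 :> R by rewrite ger0_norm ?flat_ge0 ?flat_le.
have dc : `|(den t)^-1| <= c^-1.
  have d0 := ltW (den_gt0 t).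
  by rewrite ger0_norm ?invr_ge0// lef_pV2 ?posrE.
have fd : `|flat 2 t - flat 2 (1 - t)| <= 2 :> R.
  have H (s : R) : flat 2 s <= 2 := flat_le 2 s.
  have := H t; have := H (1 - t); have := flat_ge0 2 t; have := flat_ge0 2 (1 - t).
  by rewrite ler_norml => *; lra.
rewrite /dstep (le_trans (ler_normD _ _))// lerD//.
  by rewrite normrM ler_pM.
rewrite normrM -[leRHS]mul1r ler_pM// normrM ler_pM// normrM normrN ler_pM//.
Qed.

Lemma is_derive_step t : is_derive t (1 : R) step (dstep t).
Proof.
have df := @is_derive_flat R 0 t; rewrite mul0r subr0 in df.
have dg : is_derive t (1 : R) (fun s => flat 0 (1 - s)) (- flat 2 (1 - t)).
  have := @is_derive_flat R 0 (-1 * t + 1); rewrite mul0r subr0 => /is_derive_comp_affine.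
  rewrite mulN1r (addrC _ 1) mulN1r.
  by under [X in is_derive _ _ X]eq_fun do rewrite mulN1r addrC.
have dd := is_derive_add df dg.
have dV := is_derive_inv (f := den) (lt0r_neq0 (den_gt0 t)) dd.
exact: is_derive_mul df dV.
Qed.

End step.

Section smooth_step.
Context {R : realType} {n : nat}.
Implicit Types i : 'I_n.

Lemma Cclass_flat k (a b : R) m i :
  Cclass k (fun x : 'rV[R]_n => flat m (a * x ord0 i + b)).
Proof.
apply: (Cclass_jet (h := fun m t => flat m (a * t + b))
  (dh := fun m t => a * (flat m.+2 (a * t + b) + (- m%:R) * flat m.+1 (a * t + b)))).
  move=> m' t; apply: is_derive_comp_affine; rewrite mulNr; exact: is_derive_flat.
move=> k' i' H m'; apply: CclassM; first exact: Cclass_cst.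
apply: CclassD; first exact: H.
by apply: CclassM; [exact: Cclass_cst|exact: H].
Qed.

Lemma Cclass_step k (a b : R) i :
  Cclass k (fun x : 'rV[R]_n => step (a * x ord0 i + b)).
Proof.
apply: CclassM; first exact: Cclass_flat.
apply: CclassV.
  move=> x; rewrite gt_eqF//.
  have [t0|t0] := ltP 0 (a * x ord0 i + b).
    by rewrite ltr_wpDr ?flat_ge0 ?flat_gt0.
  by rewrite ltr_wpDl ?flat_ge0// flat_gt0// subr_gt0 (le_lt_trans t0).
apply: CclassD; first exact: Cclass_flat.
rewrite (_ : (fun x => _) = (fun x : 'rV[R]_n => flat 0 (- a * x ord0 i + (1 - b)))).
  exact: Cclass_flat.
by apply/funext => x; congr flat; ring.
Qed.

End smooth_step.

Section cutoff.
Context {R : realType}.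
Implicit Types (A l u t : R).

(** A cutoff to the interval from l to u, equal to 1 at distance at least 1 / A
    from both end points. *)
Definition cut A l u t : R := step (A * (t - l)) * step (A * (u - t)).

Definition dcut A l u t : R :=
  A * dstep (A * (t - l)) * step (A * (u - t)) +
  step (A * (t - l)) * (- A * dstep (A * (u - t))).

Lemma is_derive_cut A l u t : is_derive t (1 : R) (cut A l u) (dcut A l u t).
Proof.
have E1 s : A * (s - l) = A * s + (- (A * l)) by ring.
have E2 s : A * (u - s) = - A * s + A * u by ring.
rewrite /cut /dcut; under [X in is_derive _ _ X]eq_fun do rewrite E1 E2.
by rewrite E1 E2; apply: is_derive_mul; apply: is_derive_comp_affine;
  exact: is_derive_step.
Qed.

Lemma cut_ge0 A l u t : 0 <= cut A l u t.
Proof. by rewrite mulr_ge0// step_ge0. Qed.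

Lemma cut_le1 A l u t : cut A l u t <= 1.
Proof. by rewrite -[leRHS]mulr1 ler_pM ?step_ge0 ?step_le1. Qed.

Lemma cut_out A l u t : 0 <= A -> ~~ (l < t < u) ->
  cut A l u t = 0 /\ dcut A l u t = 0.
Proof.
rewrite negb_and -!leNgt => A0 /orP[tl|ut]; rewrite /cut /dcut.
  have tl0 : A * (t - l) <= 0 by rewrite mulr_ge0_le0// subr_le0.
  by rewrite (step_le0 tl0) (dstep_le0 tl0) mulr0 !mul0r addr0.
have ut0 : A * (u - t) <= 0 by rewrite mulr_ge0_le0// subr_le0.
by rewrite (step_le0 ut0) (dstep_le0 ut0) !mulr0 addr0.
Qed.

Lemma cut_in A l u t : 1 <= A * (t - l) -> 1 <= A * (u - t) ->
  cut A l u t = 1 /\ dcut A l u t = 0.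
Proof.
move=> H K; rewrite /cut /dcut (step_ge1 H) (step_ge1 K) (dstep_ge1 H) (dstep_ge1 K).
by rewrite !mulr0 mulr1 mul0r addr0.
Qed.

Lemma dcut_le L A l u t : 0 <= A -> (forall s, `|dstep s| <= L) ->
  `|dcut A l u t| <= 2 * A * L.
Proof.
move=> A0 sL; have L0 : 0 <= L := le_trans (normr_ge0 _) (sL 0).
have s1 s : `|step s| <= 1 by rewrite ger0_norm ?step_ge0 ?step_le1.
have -> : 2 * A * L = A * L + A * L by ring.
have AL s : `|A * dstep s| <= A * L.
  by rewrite normrM ger0_norm// ler_wpM2l.
rewrite /dcut (le_trans (ler_normD _ _))// lerD// normrM.
  by rewrite -[leRHS]mulr1 ler_pM ?AL ?s1.
by rewrite -[leRHS]mul1r ler_pM ?s1// mulNr normrN AL.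
Qed.

Lemma Cclass_cut n k A l u (i : 'I_n) :
  Cclass k (fun x : 'rV[R]_n => cut A l u (x ord0 i)).
Proof.
have E1 s : A * (s - l) = A * s + (- (A * l)) by ring.
have E2 s : A * (u - s) = - A * s + A * u by ring.
rewrite /cut; under eq_fun do rewrite E1 E2.
by apply: CclassM; exact: Cclass_step.
Qed.

(** As the slope increases, the cutoffs exhaust the open interval. *)
Lemma cvg_cut (l u t : R) :
  (fun m => cut m%:R l u t) @ \oo --> (if l < t < u then 1 else 0 : R).
Proof.
have [/andP[lt tu]|tlu] := boolP (l < t < u); last first.
  apply: cvg_near_cst; apply: nearW => m.
  by have [-> _] := cut_out (ler0n R m) tlu.
have lt0 : 0 < t - l by rewrite subr_gt0.
have tu0 : 0 < u - t by rewrite subr_gt0.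
apply: cvg_near_cst; near=> m; have [] // := @cut_in m%:R l u t.
- rewrite -ler_pdivrMr// mul1r; near: m; exact: nbhs_infty_ger.
- rewrite -ler_pdivrMr// mul1r; near: m; exact: nbhs_infty_ger.
Unshelve. all: by end_near. Qed.

End cutoff.

(** * L^2 norms as inner products *)
Section L2_sqint.
Context {dsp} {T : measurableType dsp} {R : realType}.
Variable mu : {measure set T -> \bar R}.
Implicit Types (A : set T) (f : T -> R).

Lemma Lnorm2_sqr f :
  ('N[mu]_2%:E[EFin \o f] `^ 2 = \int[mu]_x (f x ^+ 2)%:E)%E.
Proof.
rewrite poweR_Lnorm ?pnatr_eq0//; apply: eq_integral => x _ /=.
by rewrite powR_mulrn// real_normK ?num_real.
Qed.

Lemma L2_sqint A f : L2 mu A f <-> sqint mu (f \_ A).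
Proof.
rewrite /L2; set g := f \_ A; split.
  move=> H; split; last exact: Lfun2_integrable_sqr.
  by move/sub_Lfun_mfun: H; rewrite inE.
move=> [mg /integrableP[_ gy]].
apply/andP; split; first by rewrite inE.
rewrite inE /= /finite_norm ltey; apply/eqP => Ny.
have := Lnorm2_sqr g; rewrite Ny poweRyr ?pnatr_eq0// => E.
suff : (\int[mu]_x (g x ^+ 2)%:E < +oo)%E by rewrite -E ltxx.
apply: le_lt_trans gy; apply: le_trans (lee_abs _) (le_abse_integral _ _ _) => //.
by apply/measurable_EFinP; exact: measurable_funX.
Qed.

Lemma L2norm_ge0 A f : 0 <= L2norm mu A f.
Proof. exact/fine_ge0/Lnorm_ge0. Qed.

Lemma L2norm_sqr A f : L2norm mu A f ^+ 2 = ip mu (f \_ A) (f \_ A).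
Proof.
rewrite -powR_mulrn ?L2norm_ge0// /L2norm -fine_poweR Lnorm2_sqr.
by congr fine; apply: eq_integral => x _; rewrite expr2.
Qed.

Lemma L2norm0 A : L2norm mu A (fun=> 0) = 0.
Proof.
rewrite /L2norm (_ : _ \_ A = cst 0); last first.
  by apply/funext => x; rewrite patchE; case: ifP.
by rewrite (_ : _ \o _ = cst 0%E)// Lnorm0.
Qed.

Lemma L2_0 A : L2 mu A (fun=> 0).
Proof.
apply/L2_sqint; rewrite (_ : _ \_ A = fun=> 0); first exact: sqint0.
by apply/funext => x; rewrite patchE; case: ifP.
Qed.

End L2_sqint.

(** * Test functions and the fundamental lemma of the calculus of variations *)
Section cutbox.
Context {R : realType} {n : nat}.
Implicit Types (l u x : 'rV[R]_n) (A : R).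

Definition cutbox A l u x : R := \prod_i cut A (l ord0 i) (u ord0 i) (x ord0 i).

Lemma Cclass_cutbox A l u k : Cclass k (cutbox A l u).
Proof. by apply: Cclass_prod => i; exact: Cclass_cut. Qed.

Lemma cutbox_ge0 A l u x : 0 <= cutbox A l u x.
Proof. by apply: prodr_ge0 => i _; exact: cut_ge0. Qed.

Lemma cutbox_le1 A l u x : cutbox A l u x <= 1.
Proof. by apply: prodr_ile1 => i _; rewrite cut_ge0 cut_le1. Qed.

Lemma cutbox_out A l u x : 0 <= A -> ~ obox l u x -> cutbox A l u x = 0.
Proof.
move=> A0 /existsNP[i /negP xi]; rewrite /cutbox (bigD1 i)//=.
by have [-> _] := cut_out A0 xi; rewrite mul0r.
Qed.

(** Test functions converge boundedly to the indicator of a box: this is how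
    they approximate L^2 functions. *)
Lemma cvg_cutbox l u x :
  (fun m => cutbox m%:R l u x) @ \oo --> (\1_(obox l u) x : R).
Proof.
rewrite (_ : \1_(obox l u) x =
  \prod_i (if l ord0 i < x ord0 i < u ord0 i then 1 else 0 : R)).
  rewrite /cutbox; elim: (index_enum _) => [|i r ih].
    by under eq_fun do rewrite big_nil; rewrite big_nil; exact: cvg_cst.
  under eq_fun do rewrite big_cons; rewrite big_cons.
  by apply: cvgM => //; exact: cvg_cut.
rewrite indicE; have [/set_mem xb|/negP xb] := boolP (x \in obox l u).
  by rewrite big1// => i _; rewrite ifT//; exact: xb.
have /existsNP[i /negP/negbTE xi] : ~ obox l u x by move=> H; apply: xb; exact: mem_set.
by rewrite (bigD1 i)//= xi mul0r.
Qed.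

End cutbox.

Lemma ae_countable dsp (T : measurableType dsp) (R : realType)
    (mu : {measure set T -> \bar R}) (I : countType) (P : I -> T -> Prop) :
  (forall i, {ae mu, forall x, P i x}) -> {ae mu, forall x, forall i, P i x}.
Proof.
move=> aeP.
have : mu.-negligible (\bigcup_k [set x | ~ (if unpickle k is Some i then P i x else True)]).
  apply: negligible_bigcup => k; case: (unpickle k) => [i|]; first exact: aeP.
  by apply: (negligibleS _ (negligible_set0 mu)) => x; apply; exact: Logic.I.
apply: negligibleS => x /= /existsNP[i Pi]; exists (pickle i) => //=.
by rewrite pickleK.
Qed.

Section test_functions.
Context {R : realType} {n : nat}.
Local Notation E := 'rV[R]_n.
Local Notation leb := (@lebesgue_rV R n).
Implicit Types (O : set E) (f g h : E -> R) (l u x : E).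

Let box_test l u : set (E -> R) :=
  [set f | Cinfty f /\ forall x, ~ cbox l u x -> f x = 0].

Let box_test_sqint l u : box_test l u `<=` sqint leb.
Proof.
move=> f [sf f0]; have cf := Cclass_continuous (sf 0).
have [B _ fB] := bounded_cbox l u cf.
by apply: (sqint_bounded_cbox _ fB f0); exact: continuous_measurable_rV.
Qed.

Lemma obox_cbox l u : obox l u `<=` cbox l u.
Proof. by move=> x xb i; have /andP[/ltW -> /ltW ->] := xb i. Qed.

Lemma sqint_indic_cbox l u : sqint leb (\1_(cbox l u) : E -> R).
Proof.
apply: (@sqint_bounded_cbox _ _ l u _ 1).
- by apply: measurable_indic; exact: measurable_cbox.
- by move=> x; rewrite indicE; case: (_ \in _); rewrite ?normr1 ?normr0.
- by move=> x xb; rewrite indicE memNset.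
Qed.

Let box_indicator l u l' : (forall i, l ord0 i <= l' ord0 i) ->
  approximable leb (box_test l u) (\1_(obox l' u)).
Proof.
move=> ll'.
have sub : obox l' u `<=` cbox l u.
  by move=> x xb i; have /andP[/ltW h /ltW ->] := xb i; rewrite (le_trans (ll' i)).
apply: (@approximable_dominated _ _ _ leb (box_test l u) (@box_test_sqint l u)
    (fun m => cutbox m%:R l' u) _ (\1_(cbox l u))).
- move=> m; apply: approximable_mem; first exact: box_test_sqint.
  split; first by move=> k; exact: Cclass_cutbox.
  by move=> x xb; apply: cutbox_out => // /sub.
- by apply: measurable_indic; exact: measurable_obox.
- exact: sqint_indic_cbox.
- by move=> x; exact: cvg_cutbox.
- move=> m x; rewrite ger0_norm ?cutbox_ge0// indicE.
  have [xb|xb] := boolP (x \in cbox l u); first exact: cutbox_le1.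
  by rewrite cutbox_out// => /sub xb'; move/negP: xb; apply; exact: mem_set.
Qed.

Let box_dense l u f : sqint leb f -> (forall x, ~ obox l u x -> f x = 0) ->
  approximable leb (box_test l u) f.
Proof.
move=> sf f0.
apply: (@approximable_weight _ _ _ leb (box_test l u) _ _ _ (range octant)
    (\1_(obox l u))) => //.
- by split => [k|x //]; exact: Cclass_cst.
- move=> a g h [sg g0] [sh h0]; split => [k|x xb].
    by apply: CclassD => //; apply: CclassM => //; exact: Cclass_cst.
  by rewrite g0// h0// mulr0 addr0.
- exact: octant_generates.
- exact: octantI.
- exact: box_indicator.
- move=> A [a _ <-].
  rewrite (_ : (fun x => _) = \1_(obox (\row_i Num.max (a ord0 i) (l ord0 i)) u)).
    by apply: box_indicator => i; rewrite mxE le_max lexx orbT.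
  transitivity (\1_(obox l u `&` octant a) : E -> R).
    by apply/funext => x; rewrite indicI.
  congr (\1_ _); apply/seteqP; split => x /=.
    move=> [xb xa] i; rewrite mxE gt_max.
    by have /andP[-> ->] := xb i; rewrite xa.
  move=> H; split=> i; have := H i; rewrite mxE gt_max => /andP[/andP[]] //.
  by move=> _ -> ->.
- move=> x; rewrite indicE; case: (boolP (x \in obox l u)) => /=.
    by move=> _ /eqP; rewrite oner_eq0.
  by move=> /negP xb _; apply: f0 => H; apply: xb; exact: mem_set.
Qed.

(** The fundamental lemma of the calculus of variations. On a box whose closure
    lies in O, the restriction of h is an L^2-limit of test functions on O, to
    which h is orthogonal; hence its norm is 0. Countably many boxes cover O. *)
Lemma ae_eq0_test O h : open O -> sqint leb h ->
  (forall f, test_function O f -> ip leb h f = 0) ->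
  {ae leb, forall x, O x -> h x = 0}.
Proof.
move=> oO sh hf.
have box0 l u : cbox l u `<=` O ->
    {ae leb, forall x, obox l u x -> h x = 0}.
  move=> bO; pose g x := \1_(obox l u) x * h x.
  have sg : sqint leb g.
    apply: (sqint_le _ sh) => [|x].
      apply: measurable_funM; last exact: sqint_measurable sh.
      by apply: measurable_indic; exact: measurable_obox.
    rewrite /g normrM indicE.
    by case: (_ \in _); rewrite ?normr1 ?mul1r ?normr0 ?mul0r.
  have [_ ag] : approximable leb (box_test l u) g.
    by apply: box_dense => // x xb; rewrite /g indicE memNset ?mul0r.
  have gg : ip leb g g = ip leb h g.
    apply: eq_Rintegral => x _; rewrite /g indicE.
    by case: (_ \in _); rewrite ?mul1r ?mul0r ?mulr0.
  have /eqP gg0 : ip leb g g == 0.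
    apply/contraT => gneq.
    have g0 : 0 < ip leb g g by rewrite lt_neqAle eq_sym gneq ip_ge0.
    have h1 : 0 < ip leb h h + 1 by rewrite ltr_wpDl// ip_ge0.
    (* so small that Cauchy-Schwarz contradicts |g|^2 = <h, g - s> *)
    have d0 : 0 < ip leb g g ^+ 2 / (ip leb h h + 1) / 2.
      by rewrite !divr_gt0// exprn_gt0.
    have [s Ss gs] := ag _ d0.
    have ss := box_test_sqint Ss.
    have hs : ip leb h s = 0.
      apply: hf; case: Ss => sms s0; split => //; exists (cbox l u); split => //.
      exact: compact_cbox.
    have sgs : sqint leb (fun x => g x - s x) by exact: sqintB.
    have := ip_CS sh sgs.
    rewrite (ipC _ h (fun x => g x - s x)) ipBl// (ipC _ s) hs subr0 (ipC _ g) -gg.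
    move: gs; rewrite -mulrA -invfM ler_pdivlMr ?mulr_gt0// => gs.
    have := ip_ge0 leb h; have := ip_ge0 leb (fun x => g x - s x).
    have : 0 < ip leb g g ^+ 2 by rewrite exprn_gt0.
    by nra.
  apply: filterS (ip_eq0_ae sg gg0) => x; rewrite /g => + xb.
  by rewrite indicE mem_set// mul1r.
have H : {ae leb, forall x, forall pq : 'rV[rat]_n * 'rV[rat]_n,
  cbox (map_mx ratr pq.1) (map_mx ratr pq.2) `<=` O ->
  obox (map_mx ratr pq.1) (map_mx ratr pq.2) x -> h x = 0}.
  apply: ae_countable => pq.
  have [pqO|npqO] := pselect (cbox (map_mx ratr pq.1 : E) (map_mx ratr pq.2) `<=` O).
    by apply: filterS (box0 _ _ pqO) => x.
  exact: aeW.
apply: filterS H => x P Ox; have := Ox.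
by rewrite {1}(open_bigcup_obox oO) => -[pq pqO xpq]; exact: P pqO xpq.
Qed.

End test_functions.

(** * Weak derivatives of test functions *)
Lemma coord_le_norm (R : realType) n (x : 'rV[R]_n) i : `|x ord0 i| <= `|x|.
Proof.
rewrite [leRHS]/Num.norm /= mx_normrE.
exact: (le_bigmax _ (fun ij : 'I_1 * 'I_n => `|x ij.1 ij.2|) (ord0, i)).
Qed.

Section test_derivatives.
Context {R : realType} {n : nat}.
Local Notation E := 'rV[R]_n.
Local Notation leb := (@lebesgue_rV R n).
Implicit Types (O : set E) (f u g : E -> R) (x : E).
Local Notation "'d_ i u" := ('D_(basis_vec i) u) (at level 10, i at next level).

Lemma Cinfty_derive u i : Cinfty u -> Cinfty ('d_ i u).
Proof. by move=> su k; have [] := Cclass_elim (su k.+1) i. Qed.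

Lemma Cinfty_continuous u : Cinfty u -> continuous u.
Proof. by move=> su; exact: (Cclass_continuous (su 0)). Qed.

Lemma Cinfty_is_derive u i x : Cinfty u -> is_derive x (basis_vec i) u ('d_ i u x).
Proof. by move=> su; have [] := Cclass_elim (su 1) i. Qed.

Lemma test_function_derive O u i : test_function O u -> test_function O ('d_ i u).
Proof.
move=> [su [K [cK KO u0]]]; split; first exact: Cinfty_derive.
exists K; split => // x Kx.
have oK : open (~` K).
  by apply: closed_openC; apply: compact_closed => //; exact: norm_hausdorff.
have u0x : \forall y \near x, u y = cst 0 y.
  by have := open_nbhs_nbhs (conj oK Kx); apply: filterS => y /u0.
by rewrite (near_eq_derive _ u0x) derive_cst.
Qed.

Lemma test_function_out O u x : test_function O u -> ~ O x -> u x = 0.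
Proof. by move=> [_ [K [_ KO u0]]] Ox; apply: u0 => /KO. Qed.

Lemma test_function_patch O u : test_function O u -> u \_ O = u.
Proof.
move=> tu; apply/funext => x; rewrite patchE; case: ifPn => //.
by move=> /negP Ox; rewrite (test_function_out tu)// => H; apply: Ox; exact: mem_set.
Qed.

Lemma test_function_cube O u : test_function O u ->
  exists M, forall x, ~ cube M x -> u x = 0.
Proof.
move=> [_ [K [cK _ u0]]]; have [M [_ KM]] := compact_bounded cK.
exists (`|M| + 1) => x xM; apply: u0 => Kx; apply: xM => i.
apply: le_trans (coord_le_norm _ _) _; apply: KM => //.
by rewrite (le_lt_trans (ler_norm _))// ltrDl.
Qed.

Lemma test_function_sqint O u : test_function O u -> sqint leb u.
Proof.
move=> tu; have [M u0] := test_function_cube tu; have cu := Cinfty_continuous tu.1.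
have [B _ uB] := bounded_cbox (const_mx (- M)) (const_mx M) cu.
apply: (sqint_bounded_cbox _ uB); last by move=> x; rewrite -cubeE => /u0.
exact: continuous_measurable_rV.
Qed.

Lemma test_function0 O : test_function O (fun=> 0).
Proof.
split; first by move=> k; exact: Cclass_cst.
by exists set0; split => //; exact: compact0.
Qed.

(** Integration by parts: the derivative of u f has integral 0. *)
Lemma ip_derive O O' u f i : test_function O u -> test_function O' f ->
  ip leb u ('d_ i f) = - ip leb ('d_ i u) f.
Proof.
move=> tu tf; apply/eqP; rewrite -subr_eq0 opprK.
have [su sf] := (test_function_sqint tu, test_function_sqint tf).
have [tdu tdf] := (test_function_derive i tu, test_function_derive i tf).
have [sdu sdf] := (test_function_sqint tdu, test_function_sqint tdf).
have [M u0] := test_function_cube tu; have [M' du0] := test_function_cube tdu.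
pose M'' := Num.max M M'.
have cubeM x : ~ cube M'' x -> u x = 0 /\ 'd_ i u x = 0.
  move=> xM; split; [apply: u0 => H|apply: du0 => H]; apply: xM => j;
  by rewrite le_max (H j) ?orbT.
have [cu cf] := (Cinfty_continuous tu.1, Cinfty_continuous tf.1).
have [cdu cdf] := (Cinfty_continuous tdu.1, Cinfty_continuous tdf.1).
have := @integral_derive_0 R n i M'' (fun x => u x * f x)
  (fun x => 'd_ i u x * f x + u x * 'd_ i f x).
move=> H; have {}H : (\int[leb]_x ('d_ i u x * f x + u x * 'd_ i f x)%:E = 0)%E.
  apply: H.
  - exact: continuous_mul.
  - by apply: continuous_add; exact: continuous_mul.
  - by move=> x; apply: is_derive_mul; apply: Cinfty_is_derive; [exact: tu.1|exact: tf.1].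
  - by move=> x /cubeM[-> ->]; rewrite !mul0r addr0.
rewrite addrC /ip -RintegralD//; try exact: integrable_sqintM.
by rewrite /Rintegral H.
Qed.

Lemma Rintegral_patchM O u g : \int[leb]_(x in O) (u x * g x) =
  ip leb (u \_ O) (g \_ O).
Proof.
rewrite Rintegral_mkcond; apply: eq_Rintegral => x _.
by rewrite !patchE; case: ifP => //; rewrite mulr0.
Qed.

Lemma is_weak_partial_test O u i :
  test_function O u -> is_weak_partial O i u ('d_ i u).
Proof.
move=> tu; have tdu := test_function_derive i tu; split.
  by apply/L2_sqint; rewrite test_function_patch//; exact: test_function_sqint tdu.
move=> f tf; have tdf := test_function_derive i tf.
rewrite !Rintegral_patchM !(test_function_patch tu, test_function_patch tf,
  test_function_patch tdu, test_function_patch tdf).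
exact: ip_derive tu tf.
Qed.

Lemma weak_partial_unique O u i g g' : open O -> L2 leb O u ->
  is_weak_partial O i u g -> is_weak_partial O i u g' ->
  {ae leb, forall x, (g \_ O) x = (g' \_ O) x}.
Proof.
move=> oO u2 [/L2_sqint sg Hg] [/L2_sqint sg' Hg'].
have sh := sqintB sg sg'.
have : {ae leb, forall x, O x -> (g \_ O) x - (g' \_ O) x = 0}.
  apply: ae_eq0_test => // f tf; have sf := test_function_sqint tf.
  rewrite ipBl//; have := Hg f tf; rewrite (Hg' f tf) => /oppr_inj.
  rewrite !Rintegral_patchM (test_function_patch tf) => ->.
  exact: subrr.
apply: filterS => x H.
have [/H/eqP|Ox] := pselect (O x); first by rewrite subr_eq0 => /eqP.
by rewrite !patchE !memNset.
Qed.

(** The weak derivative is an unspecified choice among all candidates; by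
    uniqueness it agrees with the classical derivative almost everywhere. *)
Lemma weak_partial_test O u i : open O -> test_function O u ->
  is_weak_partial O i u (weak_partial O i u) /\
  {ae leb, forall x, (weak_partial O i u \_ O) x = 'd_ i u x}.
Proof.
move=> oO tu; have dP := is_weak_partial_test i tu.
have wP : is_weak_partial O i u (weak_partial O i u).
  exact: (xgetPex (cst 0) (ex_intro _ _ dP)).
split => //; have u2 : L2 leb O u.
  by apply/L2_sqint; rewrite test_function_patch//; exact: test_function_sqint tu.
have := weak_partial_unique oO u2 wP dP.
by rewrite (test_function_patch (test_function_derive i tu)).
Qed.

Lemma test_function_H1 O u : test_function O u -> H1 O u.
Proof.
move=> tu; split.
  by apply/L2_sqint; rewrite test_function_patch//; exact: test_function_sqint tu.
by move=> i; exists ('d_ i u); exact: is_weak_partial_test.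
Qed.

Lemma L2norm_test O u : test_function O u -> L2norm leb O u ^+ 2 = ip leb u u.
Proof. by move=> tu; rewrite L2norm_sqr test_function_patch. Qed.

Lemma L2norm_weak_partial_test O u i : open O -> test_function O u ->
  L2norm leb O (weak_partial O i u) ^+ 2 = ip leb ('d_ i u) ('d_ i u).
Proof.
move=> oO tu; rewrite L2norm_sqr.
have [[/L2_sqint sw _] wd] := weak_partial_test i oO tu.
have sd := test_function_sqint (test_function_derive i tu).
have [mw md] := (sqint_measurable sw, sqint_measurable sd).
by rewrite (ip_ae_eq mw md mw wd) ipC (ip_ae_eq mw md md wd).
Qed.

End test_derivatives.

(** * Polynomials that converge to a jump *)
Section threshold.
Context {R : realType}.
Implicit Types (y z r : R).

Lemma bernoulli z N : -1 <= z -> 1 + N%:R * z <= (1 + z) ^+ N.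
Proof.
move=> z1; elim: N => [|N ih]; first by rewrite mul0r addr0 expr0.
have z0 : 0 <= 1 + z by lra.
rewrite exprS; apply: le_trans (ler_wpM2l z0 ih).
rewrite -natr1; have := sqr_ge0 z; have := ler0n R N; rewrite expr2; nra.
Qed.

Lemma cvg_nat_geometric r : 0 <= r < 1 -> (fun m => m%:R * r ^+ m) @ \oo --> (0 : R).
Proof.
move=> /andP[]; rewrite le_eqVlt => /predU1P[<- _|r0 r1].
  by apply: cvg_near_cst; exists 1 => // -[|m]//= _; rewrite exprS mul0r mulr0.
pose s := (1 + r) / 2; pose c := (s / r - 1)^-1.
have rs : r < s by rewrite /s; lra.
have s1 : s < 1 by rewrite /s; lra.
have s0 : 0 < s by exact: lt_trans rs.
have q1 : 0 < s / r - 1 by rewrite subr_gt0 ltr_pdivlMr// mul1r.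
have c0 : 0 < c by rewrite invr_gt0.
have H : (fun m => c * s ^+ m) @ \oo --> (0 : R).
  rewrite -[X in _ --> X](mulr0 c); apply: cvgM; first exact: cvg_cst.
  by apply: cvg_expr; rewrite ger0_norm// ltW.
apply: (squeeze_cvgr _ (cvg_cst 0) H).
apply: nearW => m; rewrite mulr_ge0 ?exprn_ge0 ?(ltW r0)//=.
have := @bernoulli (s / r - 1) m; rewrite subrKC => B.
have {}B : 1 + m%:R * (s / r - 1) <= (s / r) ^+ m by apply: B; lra.
have rm : 0 < r ^+ m by rewrite exprn_gt0.
rewrite /c [leRHS]mulrC ler_pdivlMr//.
have -> : s ^+ m = (s / r) ^+ m * r ^+ m.
  by rewrite -exprMn divfK// gt_eqF.
rewrite mulrAC ler_wpM2r ?(ltW rm)//; apply: le_trans B.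
by rewrite lerDr.
Qed.

(** Powers of polynomials in y that converge to the indicator of y < 1/2; the
    factor m in the exponent makes them vanish at the jump, too. *)
Definition threshold m y : R := (1 - y ^+ m) ^+ (m * 2 ^ m).

Lemma threshold_ge0 m y : 0 <= y <= 1 -> 0 <= threshold m y.
Proof.
by move=> /andP[y0 y1]; rewrite exprn_ge0// subr_ge0 exprn_ile1.
Qed.

Lemma threshold_le1 m y : 0 <= y <= 1 -> threshold m y <= 1.
Proof.
move=> /andP[y0 y1]; rewrite exprn_ile1// ?subr_ge0 ?exprn_ile1//.
by rewrite gerBl exprn_ge0.
Qed.

(** For y < 1/2, Bernoulli bounds the power below by 1 - m (2 y)^m. For
    y >= 1/2, the product with (1 + y^m)^(m 2^m) is at most 1, and this factor
    is at least 1 + m, again by Bernoulli. *)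
Lemma cvg_threshold y : 0 <= y <= 1 ->
  (fun m => threshold m y) @ \oo --> (if y < 2^-1 then 1 else 0 : R).
Proof.
move=> y01; have /andP[y0 y1] := y01.
have NE m : (m * 2 ^ m)%:R * y ^+ m = m%:R * (2 * y) ^+ m :> R.
  by rewrite natrM natrX -mulrA exprMn.
case: ifPn => [y2|]; last rewrite -leNgt => y2.
  have r1 : 0 <= 2 * y < 1 by lra.
  have H : (fun m => 1 - m%:R * (2 * y) ^+ m) @ \oo --> (1 : R).
    rewrite -[X in _ --> X](subr0 1); apply: cvgB; first exact: cvg_cst.
    exact: cvg_nat_geometric.
  apply: (@squeeze_cvgr _ _ _ _ _ (fun=> 1) _ _ 1 H); last exact: cvg_cst.
  apply: nearW => m; rewrite threshold_le1// andbT.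
  have := @bernoulli (- y ^+ m) (m * 2 ^ m); rewrite mulrN NE; apply.
  by rewrite lerN2 exprn_ile1.
apply: (squeeze_cvgr _ (cvg_cst 0) (@cvg_harmonic R)).
apply: nearW => m; rewrite threshold_ge0//= /threshold.
have ym : 0 <= y ^+ m by rewrite exprn_ge0.
have ym1 : y ^+ m <= 1 by rewrite exprn_ile1.
rewrite -[leRHS]mul1r ler_pdivlMr//.
apply: (@le_trans _ _ ((1 - y ^+ m) ^+ (m * 2 ^ m) * (1 + y ^+ m) ^+ (m * 2 ^ m))).
  rewrite ler_wpM2l ?exprn_ge0 ?subr_ge0//.
  have : 1 + (m * 2 ^ m)%:R * y ^+ m <= (1 + y ^+ m) ^+ (m * 2 ^ m).
    by apply: bernoulli; lra.
  apply: le_trans; rewrite NE -natr1 addrC lerD2l -[leLHS]mulr1 ler_wpM2l//.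
  by rewrite exprn_ege1//; lra.
rewrite -exprMn exprn_ile1//.
  by rewrite mulr_ge0 ?subr_ge0 ?addr_ge0.
by have := sqr_ge0 (y ^+ m); rewrite expr2; nra.
Qed.

End threshold.

(** * Orthogonality of waves *)
Section orthogonality1.
Context {R : realType}.
Local Notation leb1 := (@lebesgue_measure R).
Variables (a e : R).
Hypothesis e0 : 0 < e.

Lemma sin_natpi (k : nat) : sin (k%:R * pi) = 0 :> R.
Proof.
elim: k => [|k ih]; first by rewrite mul0r sin0.
by rewrite -natr1 mulrDl mul1r sinDpi ih oppr0.
Qed.

Lemma integrable_segment (f : R -> R) (b c : R) : continuous f ->
  leb1.-integrable setT (fun t => (\1_(`[b, c]%classic) t * f t)%:E).
Proof.
move=> cf; have : leb1.-integrable `[b, c] (EFin \o f).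
  apply: continuous_compact_integrable; first exact: segment_compact.
  exact: continuous_subspaceT.
rewrite integrable_mkcond//; congr (_.-integrable _ _).
apply/funext => t; rewrite restrict_EFin /= patchE indicE.
by case: ifP; rewrite ?mul1r ?mul0r.
Qed.

Lemma Rintegral_segment (f F : R -> R) (b c : R) : b < c -> continuous f ->
  (forall t, is_derive t (1 : R) F (f t)) ->
  \int[leb1]_t (\1_(`[b, c]%classic) t * f t) = F c - F b.
Proof.
move=> bc cf dF.
have cF : continuous F.
  by move=> t; apply: differentiable_continuous; apply/derivable1_diffP; case: (dF t).
have -> : \int[leb1]_t (\1_(`[b, c]%classic) t * f t) = \int[leb1]_(t in `[b, c]) f t.
  rewrite [RHS]Rintegral_mkcond; apply: eq_Rintegral => t _.
  by rewrite patchE indicE; case: ifP; rewrite ?mul1r ?mul0r.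
rewrite /Rintegral (@continuous_FTC2 _ f F)//.
- exact: continuous_subspaceT.
- split; first by move=> t _; case: (dF t).
  + exact: cvg_at_right_filter (cF _).
  + exact: cvg_at_left_filter (cF _).
- by move=> t _; rewrite derive1E; case: (dF t).
Qed.

Let continuous_cosaffine (g p : R) : continuous (fun t => cos (g * (t - a) + p)).
Proof.
move=> t; apply: (@continuous_comp _ _ _ (fun t => g * (t - a) + p) cos);
  last exact: continuous_cos.
apply: cvgD; last exact: cvg_cst.
apply: cvgM; first exact: cvg_cst.
by apply: cvgB; [exact: cvg_id|exact: cvg_cst].
Qed.

Let cosint (g p : R) : g != 0 -> sin (g * e + p) = sin p ->
  \int[leb1]_t (\1_(`[a, a + e]%classic) t * cos (g * (t - a) + p)) = 0.
Proof.
move=> g0 gp.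
have E t : g * (t - a) + p = g * t + (p - g * a) by ring.
have dF t : is_derive t (1 : R) (fun t => g^-1 * sin (g * t + (p - g * a)))
    (cos (g * (t - a) + p)).
  rewrite E; apply: (is_derive_eq (is_derive_mul (@is_derive_cst R R R g^-1 t 1)
    (is_derive_comp_affine (is_derive_sin (g * t + (p - g * a)))))).
  by rewrite mul0r add0r mulKf.
rewrite (Rintegral_segment _ (@continuous_cosaffine g p) dF) ?ltrDl//.
have -> : g * (a + e) + (p - g * a) = g * e + p by ring.
have -> : g * a + (p - g * a) = p by ring.
by rewrite gp subrr.
Qed.

Definition freq (k : nat) : R := k.+1%:R * pi / e.

Lemma freq_gt0 k : 0 < freq k.
Proof. by rewrite /freq divr_gt0// mulr_gt0 ?pi_gt0. Qed.

Lemma freq_ge k : e^-1 <= freq k.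
Proof.
rewrite /freq -[leLHS]mul1r ler_pM2r ?invr_gt0//.
by have := @pi_ge2 R => p2; rewrite -[leLHS]mulr1 ler_pM// ?ler1n//; lra.
Qed.

(** The product of two modes is a difference of two cosines, with frequencies
    A - B and A + B. Over the interval, each runs through a whole number of half
    periods, starting at an extremum, and integrates to 0 unless A = B. *)
Lemma Rintegral_tmode (k l m : nat) :
  \int[leb1]_t (\1_(`[a, a + e]%classic) t *
    (tmode (freq k) a m t * tmode (freq l) a m t)) = (if k == l then e / 2 else 0).
Proof.
pose A := freq k; pose B := freq l.
have en : e != 0 by rewrite gt_eqF.
have sinm : sin (m%:R * pi) = 0 := sin_natpi m.
have prodE t : tmode A a m t * tmode B a m t =
   2^-1 * cos ((A - B) * (t - a) + 0) - 2^-1 * cos ((A + B) * (t - a) + m%:R * pi).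
  rewrite /tmode; set X := A * _ + _; set Y := B * _ + _.
  have -> : (A - B) * (t - a) + 0 = X - Y by rewrite /X /Y; ring.
  have -> : (A + B) * (t - a) + m%:R * pi = X + Y.
    by rewrite /X /Y; field.
  by rewrite (cosB X Y) (cosD X Y); field.
have cc (g p : R) : continuous (fun t => 2^-1 * cos (g * (t - a) + p)).
  by apply: continuous_mul; [exact: cst_continuous|exact: continuous_cosaffine].
have scal (g p : R) : \int[leb1]_t (\1_(`[a, a + e]%classic) t * (2^-1 * cos (g * (t - a) + p)))
   = 2^-1 * \int[leb1]_t (\1_(`[a, a + e]%classic) t * cos (g * (t - a) + p)).
  under eq_Rintegral do rewrite mulrCA.
  by apply: RintegralZl => //; exact: integrable_segment.
under eq_Rintegral do rewrite prodE mulrBr.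
rewrite RintegralB//; try exact: integrable_segment.
rewrite !scal.
rewrite (cosint (g := A + B)); last 2 first.
- by rewrite gt_eqF// addr_gt0 ?freq_gt0.
- have -> : (A + B) * e + m%:R * pi = (k.+1 + l.+1 + m)%:R * pi.
    by rewrite /A /B /freq !natrD; field.
  by rewrite sin_natpi sinm.
case: eqP => [kl|/eqP kl].
  have -> : A - B = 0 by rewrite /A /B kl subrr.
  under eq_Rintegral do rewrite mul0r addr0 cos0.
  have H := @Rintegral_segment (fun=> 1) id a (a + e).
  rewrite H ?ltrDl//; first by rewrite addrAC subrr add0r mulr0 subr0 mulrC.
  exact: cst_continuous.
rewrite cosint ?mulr0 ?subr0//.
- apply/eqP => /subr0_eq AB; move/eqP: kl; apply; apply/eqP.
  have : A * e / pi = B * e / pi by rewrite AB.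
  have pn : pi != 0 :> R by rewrite gt_eqF ?pi_gt0.
  by rewrite /A /B /freq !divfK// !mulfK// => /eqP; rewrite eqr_nat eqSS.
- have -> : (A - B) * e + 0 = k.+1%:R * pi - l.+1%:R * pi by rewrite /A /B /freq; field.
  by rewrite sinB !sin_natpi mul0r mulr0 subr0 sin0.
Qed.

End orthogonality1.

Section waves.
Context {R : realType} {n : nat}.
Local Notation E := 'rV[R]_n.
Local Notation leb := (@lebesgue_rV R n).
Local Notation index := {ffun 'I_n -> nat}.
Variables (a : E) (e : R).
Hypothesis e0 : 0 < e.
Implicit Types (k l : index) (b : 'I_n -> nat) (c : index -> R) (r : seq index).

Let Q : set E := cbox a (a + const_mx e).

(** A product of sines and cosines; b counts the derivatives taken in each
    variable. *)
Definition mode k b (x : E) : R := \prod_i tmode (freq e (k i)) (a ord0 i) (b i) (x ord0 i).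

Definition wave c r b (x : E) : R := \sum_(k <- r) c k * mode k b x.

Definition incr b (j i : 'I_n) : nat := if i == j then (b i).+1 else b i.

Lemma is_derive_mode k b j x :
  is_derive x (basis_vec j) (mode k b) (freq e (k j) * mode k (incr b j) x).
Proof.
have := @is_derive_prod_coord R n
  (fun i => tmode (freq e (k i)) (a ord0 i) (b i))
  (fun t => freq e (k j) * tmode (freq e (k j)) (a ord0 j) (b j).+1 t) j x
  (is_derive_tmode _ _ _ _).
move=> H; apply: (is_derive_eq H); rewrite /mode (bigD1 j)//= eqxx [in RHS](bigD1 j)//= /incr eqxx.
rewrite mulrA; congr (_ * _); apply: eq_bigr => i ij.
by rewrite (negbTE ij).
Qed.

Lemma mode_incr2 k b i x : mode k (incr (incr b i) i) x = - mode k b x.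
Proof.
rewrite /mode (bigD1 i)//= [in RHS](bigD1 i)//= /incr eqxx tmode_add2 mulNr.
by congr (- (_ * _)); apply: eq_bigr => j ji; rewrite (negbTE ji).
Qed.

Lemma Cclass_wave c r b m : Cclass m (wave c r b).
Proof.
apply: Cclass_sum => k; apply: CclassM; first exact: Cclass_cst.
by apply: Cclass_prod => i; exact: Cclass_tmode.
Qed.

Lemma is_derive_wave c r b j x : is_derive x (basis_vec j) (wave c r b)
  (wave (fun k => c k * freq e (k j)) r (incr b j) x).
Proof.
have H k : is_derive x (basis_vec j) (fun y => c k * mode k b y)
    (0 * mode k b x + c k * (freq e (k j) * mode k (incr b j) x)).
  apply: (is_derive_mul (f := fun=> c k)); exact: is_derive_mode.
apply: (is_derive_eq (is_derive_sum_seq r H)).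
by apply: eq_bigr => k _; rewrite mul0r add0r mulrA.
Qed.

Lemma sqint_cbox_mul (f : E -> R) : continuous f -> sqint leb (fun x => \1_Q x * f x).
Proof.
move=> cf; have [B _ fB] := bounded_cbox a (a + const_mx e) cf.
apply: (@sqint_bounded_cbox _ _ a (a + const_mx e) _ B).
- apply: measurable_funM; last exact: continuous_measurable_rV.
  by apply: measurable_indic; exact: measurable_cbox.
- by move=> x xQ; rewrite indicE mem_set// mul1r fB.
- by move=> x xQ; rewrite indicE memNset// mul0r.
Qed.

Lemma continuous_wave c r b : continuous (wave c r b).
Proof. exact: (Cclass_continuous (Cclass_wave c r b 0)). Qed.

Lemma continuous_mode k b : continuous (mode k b).
Proof.
have : Cclass 0 (mode k b) by apply: Cclass_prod => i; exact: Cclass_tmode.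
exact: Cclass_continuous.
Qed.

Lemma ip_mode k l b :
  ip leb (fun x => \1_Q x * mode k b x) (fun x => \1_Q x * mode l b x) =
  if k == l then (e / 2) ^+ n else 0.
Proof.
pose f i t : R := \1_(`[a ord0 i, a ord0 i + e]%classic) t *
  (tmode (freq e (k i)) (a ord0 i) (b i) t * tmode (freq e (l i)) (a ord0 i) (b i) t).
have jf i : (@lebesgue_measure R).-integrable setT (EFin \o f i).
  by apply: integrable_segment; apply: continuous_mul; exact: continuous_tmode.
have [_] := integral_prod_coord jf.
have -> : \int[leb]_x \prod_i f i (x ord0 i) =
  ip leb (fun x => \1_Q x * mode k b x) (fun x => \1_Q x * mode l b x).
  apply: eq_Rintegral => x _; rewrite /f !big_split /=.
  have -> : \prod_i \1_(`[a ord0 i, a ord0 i + e]%classic) (x ord0 i) = \1_Q x :> R.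
    rewrite /Q -prod_indic_cbox; apply: eq_bigr => i _.
    by rewrite !mxE.
  rewrite -[X in _ = _ * _ * (_ * X)]/(mode l b x) indicE.
  by case: (x \in Q); rewrite ?mul1r ?mul0r.
move=> ->; under eq_bigr do rewrite Rintegral_tmode//.
case: eqP => [->|/eqP kl].
  by under eq_bigr do rewrite eqxx; rewrite prodr_const card_ord.
have /existsP[i kli] : [exists i, k i != l i].
  apply/existsP; apply: contrapT => H; move/eqP: kl; apply; apply/ffunP => i.
  by apply/eqP/negPn/negP => kli; apply: H; exists i.
by rewrite (bigD1 i)//= (negbTE kli) mul0r.
Qed.

(** The right-hand side does not depend on b: all norm estimates for derivatives
    of waves reduce to a comparison of coefficients. *)
Lemma ip_wave c r b : uniq r ->
  ip leb (fun x => \1_Q x * wave c r b x) (fun x => \1_Q x * wave c r b x) =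
  (e / 2) ^+ n * \sum_(k <- r) c k ^+ 2.
Proof.
move=> ur; pose m k x := \1_Q x * mode k b x.
have sm k : sqint leb (m k) by apply: sqint_cbox_mul; exact: continuous_mode.
have scm k : sqint leb (fun x => c k * m k x) by exact: sqintZ.
have -> : (fun x => \1_Q x * wave c r b x) = (fun x => \sum_(k <- r) c k * m k x).
  by apply/funext => x; rewrite /wave mulr_sumr; apply: eq_bigr => k _; rewrite mulrCA.
rewrite ip_suml//; last exact: sqint_sum.
rewrite mulr_sumr big_seq [RHS]big_seq; apply: eq_bigr => k kr.
rewrite ip_sumr// (bigD1_seq k)//= big1 ?addr0 => [|l lk];
  rewrite ipZl// ipC ipZl// ip_mode.
  by rewrite eqxx; ring.
by rewrite (negbTE lk) !mulr0.
Qed.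

End waves.

(** * Density of sine sums *)
Section sine_density.
Context {R : realType} {n : nat}.
Local Notation E := 'rV[R]_n.
Local Notation leb := (@lebesgue_rV R n).
Local Notation index := {ffun 'I_n -> nat}.
Variables (a : E) (e : R).
Hypothesis e0 : 0 < e.
Implicit Types (k l : index) (c : index -> R) (r : seq index) (f g : E -> R) (x : E).

Let Q : set E := cbox a (a + const_mx e).
Let sines k := mode a e k (fun=> 0%N).

(** The frequencies are listed without repetition, so that the coefficients
    determine the norm. *)
Definition sine_sums : set (E -> R) := [set f | exists r c,
  uniq r /\ f = fun x => \1_Q x * wave a e c r (fun=> 0%N) x].

Let S0 : sine_sums (fun=> 0).
Proof.
exists [::], (fun=> 0); split => //; apply/funext => x.
by rewrite /wave big_nil mulr0.
Qed.

Let sum_undup (r1 r2 : seq index) (F : index -> R) : uniq r1 ->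
  \sum_(k <- undup (r1 ++ r2) | k \in r1) F k = \sum_(k <- r1) F k.
Proof.
move=> u1; rewrite -big_filter; apply: perm_big; apply: uniq_perm => //.
  by rewrite filter_uniq// undup_uniq.
move=> k; rewrite mem_filter mem_undup mem_cat.
by case: (k \in r1).
Qed.

Let Slin (t : R) f g : sine_sums f -> sine_sums g -> sine_sums (fun x => t * f x + g x).
Proof.
move=> [r1 [c1 [u1 ->]]] [r2 [c2 [u2 ->]]].
exists (undup (r1 ++ r2)), (fun k => t * (if k \in r1 then c1 k else 0) +
  (if k \in r2 then c2 k else 0)); split; first exact: undup_uniq.
apply/funext => x; rewrite /wave mulrCA -mulrDr; congr (_ * _).
rewrite -(sum_undup r2 _ u1) -(sum_undup r1 _ u2) mulr_sumr.
have -> : \sum_(k <- undup (r2 ++ r1) | k \in r2) c2 k * sines k x =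
    \sum_(k <- undup (r1 ++ r2) | k \in r2) c2 k * sines k x.
  apply: perm_big; apply: uniq_perm; rewrite ?undup_uniq// => k.
  by rewrite !mem_undup !mem_cat orbC.
rewrite big_mkcond [X in _ + X]big_mkcond -big_split /=.
by apply: eq_bigr => k _; case: ifP; case: ifP => _ _; rewrite /sines; ring.
Qed.

Let Ssq : sine_sums `<=` sqint leb.
Proof.
by move=> f [r [c [_ ->]]]; apply: sqint_cbox_mul; exact: continuous_wave.
Qed.

Let S_mode k : sine_sums (fun x => \1_Q x * sines k x).
Proof.
exists [:: k], (fun=> 1); split => //; apply/funext => x.
by rewrite /wave big_seq1 mul1r.
Qed.

Let S_sum (r : seq index) c (F : index -> E -> R) :
  (forall k, sine_sums (F k)) -> sine_sums (fun x => \sum_(k <- r) c k * F k x).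
Proof.
move=> SF; elim: r => [|k r ih].
  by under eq_fun do rewrite big_nil; exact: S0.
by under eq_fun do rewrite big_cons; exact: Slin.
Qed.

Definition coscoord i x : R := cos (freq e 0 * (x ord0 i - a ord0 i)).

Let up k i : index := [ffun j => if j == i then (k j).+1 else k j].
Let down k i : index := [ffun j => if j == i then (k j).-1 else k j].

(** The addition theorem: a product of a sine with the basic cosine is again a
    sum of sines. *)
Let sines_coscoord k i x : sines k x * coscoord i x =
  2^-1 * sines (up k i) x + (if k i == 0%N then 0 else 2^-1) * sines (down k i) x.
Proof.
have sinesE l : sines l x = tmode (freq e (l i)) (a ord0 i) 0 (x ord0 i) *
    \prod_(j | j != i) tmode (freq e (l j)) (a ord0 j) 0 (x ord0 j).
  by rewrite /sines /mode (bigD1 i).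
rewrite !sinesE !ffunE eqxx.
set P := \prod_(j | _) _.
have -> : \prod_(j | j != i) tmode (freq e (up k i j)) (a ord0 j) 0 (x ord0 j) = P.
  by apply: eq_bigr => j ji; rewrite ffunE (negbTE ji).
have -> : \prod_(j | j != i) tmode (freq e (down k i j)) (a ord0 j) 0 (x ord0 j) = P.
  by apply: eq_bigr => j ji; rewrite ffunE (negbTE ji).
rewrite /tmode /coscoord !mul0r !addr0.
set t := x ord0 i - a ord0 i.
have fD (m : nat) : freq e m.+1 * t = freq e m * t + freq e 0 * t.
  by rewrite /freq -[m.+2%:R]natr1; ring.
rewrite fD sinD; case: (k i) => [|m] /=.
  by rewrite mul0r addr0; field.
have -> : sin (freq e m * t) = sin (freq e m.+1 * t - freq e 0 * t).
  by rewrite fD addrK.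
by rewrite sinB; field.
Qed.

Let S_cos f i : sine_sums f -> sine_sums (fun x => f x * coscoord i x).
Proof.
move=> [r [c [_ ->]]].
have H k : sine_sums (fun x => \1_Q x * sines k x * coscoord i x).
  rewrite (_ : (fun x => _) = fun x => 2^-1 * (\1_Q x * sines (up k i) x) +
     ((if k i == 0%N then 0 else 2^-1) * (\1_Q x * sines (down k i) x) + 0)).
    by apply: Slin => //; apply: Slin.
  by apply/funext => x; rewrite -mulrA sines_coscoord; ring.
have := S_sum r c H; congr sine_sums; apply/funext => x.
by rewrite /wave mulr_sumr mulr_suml; apply: eq_bigr => k _; rewrite /sines; ring.
Qed.

Let S_poly f i (p : {poly R}) : sine_sums f -> sine_sums (fun x => f x * p.[coscoord i x]).
Proof.
move=> Sf; elim/poly_ind: p => [|p t ih].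
  by under eq_fun do rewrite horner0 mulr0.
rewrite (_ : (fun x => _) = fun x => t * f x + f x * p.[coscoord i x] * coscoord i x).
  by apply: Slin => //; exact: S_cos.
by apply/funext => x; rewrite !hornerE; ring.
Qed.

Let S_prod_poly (r : seq 'I_n) f (p : 'I_n -> {poly R}) : sine_sums f ->
  sine_sums (fun x => f x * \prod_(i <- r) (p i).[coscoord i x]).
Proof.
elim: r f => [|i r ih] f Sf.
  by under eq_fun do rewrite big_nil mulr1.
under eq_fun do rewrite big_cons mulrA.
by apply: ih; exact: S_poly.
Qed.

Let weight x : R := \1_Q x * sines [ffun=> 0%N] x.

Let weight_ge0 x : 0 <= weight x.
Proof.
rewrite /weight indicE; have [/set_mem xQ|_] := boolP (x \in Q); last by rewrite mul0r.
rewrite mul1r; apply: prodr_ge0 => i _; rewrite ffunE /tmode mul0r addr0.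
have := xQ i; rewrite !mxE => /andP[xa xe]; apply: sin_ge0_pi.
rewrite /freq mul1r mulr_ge0 ?divr_ge0 ?pi_ge0 ?(ltW e0) ?subr_ge0//=.
by rewrite mulrAC ler_pdivrMr// ler_wpM2l ?pi_ge0// lerBlDl.
Qed.

Let weight_gt0 x : obox a (a + const_mx e) x -> 0 < weight x.
Proof.
move=> xQ; rewrite /weight indicE mem_set ?mul1r; last exact: obox_cbox.
apply: prodr_gt0 => i _; rewrite ffunE /tmode mul0r addr0.
have := xQ i; rewrite !mxE => /andP[xa xe]; apply: sin_gt0_pi.
rewrite /freq mul1r mulr_gt0 ?divr_gt0 ?pi_gt0 ?subr_gt0//=.
by rewrite mulrAC ltr_pdivrMr// ltr_pM2l ?pi_gt0// ltrBlDl.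
Qed.

Let weight_eq0 x : ~ obox a (a + const_mx e) x -> weight x = 0.
Proof.
rewrite /weight indicE; have [/set_mem xQ|_] := boolP (x \in Q); last by rewrite mul0r.
move=> /existsNP[i]; rewrite !mxE => xi.
rewrite mul1r /sines /mode (bigD1 i)//= ffunE /tmode mul0r addr0.
have := xQ i; rewrite !mxE => /andP[]; rewrite le_eqVlt => /predU1P[<- _|ax].
  by rewrite subrr mulr0 sin0 mul0r.
rewrite le_eqVlt => /predU1P[->|xe]; last by case: xi; rewrite ax xe.
by rewrite addrAC subrr add0r /freq mul1r divfK ?gt_eqF// sinpi mul0r.
Qed.

(** Sends [-1, 1] into [0, 1] and alpha to 1/2, the jump of the threshold. *)
Let level (alpha y : R) : R := 2^-1 + (y - alpha) / 4.

Let level01 alpha y : `|alpha| <= 1 -> `|y| <= 1 -> 0 <= level alpha y <= 1.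
Proof. by rewrite !ler_norml /level => /andP[h1 h2] /andP[h3 h4]; apply/andP; split; lra. Qed.

Let threshold_poly alpha m : {poly R} :=
  (1 - ((4^-1)%:P * ('X - alpha%:P) + (2^-1)%:P) ^+ m) ^+ (m * 2 ^ m).

Let threshold_polyE alpha m y :
  (threshold_poly alpha m).[y] = threshold m (level alpha y).
Proof.
rewrite /threshold_poly /threshold /level !hornerE.
by congr ((1 - _ ^+ _) ^+ _); rewrite addrC mulrC.
Qed.

(** The cosine is decreasing on the half period only, so that bounds outside of
    the cell are moved to its faces. *)
Let clip (s : R) : R := Num.max 0 (Num.min s e).

Let clip_cos s t : 0 < t < e -> (cos (freq e 0 * t) < cos (freq e 0 * clip s)) = (s < t).
Proof.
move=> /andP[t0 te].
have f0 := @freq_gt0 _ _ e0 0.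
have fe : freq e 0 * e = pi by rewrite /freq mul1r divfK// gt_eqF.
have c0 : 0 <= clip s by rewrite le_max lexx.
have ce : clip s <= e by rewrite ge_max ge_min lexx orbT (ltW e0).
have dom u : 0 <= u -> u <= e -> freq e 0 * u \in `[0, pi].
  by move=> u0 ue; rewrite in_itv/= mulr_ge0 ?(ltW f0)//= -fe ler_wpM2l ?(ltW f0).
rewrite ltr_cos ?dom ?(ltW t0) ?(ltW te)//.
by rewrite ltr_pM2l// /clip gt_max t0 gt_min /= [e < t]ltNge (ltW te) orbF.
Qed.

(** Octants are cut out by thresholds for the cosines of the coordinates, and
    threshold polynomials in these cosines keep the weight a sine sum. *)
Let weight_octant A : range octant A -> approximable leb sine_sums (fun x => weight x * \1_A x).
Proof.
move=> [y _ <-].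
pose alpha i := cos (freq e 0 * clip (y ord0 i - a ord0 i)).
have l01 i x := level01 (cos_max _ : `|alpha i| <= 1) (cos_max _ : `|coscoord i x| <= 1).
apply: (@approximable_dominated _ _ _ leb sine_sums Ssq
    (fun m x => weight x * \prod_i (threshold_poly (alpha i) m).[coscoord i x]) _ weight).
- by move=> m; apply: approximable_mem => //; apply: S_prod_poly; exact: S_mode.
- apply: measurable_funM; first exact: sqint_measurable (Ssq (S_mode _)).
  by apply: measurable_indic; exact: measurable_octant.
- exact: Ssq (S_mode _).
- move=> x; have [xQ|xQ] := pselect (obox a (a + const_mx e) x); last first.
    suff -> : weight x = 0.
      by under eq_fun do rewrite mul0r; rewrite mul0r; exact: cvg_cst.
    exact: weight_eq0.
  apply: cvgM; first exact: cvg_cst.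
  have ti i : 0 < x ord0 i - a ord0 i < e.
    by have := xQ i; rewrite !mxE subr_gt0 ltrBlDl.
  have -> : \1_(octant y) x =
      \prod_i (if level (alpha i) (coscoord i x) < 2^-1 then 1 else 0 : R).
    have E i : (level (alpha i) (coscoord i x) < 2^-1) = (y ord0 i < x ord0 i).
      rewrite -[RHS](ltrD2r (- a ord0 i)) -(clip_cos _ (ti i)).
      rewrite -/(alpha i) -/(coscoord i x) /level.
      by apply/idP/idP => ?; lra.
    rewrite indicE; have [/set_mem xy|/negP xy] := boolP (x \in octant y).
      by rewrite big1// => i _; rewrite E ifT//; exact: xy.
    have /existsNP[i /negP/negbTE xi] : ~ octant y x by move=> H; apply: xy; exact: mem_set.
    by rewrite (bigD1 i)//= E xi mul0r.
  elim: (index_enum _) => [|i s ih].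
    by under eq_fun do rewrite big_nil; rewrite big_nil; exact: cvg_cst.
  under eq_fun do rewrite big_cons; rewrite big_cons.
  apply: cvgM => //; under eq_fun do rewrite threshold_polyE.
  exact: cvg_threshold.
- move=> m x; rewrite normrM ger0_norm// ler_piMr// normr_prod.
  apply: prodr_ile1 => i _; rewrite normr_ge0 threshold_polyE.
  by rewrite ger0_norm ?threshold_ge0 ?threshold_le1.
Qed.

(** The weight is the product of the lowest sines, which is positive inside the
    cell. *)
Lemma sine_sums_dense f : sqint leb f ->
  (forall x, ~ obox a (a + const_mx e) x -> f x = 0) -> approximable leb sine_sums f.
Proof.
move=> sf f0.
apply: (approximable_weight S0 Slin Ssq octant_generates octantI _
  weight_ge0 weight_octant sf).
  by apply: approximable_mem => //; exact: S_mode.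
by move=> x wx; apply: f0 => /weight_gt0; rewrite wx ltxx.
Qed.

End sine_density.

(** * Solving the divergence equation in one cell *)
Section cutbox_derivative.
Context {R : realType} {n : nat}.
Implicit Types (l u x : 'rV[R]_n) (A : R).

Definition dcutbox A l u (j : 'I_n) x : R :=
  \prod_i (if i == j then dcut A (l ord0 i) (u ord0 i)
           else cut A (l ord0 i) (u ord0 i)) (x ord0 i).

Lemma is_derive_cutbox A l u j x :
  is_derive x (basis_vec j) (cutbox A l u) (dcutbox A l u j x).
Proof.
have := @is_derive_prod_coord R n (fun i => cut A (l ord0 i) (u ord0 i))
  (dcut A (l ord0 j) (u ord0 j)) j x (is_derive_cut _ _ _ _).
move=> H; apply: (is_derive_eq H); apply: eq_bigr => i _.
by case: eqP => [->|].
Qed.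

Lemma dcutbox_out A l u j x : 0 <= A -> ~ obox l u x -> dcutbox A l u j x = 0.
Proof.
move=> A0 /existsNP[i /negP xi]; rewrite /dcutbox (bigD1 i)//=.
by have [c0 d0] := cut_out A0 xi; case: eqP => _; rewrite ?c0 ?d0 mul0r.
Qed.

Lemma dcutbox_le L A l u j x : 0 <= A -> (forall s, `|dstep s| <= L) ->
  `|dcutbox A l u j x| <= 2 * A * L.
Proof.
move=> A0 sL; rewrite /dcutbox (bigD1 j)//= eqxx normrM -[leRHS]mulr1.
rewrite ler_pM//; first exact: dcut_le.
rewrite normr_prod; apply: prodr_ile1 => i /negbTE ->.
by rewrite normr_ge0 ger0_norm ?cut_ge0 ?cut_le1.
Qed.

Lemma cutbox_in A l u x :
  (forall i, 1 <= A * (x ord0 i - l ord0 i) /\ 1 <= A * (u ord0 i - x ord0 i)) ->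
  cutbox A l u x = 1 /\ forall j, dcutbox A l u j x = 0.
Proof.
move=> H; split=> [|j].
  by apply: big1 => i _; have [/cut_in h /h[->]] := H i.
rewrite /dcutbox (bigD1 j)//= eqxx.
by have [/cut_in h /h[_ ->]] := H j; rewrite mul0r.
Qed.

End cutbox_derivative.

Section cell_field.
Context {R : realType} {n : nat}.
Local Notation E := 'rV[R]_n.
Local Notation leb := (@lebesgue_rV R n).
Local Notation index := {ffun 'I_n -> nat}.
Local Notation "'d_ i u" := ('D_(basis_vec i) u) (at level 10, i at next level).
Variables (a : E) (e A L : R).
Hypothesis n0 : (0 < n)%N.
Hypothesis e0 : 0 < e.
Hypothesis A0 : 0 <= A.
Hypothesis sL : forall s : R, `|dstep s| <= L.
Implicit Types (k : index) (c : index -> R) (f : E -> R) (x : E).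

Let b : E := a + const_mx e.
Let Q : set E := cbox a b.

(** The eigenvalue of minus the Laplacian for the mode k. *)
Let ksqr k : R := \sum_i freq e (k i) ^+ 2.

Let freq_ksqr k i : freq e (k i) ^+ 2 <= ksqr k.
Proof. by rewrite /ksqr (bigD1 i)//= lerDl sumr_ge0// => j _; rewrite sqr_ge0. Qed.

Let ksqr_gt0 k : 0 < ksqr k.
Proof.
apply: lt_le_trans (freq_ksqr k (Ordinal n0)).
by rewrite exprn_gt0// freq_gt0.
Qed.

(** The coefficients of the i-th component of the gradient of the solution u of
    the Poisson equation whose right-hand side has the coefficients c. *)
Let grad c i k : R := - (c k * freq e (k i) / ksqr k).

Let w c r i := wave a e (grad c i) r (incr (fun=> 0%N) i).

Let dw c r i j := wave a e (fun k => grad c i k * freq e (k j)) r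
  (incr (incr (fun=> 0%N) i) j).

Let sqr_ratio_le c k i j : (c k * freq e (k i) / ksqr k * freq e (k j)) ^+ 2 <= c k ^+ 2.
Proof.
have N0 := ksqr_gt0 k; have N0' : ksqr k != 0 by rewrite gt_eqF.
have fi := freq_ksqr k i; have fj := freq_ksqr k j.
rewrite -[leRHS]mulr1 (_ : (_ * _) ^+ 2 =
  c k ^+ 2 * (freq e (k i) ^+ 2 * freq e (k j) ^+ 2 / ksqr k ^+ 2)); last by field.
rewrite ler_wpM2l ?sqr_ge0// ler_pdivrMr ?exprn_gt0// mul1r expr2.
by rewrite ler_pM ?sqr_ge0.
Qed.

(** Gaining a factor e, since no frequency is below 1 / e. *)
Let grad_sqr_le c k i : grad c i k ^+ 2 <= e ^+ 2 * c k ^+ 2.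
Proof.
have N0 := ksqr_gt0 k; have := sqr_ratio_le c k i i; have f0 := @freq_gt0 _ _ e0 (k i).
have ef : 1 <= e * freq e (k i).
  have <- : e * e^-1 = 1 by rewrite divff// gt_eqF.
  by rewrite ler_wpM2l ?freq_ge// ltW.
move=> H; apply: (@le_trans _ _ ((e * freq e (k i)) ^+ 2 * grad c i k ^+ 2)).
  by rewrite ler_peMl ?sqr_ge0// exprn_ege1.
rewrite exprMn -mulrA ler_wpM2l ?sqr_ge0// mulrC /grad sqrrN -exprMn.
exact: H.
Qed.

Let wave0 c r := wave a e c r (fun=> 0%N).

Let div_w c r x : \sum_i dw c r i i x = wave0 c r x.
Proof.
rewrite /dw /wave0 /wave exchange_big /=; apply: eq_bigr => k _.
under eq_bigr do rewrite mode_incr2 /grad mulNr mulrNN.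
rewrite -mulr_suml; congr (_ * _).
have N0 : ksqr k != 0 by rewrite gt_eqF.
apply: (@mulIf _ (ksqr k)) => //.
have -> : c k * ksqr k = \sum_i c k * freq e (k i) ^+ 2 by rewrite /ksqr mulr_sumr.
by rewrite mulr_suml; apply: eq_bigr => i _; field.
Qed.

Let v c r i x := cutbox A a b x * w c r i x.

Let dv c r i j x := dcutbox A a b j x * w c r i x + cutbox A a b x * dw c r i j x.

Let is_derive_v c r i j x : is_derive x (basis_vec j) (v c r i) (dv c r i j x).
Proof. by apply: is_derive_mul; [exact: is_derive_cutbox|exact: is_derive_wave]. Qed.

Let Cinfty_v c r i : Cinfty (v c r i).
Proof. by move=> m; apply: CclassM; [exact: Cclass_cutbox|exact: Cclass_wave]. Qed.

Let sw c r i : sqint leb (fun x => \1_Q x * w c r i x).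
Proof. by apply: sqint_cbox_mul; exact: continuous_wave. Qed.

Let sdw c r i j : sqint leb (fun x => \1_Q x * dw c r i j x).
Proof. by apply: sqint_cbox_mul; exact: continuous_wave. Qed.

Let norm_w c r i : uniq r -> ip leb (fun x => \1_Q x * w c r i x) (fun x => \1_Q x * w c r i x)
  <= e ^+ 2 * ip leb (fun x => \1_Q x * wave0 c r x) (fun x => \1_Q x * wave0 c r x).
Proof.
move=> ur; rewrite !ip_wave// mulrCA ler_wpM2l//.
  by rewrite exprn_ge0// divr_ge0// ltW.
by rewrite mulr_sumr ler_sum// => k _; exact: grad_sqr_le.
Qed.

Let norm_dw c r i j : uniq r -> ip leb (fun x => \1_Q x * dw c r i j x) (fun x => \1_Q x * dw c r i j x)
  <= ip leb (fun x => \1_Q x * wave0 c r x) (fun x => \1_Q x * wave0 c r x).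
Proof.
move=> ur; rewrite !ip_wave// ler_wpM2l//.
  by rewrite exprn_ge0// divr_ge0// ltW.
by rewrite ler_sum// => k _; rewrite /grad mulNr sqrrN; exact: sqr_ratio_le.
Qed.

Let cutbox_mul_le f x : `|cutbox A a b x * f x| <= `|\1_Q x * f x|.
Proof.
rewrite !normrM; have [xQ|xQ] := pselect (obox a b x).
  rewrite indicE mem_set; last exact: obox_cbox.
  by rewrite normr1 ler_wpM2r// ger0_norm ?cutbox_ge0 ?cutbox_le1.
by rewrite cutbox_out// normr0 mul0r mulr_ge0.
Qed.

Let dcutbox_mul_le f j x : `|dcutbox A a b j x * f x| <= `|2 * A * L * (\1_Q x * f x)|.
Proof.
have L0 : 0 <= L := le_trans (normr_ge0 _) (sL 0).
rewrite mulrA !normrM -!normrM; have [xQ|xQ] := pselect (obox a b x).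
  rewrite indicE mem_set ?mulr1; last exact: obox_cbox.
  rewrite normrM [leRHS]normrM ler_wpM2r// [leRHS]ger0_norm ?mulr_ge0//.
  exact: dcutbox_le.
by rewrite dcutbox_out// mul0r normr0.
Qed.

(** P is a sine sum close to f, and V the gradient of the solution of the Poisson
    equation for P, cut off with slope A. With A e bounded, the gain of e in the
    norm of the gradient pays for the derivative of the cutoff. *)
Lemma cell_field f : sqint leb f -> (forall x, ~ obox a b x -> f x = 0) ->
  exists (P : E -> R) (V : 'I_n -> E -> R), [/\
    sqint leb P,
    ip leb (fun x => f x - P x) (fun x => f x - P x) <= ip leb f f / 4,
    (forall i, Cinfty (V i)) /\
    (forall i x, ~ obox a b x -> V i x = 0 /\ forall j, 'd_ j (V i) x = 0),
    (forall x, (forall i, 1 <= A * (x ord0 i - a ord0 i) /\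
                          1 <= A * (b ord0 i - x ord0 i)) ->
       \sum_i 'd_ i (V i) x = P x) &
    forall i, ip leb (V i) (V i) <= e ^+ 2 * ip leb P P /\
      forall j, ip leb ('d_ j (V i)) ('d_ j (V i)) <=
        2 * ((2 * A * L * e) ^+ 2 + 1) * ip leb P P].
Proof.
move=> sf f0.
have [ff0|ffn] := eqVneq (ip leb f f) 0.
  have d0 i x : ('d_ i (fun=> 0 : R) : E -> R) x = 0 by exact: derive_cst.
  have D0 i : 'd_ i (fun=> 0 : R) = (fun=> 0 : R) :> (E -> R) by apply/funext.
  exists (fun=> 0), (fun _ _ => 0); split.
  - exact: sqint0.
  - under eq_fun do rewrite subr0.
    by rewrite ff0 mul0r.
  - split => [i k|i x _]; first exact: Cclass_cst.
    by split => // j; rewrite D0.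
  - by move=> x _; rewrite big1.
  - by move=> i; rewrite ip0l mulr0; split => // j; rewrite D0 ip0l mulr0.
have ffp : 0 < ip leb f f by rewrite lt_neqAle eq_sym ffn ip_ge0.
have [_ af] := sine_sums_dense e0 sf f0.
have [_ [r [c [ur ->]]] fP] := af _ (divr_gt0 ffp (ltr0n _ 4)).
pose P x := \1_Q x * wave0 c r x.
have sP : sqint leb P by apply: sqint_cbox_mul; exact: continuous_wave.
have dvE i j : 'd_ j (v c r i) = dv c r i j.
  by apply/funext => x; case: (is_derive_v c r i j x).
have mcut : measurable_fun setT (cutbox A a b : E -> R).
  exact: continuous_measurable_rV (Cclass_continuous (Cclass_cutbox A a b 0)).
have mwave cc bb : measurable_fun setT (wave a e cc r bb : E -> R).
  by apply: continuous_measurable_rV; exact: continuous_wave.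
have scut cc bb : sqint leb (fun x => cutbox A a b x * wave a e cc r bb x).
  apply: (@sqint_le _ _ _ _ _ (fun x => \1_Q x * wave a e cc r bb x)).
  - exact: measurable_funM.
  - by apply: sqint_cbox_mul; exact: continuous_wave.
  - by move=> x; exact: cutbox_mul_le.
have sdcut i j : sqint leb (fun x => dcutbox A a b j x * w c r i x).
  apply: (@sqint_le _ _ _ _ _ (fun x => 2 * A * L * (\1_Q x * w c r i x))).
  - apply: measurable_funM; last exact: mwave.
    rewrite (_ : dcutbox A a b j = 'd_ j (cutbox A a b)); last first.
      by apply/funext => x; case: (@is_derive_cutbox R n A a b j x).
    apply: continuous_measurable_rV.
    exact: Cclass_continuous (Cclass_elim (Cclass_cutbox A a b 1) j).2.
  - exact: sqintZ.
  - by move=> x; exact: dcutbox_mul_le.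
exists P, (v c r); split => //.
- split; first exact: Cinfty_v.
  move=> i x xQ; rewrite /v cutbox_out// mul0r; split => // j.
  case: (is_derive_v c r i j x) => _ ->.
  by rewrite /dv dcutbox_out// cutbox_out// !mul0r addr0.
- move=> x xin; have [c1 d0] := cutbox_in xin.
  transitivity (\sum_i dw c r i i x).
    apply: eq_bigr => i _; case: (is_derive_v c r i i x) => _ ->.
    by rewrite /dv c1 d0 mul0r add0r mul1r.
  rewrite div_w /P indicE mem_set ?mul1r// => i.
  have [h1 h2] := xin i.
  have [A00|] := eqVneq A 0; first by move: h1; rewrite A00 mul0r ler10.
  move=> An; have Ap : 0 < A by rewrite lt_neqAle eq_sym An.
  have : 0 < A * (x ord0 i - a ord0 i) by apply: lt_le_trans h1.
  have : 0 < A * (b ord0 i - x ord0 i) by apply: lt_le_trans h2.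
  by rewrite !pmulr_rgt0// !subr_gt0 => /ltW -> /ltW ->.
- move=> i; split.
    apply: le_trans (norm_w c i ur).
    by apply: le_ip; [exact: scut|exact: sw|move=> x; exact: cutbox_mul_le].
  move=> j; rewrite dvE; apply: le_trans (ip_sqrD (sdcut i j) (scut _ _)) _.
  have H1 : ip leb (fun x => cutbox A a b x * dw c r i j x)
      (fun x => cutbox A a b x * dw c r i j x) <= ip leb P P.
    apply: le_trans (norm_dw c i j ur).
    by apply: le_ip; [exact: scut|exact: sdw|move=> x; exact: cutbox_mul_le].
  have H2 : ip leb (fun x => dcutbox A a b j x * w c r i x)
      (fun x => dcutbox A a b j x * w c r i x) <= (2 * A * L * e) ^+ 2 * ip leb P P.
    apply: (@le_trans _ _ ((2 * A * L) ^+ 2 *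
      ip leb (fun x => \1_Q x * w c r i x) (fun x => \1_Q x * w c r i x))).
      apply: (@le_trans _ _ (ip leb (fun x => 2 * A * L * (\1_Q x * w c r i x))
        (fun x => 2 * A * L * (\1_Q x * w c r i x)))).
        apply: le_ip; [exact: sdcut|exact/sqintZ/sw|move=> x; exact: dcutbox_mul_le].
      have s2 := sqintZ (2 * A * L) (sw c r i).
      by rewrite (ipZl _ (sw c r i) s2) ipC (ipZl _ (sw c r i) (sw c r i)) mulrA -expr2.
    have -> : (2 * A * L * e) ^+ 2 * ip leb P P = (2 * A * L) ^+ 2 * (e ^+ 2 * ip leb P P).
      by ring.
    by rewrite ler_wpM2l ?sqr_ge0//; exact: norm_w.
  by lra.
Qed.

End cell_field.

(** * Geometry of the cells *)
Section cells_geometry.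
Context {R : realType} {d : nat}.
Local Notation E := 'rV[R]_d.
Implicit Types (x y z : E) (A : set E).

Lemma line_coord (x c : E) (s : R) i :
  (x + s *: (c - x)) ord0 i = x ord0 i + s * (c ord0 i - x ord0 i).
Proof. by rewrite !mxE. Qed.

Lemma axis_coord (x : E) (s : R) i j :
  (x + s *: basis_vec i) ord0 j = x ord0 j + s * (j == i)%:R.
Proof. by rewrite !mxE eqxx. Qed.

Lemma closure_obox (a b : E) : (forall i, a ord0 i < b ord0 i) ->
  cbox a b `<=` closure (obox a b).
Proof.
move=> ab x xb B /nbhs_ballP[r /= r0 xrB].
(* move from x towards the centre of the box *)
pose c := 2^-1 *: (a + b).
have ci i : a ord0 i < c ord0 i < b ord0 i.
  by rewrite !mxE; have := ab i => ?; apply/andP; split; lra.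
pose s := Num.min 1 (r / (2 * (`|c - x| + 1))).
have N0 : 0 < 2 * (`|c - x| + 1) by rewrite mulr_gt0// ltr_wpDl.
have s0 : 0 < s by rewrite lt_min ltr01 divr_gt0.
have s1 : s <= 1 by rewrite ge_min lexx.
exists (x + s *: (c - x)); split; last first.
  apply: xrB; rewrite -ball_normE /= opprD addNKr normrN normrZ gtr0_norm//.
  apply: (@le_lt_trans _ _ (r / (2 * (`|c - x| + 1)) * `|c - x|)).
    by rewrite ler_wpM2r// ge_min lexx orbT.
  rewrite mulrAC ltr_pdivrMr// ltr_pM2l//.
  by have := normr_ge0 (c - x) => ?; lra.
move=> i; have := ci i; have := xb i; rewrite line_coord.
by move=> /andP[h1 h2] /andP[h3 h4]; apply/andP; split; nra.
Qed.

Lemma enorm_coord (t : R) (i : 'I_d) : enorm (t *: basis_vec i : E) = `|t|.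
Proof.
rewrite /enorm (bigD1 i)//= big1 ?addr0.
  by rewrite !mxE !eqxx mulr1 sqrtr_sqr.
by move=> j /negbTE ji; rewrite !mxE eqxx ji /= mulr0 expr0n.
Qed.

Lemma YcellE : Ycell = obox (const_mx (- 2^-1)) (const_mx (2^-1)) :> set E.
Proof. by apply/seteqP; split => x H i; have := H i; rewrite !mxE. Qed.

Lemma frontier_Ycell (x : E) (i : 'I_d) (s : R) : Ycell x -> `|s| = 2^-1 ->
  frontier Ycell (x + (s - x ord0 i) *: basis_vec i).
Proof.
move=> xY s2; set y := _ + _.
have yi : y ord0 i = s by rewrite axis_coord eqxx mulr1 subrKC.
have sE : s = 2^-1 \/ s = - 2^-1.
  by move: s2; have [?|?] := ger0P s; [left|right]; lra.
split.
  rewrite YcellE; apply: closure_obox.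
    by move=> j; rewrite !mxE; lra.
  move=> j; rewrite axis_coord !mxE; have := xY j; have [->|ji] := eqVneq j i.
    by rewrite mulr1 subrKC => _; apply/andP; split; case: sE => ->; lra.
  by rewrite mulr0 addr0 => /andP[/ltW -> /ltW ->].
move=> /nbhs_ballP[r /= r0 yr].
have : Ycell (y + (r / 2 * Num.sg s) *: basis_vec i).
  apply: yr; split => // i' j; rewrite ord1 /ball /= (axis_coord y) opprD addNKr normrN.
  rewrite !normrM normr_sg.
  have -> : (s != 0)%:R = 1 :> R by case: sE => ->; rewrite ?oppr_eq0 invr_eq0 pnatr_eq0.
  rewrite mulr1 (gtr0_norm r0) [`|2^-1|]ger0_norm ?invr_ge0//.
  case: (j == i); rewrite ?normr1 ?normr0 ?mulr1 ?mulr0//.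
  by rewrite ltr_pdivrMr// ltr_pMr// ltr1n.
move=> /(_ i); rewrite (axis_coord y) yi eqxx mulr1; case: sE => ->.
  rewrite gtr0_sg; last by rewrite invr_gt0.
  by move=> /andP[h1 h2]; lra.
rewrite ltr0_sg; last by rewrite oppr_lt0 invr_gt0.
by move=> /andP[h1 h2]; lra.
Qed.

(** Moving one coordinate of a point of omega to 1/2 or -1/2 gives a point of the
    boundary of Y, whose distance is the gap in this coordinate. *)
Lemma inclusion_margin (omega : set E) : admissible_inclusion omega ->
  exists2 delta : R, 0 < delta & forall y, omega y -> forall i,
    - 2^-1 + delta <= y ord0 i <= 2^-1 - delta.
Proof.
move=> [[oY _] _ _ _ dist].
have [delta d0 dle] : exists2 delta : R, 0 < delta &
    (delta%:E <= distance omega (frontier Ycell))%E.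
  move: dist; case: (distance _ _) => [r r0|_|//].
    by exists r => //; rewrite -lte_fin.
  by exists 1 => //; rewrite leey.
exists delta => // y oy i; have yY := oY _ oy.
have P s : `|s| = 2^-1 -> delta <= `|y ord0 i - s|.
  move=> s2; rewrite -lee_fin; apply: le_trans dle _.
  apply: ereal_inf_lbound; exists (y, y + (s - y ord0 i) *: basis_vec i) => /=.
    by split => //; exact: frontier_Ycell.
  by rewrite opprD addNKr -scaleNr opprB enorm_coord.
have /andP[yl yu] := yY i.
have := P (2^-1); rewrite ger0_norm ?invr_ge0// => /(_ erefl).
have := P (- 2^-1); rewrite normrN ger0_norm ?invr_ge0// => /(_ erefl).
rewrite opprK gtr0_norm; last by lra.
rewrite ltr0_norm; last by lra.
by move=> *; apply/andP; split; lra.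
Qed.

End cells_geometry.

Section cells.
Context {R : realType} {d : nat}.
Local Notation E := 'rV[R]_d.
Local Notation lattice := 'rV[int]_d.
Variable eps : R.
Hypothesis eps0 : 0 < eps.
Implicit Types (z : lattice) (x y : E) (Omega omega : set E).

Definition corner z : E := \row_i (eps * ((z ord0 i)%:~R - 2^-1)).

Definition cell z : set E := obox (corner z) (corner z + const_mx eps).

Lemma cell_rescale z x : cell z x -> rescale eps z Ycell x.
Proof.
move=> xz; exists (eps^-1 *: x - map_mx intr z); last first.
  by rewrite addrCA subrr addr0 scalerA divff ?scale1r// gt_eqF.
move=> i; have := xz i; rewrite !mxE => /andP[h1 h2].
have : eps * (eps^-1 * x ord0 i) = x ord0 i by rewrite mulVKf// gt_eqF.
by move=> xE; apply/andP; split; rewrite -(ltr_pM2l eps0); lra.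
Qed.

Lemma rescale_cell z omega : omega `<=` Ycell -> rescale eps z omega `<=` cell z.
Proof.
move=> oY _ [y /oY yY <-] i; have := yY i; rewrite !mxE => /andP[].
by rewrite -(ltr_pM2l eps0) -(ltr_pM2l eps0 (y _ _)) => h1 h2; apply/andP; split; lra.
Qed.

Lemma cell_inj z z' x : cell z x -> cell z' x -> z = z'.
Proof.
move=> xz xz'; apply/rowP => i; apply/eqP; rewrite -subr_eq0 -normr_le0.
rewrite -ltzD1 add0r -(@ltr_int R) intr_norm rmorphB /=.
have := xz i; have := xz' i; rewrite !mxE => /andP[h1 h2] /andP[h3 h4].
by rewrite ltr_norml; apply/andP; split; rewrite -(ltr_pM2l eps0); lra.
Qed.

Lemma closed_cell_sub Omega z : cells Omega eps z ->
  cbox (corner z) (corner z + const_mx eps) `<=` Omega.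
Proof.
move=> zO; apply: subset_trans zO.
apply: (@subset_trans _ (closure (cell z))).
  by apply: closure_obox => i; rewrite !mxE ltrDl.
by apply: closureS => x; exact: cell_rescale.
Qed.

Lemma cells_seq Omega : bounded_set Omega ->
  exists2 zs : seq lattice, uniq zs & forall z, z \in zs <-> cells Omega eps z.
Proof.
move=> [M [_ OM]]; pose B : R := `|M| + 1.
pose N := Num.bound (B / eps).
pose z_of (f : {ffun 'I_d -> 'I_(N + N).+1}) : lattice := \row_i ((f i)%:Z - N%:Z).
pose zs := undup [seq z_of f | f <- enum {ffun 'I_d -> 'I_(N + N).+1}].
exists [seq z <- zs | `[< cells Omega eps z >]]; first by rewrite filter_uniq// undup_uniq.
move=> z; rewrite mem_filter; split => [/andP[/asboolP]//|zO].
apply/andP; split; first exact/asboolP.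
have zN i : (`|z ord0 i| <= N%:Z)%R.
  have Oc : Omega (eps *: map_mx intr z).
    apply: zO; apply: subset_closure; exists 0; last by rewrite addr0.
    by move=> j; rewrite mxE oppr_lt0 invr_gt0 ltr0n.
  have := le_trans (coord_le_norm _ i) (OM B _ _ Oc).
  rewrite mxE mxE normrM gtr0_norm// -ler_pdivlMl// => H.
  rewrite -(@ler_int R) intr_norm; apply: (le_trans (H _)).
    by rewrite /B (le_lt_trans (ler_norm _))// ltrDl.
  rewrite mulrC; apply: ltW; apply: le_lt_trans (archi_boundP _) => //.
  by rewrite divr_ge0 ?addr_ge0// ltW.
rewrite mem_undup; apply/mapP.
have zlt i : (absz (z ord0 i + N%:Z)%R < (N + N).+1)%N.
  rewrite ltnS -lez_nat gez0_abs; have := zN i; rewrite ler_norml => /andP[]; lia.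
exists [ffun i => Ordinal (zlt i)]; first by rewrite mem_enum.
apply/rowP => i; rewrite mxE ffunE /= gez0_abs ?addrK//.
by have := zN i; rewrite ler_norml => /andP[]; lia.
Qed.

End cells.

(** * Smooth fields with compact support *)
Section test_sums.
Context {R : realType} {n : nat}.
Local Notation E := 'rV[R]_n.
Local Notation leb := (@lebesgue_rV R n).

Lemma test_functionD (O : set E) f g : test_function O f -> test_function O g ->
  test_function O (fun x => f x + g x).
Proof.
move=> [sf [K [cK KO f0]]] [sg [K' [cK' KO' g0]]].
split; first by move=> k; exact: CclassD.
exists (K `|` K'); split; first exact: compactU.
  by move=> x [/KO|/KO'].
by move=> x /not_orP[Kx K'x]; rewrite f0// g0// addr0.
Qed.

Lemma test_function_sum (I : eqType) (r : seq I) (O : set E) (F : I -> E -> R) :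
  (forall i, i \in r -> test_function O (F i)) ->
  test_function O (fun x => \sum_(i <- r) F i x).
Proof.
elim: r => [|i r ih] tF.
  by under eq_fun do rewrite big_nil; exact: test_function0.
under eq_fun do rewrite big_cons; apply: test_functionD.
  by apply: tF; rewrite mem_head.
by apply: ih => j jr; apply: tF; rewrite in_cons jr orbT.
Qed.

Lemma ip_sum_disjoint (I : eqType) (r : seq I) (F : I -> E -> R) : uniq r ->
  (forall i, sqint leb (F i)) -> (forall i j x, i != j -> F i x * F j x = 0) ->
  ip leb (fun x => \sum_(i <- r) F i x) (fun x => \sum_(i <- r) F i x) =
  \sum_(i <- r) ip leb (F i) (F i).
Proof.
move=> ur sF F0; rewrite ip_suml//; last exact: sqint_sum.
rewrite big_seq [RHS]big_seq; apply: eq_bigr => i ir.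
rewrite ip_sumr// (bigD1_seq i)//= big1 ?addr0// => j ji.
rewrite /ip; under eq_Rintegral do rewrite F0 1?eq_sym//.
by rewrite Rintegral_cst ?mul0r.
Qed.

End test_sums.

Section test_fields.
Context {R : realType} {d : nat}.
Local Notation E := 'rV[R]_d.
Local Notation leb := (@lebesgue_rV R d).
Local Notation "'d_ i u" := ('D_(basis_vec i) u) (at level 10, i at next level).
Variables (O : set E) (v : 'I_d -> E -> R).
Hypothesis oO : open O.
Hypothesis tv : forall i, test_function O (v i).

Definition vfield (x : E) : E := \row_i v i x.

Lemma coord_vfield i : coord_fun vfield i = v i.
Proof. by apply/funext => x; rewrite /coord_fun mxE. Qed.

Lemma H1norm_vfield : H1norm O vfield ^+ 2 =
  \sum_j (ip leb (v j) (v j) + \sum_i ip leb ('d_ i (v j)) ('d_ i (v j))).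
Proof.
rewrite /H1norm sqr_sqrtr; last first.
  by apply: sumr_ge0 => j _; rewrite addr_ge0 ?sqr_ge0//; apply: sumr_ge0 => i _; rewrite sqr_ge0.
apply: eq_bigr => j _; rewrite coord_vfield (L2norm_test (tv j)).
by congr (_ + _); apply: eq_bigr => i _; rewrite (L2norm_weak_partial_test i oO (tv j)).
Qed.

Lemma Rintegral_weak_div (D : set E) (psi : E -> R) : D `<=` O -> L2 leb D psi ->
  \int[leb]_(x in D) (weak_div O vfield x * psi x) =
  \sum_i ip leb ('d_ i (v i)) (psi \_ D).
Proof.
move=> DO /L2_sqint sp.
pose g i := weak_partial O i (v i) \_ O.
have sg i : sqint leb (g i) by have [[/L2_sqint]] := weak_partial_test i oO (tv i).
have -> : \int[leb]_(x in D) (weak_div O vfield x * psi x) =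
    ip leb (fun x => \sum_i g i x) (psi \_ D).
  rewrite Rintegral_mkcond; apply: eq_Rintegral => x _; rewrite patchE [in RHS]patchE.
  case: ifPn => [/set_mem Dx|_]; last by rewrite mulr0.
  congr (_ * _); apply: eq_bigr => i _.
  by rewrite /g coord_vfield patchE mem_set//; exact: DO.
rewrite ip_suml//; apply: eq_bigr => i _.
have [_ wd] := weak_partial_test i oO (tv i).
have sd := test_function_sqint (test_function_derive i (tv i)).
exact: (ip_ae_eq (sqint_measurable (sg i)) (sqint_measurable sd) (sqint_measurable sp) wd).
Qed.

Lemma ae_zero_vfield : ae_zero O vfield ->
  forall i j, {ae leb, forall x, 'd_ j (v i) x = 0}.
Proof.
move=> v0 i j; have td := test_function_derive j (tv i).
have vi0 : {ae leb, forall x, v i x = 0}.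
  apply: filterS v0 => x H; have [/H/rowP/(_ i)|Ox] := pselect (O x); first by rewrite !mxE.
  exact: test_function_out (tv i) Ox.
have : {ae leb, forall x, O x -> 'd_ j (v i) x = 0}.
  apply: ae_eq0_test => //; first exact: test_function_sqint td.
  move=> f tf; apply/eqP; rewrite -oppr_eq0 -(ip_derive j (tv i) tf).
  have tdf := test_function_derive j tf.
  rewrite (@ip_ae_eq _ _ _ leb (v i) (fun=> 0)) ?ip0l//.
  - exact: sqint_measurable (test_function_sqint (tv i)).
  - exact: sqint_measurable (test_function_sqint tdf).
apply: filterS => x H; have [/H//|Ox] := pselect (O x).
exact: test_function_out td Ox.
Qed.

End test_fields.

Section vanishing_trace.
Context {R : realType} {d : nat}.
Local Notation E := 'rV[R]_d.
Variables (O : set E) (v : 'I_d -> E -> R).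
Hypothesis oO : open O.
Hypothesis tv : forall i, test_function O (v i).

(** The field vanishes near the boundary, and approximates itself: its trace is
    0, which is orthogonal to all rigid motions. *)
Lemma Vspace_vfield : Vspace O (vfield v).
Proof.
split; first by move=> j; rewrite coord_vfield; exact: test_function_H1.
exists (fun=> 0); split.
  exists (fun=> vfield v); split.
  - by move=> k j; rewrite coord_vfield; exact: (tv j).1.
  - rewrite (_ : (fun k => _) = fun=> 0); first exact: cvg_cst.
    apply/funext => k; apply/eqP; rewrite -sqrf_eq0.
    rewrite (_ : (fun x => _) = vfield (fun _ _ => 0)); last first.
      by apply/funext => x; apply/rowP => i; rewrite !mxE subrr.
    rewrite H1norm_vfield//; last by move=> i; exact: test_function0.
    rewrite big1// => j _; rewrite ip0l add0r big1// => i _.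
    rewrite (_ : 'D_(basis_vec i) (fun=> 0) = (fun=> 0 : R) :> (E -> R)) ?ip0l//.
    by apply/funext => x; exact: derive_cst.
  - move=> j; rewrite (_ : coord_fun _ j = fun=> 0); first exact: L2_0.
    by apply/funext => x; rewrite /coord_fun mxE.
  - move=> j; rewrite (_ : (fun k => _) = fun=> 0); first exact: cvg_cst.
    apply/funext => k; rewrite coord_vfield -[RHS](@L2norm0 _ _ _ (@surface R d) (frontier O)).
    rewrite /L2norm; congr (fine (Lnorm _ _ (EFin \o _))).
    apply/funext => x; rewrite !patchE; case: ifPn => // /set_mem[_ xO].
    rewrite /coord_fun mxE subr0 (test_function_out (tv j))//.
    by move=> Ox; apply: xO; exact: (open_nbhs_nbhs (conj oO Ox)).
split; first split.
- move=> j; rewrite (_ : coord_fun _ j = fun=> 0); first exact: L2_0.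
  by apply/funext => x; rewrite /coord_fun mxE.
- rewrite integral0_eq ?ltry// => x _; rewrite integral0_eq// => y _.
  rewrite subrr /enorm big1 ?sqrtr0 ?expr0n ?mul0r//.
  by move=> i _; rewrite mxE expr0n.
move=> r _; rewrite /Rintegral integral0_eq// => x _.
by rewrite big1// => j _; rewrite mxE mul0r.
Qed.

End vanishing_trace.

(** * The inf-sup inequality *)
Section inf_sup.
Context {R : realType} {d : nat}.
Local Notation E := 'rV[R]_d.
Local Notation leb := (@lebesgue_rV R d).
Local Notation lattice := 'rV[int]_d.
Local Notation "'d_ i u" := ('D_(basis_vec i) u) (at level 10, i at next level).
Implicit Types (x : E) (Omega omega : set E).

(** An approximation of f within half of its norm is as good as f itself, up to
    constants. *)
Lemma ip_approx (f P : E -> R) : sqint leb f -> sqint leb P ->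
  ip leb (fun x => f x - P x) (fun x => f x - P x) <= ip leb f f / 4 ->
  3 / 8 * ip leb f f <= ip leb P f /\ ip leb P P <= 5 / 2 * ip leb f f.
Proof.
move=> sf sP.
have := ip_ge0 leb P; have := ip_ge0 leb (fun x => f x - 2^-1 * P x).
have sP2 := sqintZ 2^-1 sP.
rewrite !ip_sqrB// (ipC _ f (fun x => _ * _)) !(ipZl _ sP)//.
rewrite (ipC _ P (fun x => _ * _)) (ipZl _ sP sP) (ipC _ f P) => *.
by split; lra.
Qed.

(** The sum of the fields of cell_field over the cells, for the restrictions of
    the pressure. No two of them are nonzero at the same point, so that their
    norms add up. The slope is chosen such that the cutoffs are 1 on the
    inclusions. *)
Lemma test_field Omega omega (delta L eps : R) (psi : E -> R) :
  (0 < d)%N -> bounded_set Omega -> open Omega -> omega `<=` Ycell ->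
  0 < delta -> (forall y, omega y -> forall i,
    - 2^-1 + delta <= y ord0 i <= 2^-1 - delta) ->
  (forall s : R, `|dstep s| <= L) -> 0 < eps < 1 ->
  L2 leb (inclusions Omega omega eps) psi ->
  let psi0 := psi \_ (inclusions Omega omega eps) in
  let C := 2 * ((2 * L / delta) ^+ 2 + 1) in
  exists v : 'I_d -> E -> R, [/\ forall i, test_function Omega (v i),
    3 / 8 * ip leb psi0 psi0 <= \sum_i ip leb ('d_ i (v i)) psi0,
    forall i, ip leb (v i) (v i) <= 5 / 2 * ip leb psi0 psi0 &
    forall i j, ip leb ('d_ j (v i)) ('d_ j (v i)) <= C * (5 / 2) * ip leb psi0 psi0].
Proof.
move=> d0 bO oO oY delta0 margin sL /andP[eps0 eps1] psi2 psi0 C.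
have [zs uzs zsP] := cells_seq eps0 bO.
set D := inclusions Omega omega eps in psi2 psi0 *.
have spsi : sqint leb psi0 by apply/L2_sqint.
pose A := (eps * delta)^-1.
have A0 : 0 <= A by rewrite invr_ge0 mulr_ge0// ltW.
pose a (z : lattice) : E := corner eps z.
pose b (z : lattice) : E := a z + const_mx eps.
pose f (z : lattice) x := \1_(cell eps z) x * psi0 x.
have sf z : sqint leb (f z).
  apply: (sqint_le _ spsi) => [|x].
    apply: measurable_funM; last exact: sqint_measurable spsi.
    by apply: measurable_indic; exact: measurable_obox.
  rewrite /f normrM indicE.
  by case: (_ \in _); rewrite ?normr1 ?mul1r ?normr0 ?mul0r.
have f_out z x : ~ cell eps z x -> f z x = 0.
  by move=> xz; rewrite /f indicE memNset ?mul0r.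
have /choice[PV PVP] (z : lattice) := cell_field d0 eps0 A0 sL (sf z) (f_out z).
have /choice[V VP] := PVP; move: (PV) VP => P VP {PVP PV}.
have sP z : sqint leb (P z) by have [] := VP z.
have V_out z i x : ~ cell eps z x -> V z i x = 0 /\ forall j, 'd_ j (V z i) x = 0.
  by move=> xz; have [_ _ [_ H] _ _] := VP z; exact: H.
have sV z i : Cinfty (V z i) by have [_ _ [H _] _ _] := VP z.
have tV z i : z \in zs -> test_function Omega (V z i).
  move=> /zsP zO; split => //; exists (cbox (a z) (b z)); split.
  - exact: compact_cbox.
  - exact: closed_cell_sub.
  - move=> x xz; have [] // := @V_out z i x.
    by move=> /obox_cbox.
pose v i x := \sum_(z <- zs) V z i x.
have tv i : test_function Omega (v i).
  by apply: test_function_sum => z zzs; exact: tV.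
have dvx i j x : 'd_ j (v i) x = \sum_(z <- zs) 'd_ j (V z i) x.
  have H z := Cinfty_is_derive j x (sV z i).
  by case: (is_derive_sum_seq zs H).
have dvE i j : 'd_ j (v i) = fun x => \sum_(z <- zs) 'd_ j (V z i) x.
  by apply/funext => x; exact: dvx.
pose T := ip leb psi0 psi0.
have disj z z' x : z != z' -> ~ cell eps z x \/ ~ cell eps z' x.
  move=> zz'; have [xz|] := pselect (cell eps z x); last by left.
  by right => xz'; move/eqP: zz'; apply; exact: cell_inj xz xz'.
have psi0E : psi0 = fun x => \sum_(z <- zs) f z x.
  apply/funext => x; have [[z /zsP zzs xz]|xD] := pselect (D x).
    have xc : cell eps z x by exact: rescale_cell xz.
    rewrite (bigD1_seq z)//= big1 ?addr0 => [|z' z'z].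
      by rewrite /f indicE mem_set ?mul1r.
    by have [/f_out|] := disj z' z x z'z.
  rewrite /psi0 patchE memNset// big1// => z _.
  by rewrite /f /psi0 patchE memNset// mulr0.
have TE : T = \sum_(z <- zs) ip leb (f z) (f z).
  rewrite /T {1 2}psi0E ip_sum_disjoint// => z z' x zz'.
  by have [/f_out ->|/f_out ->] := disj z z' x zz'; rewrite ?mul0r ?mulr0.
have fP z : 3 / 8 * ip leb (f z) (f z) <= ip leb (P z) (f z) /\
    ip leb (P z) (P z) <= 5 / 2 * ip leb (f z) (f z).
  by have [_ H _ _ _] := VP z; exact: ip_approx.
have PT : \sum_(z <- zs) ip leb (P z) (P z) <= 5 / 2 * T.
  by rewrite TE mulr_sumr; apply: ler_sum => z _; have [] := fP z.
have sVz z i : z \in zs -> sqint leb (V z i) by move=> /tV H; exact: test_function_sqint (H i).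
have test_norm (F : lattice -> E -> R) (c : R) : 0 <= c ->
    (forall z, z \in zs -> sqint leb (F z)) ->
    (forall z x, ~ cell eps z x -> F z x = 0) ->
    (forall z, ip leb (F z) (F z) <= c * ip leb (P z) (P z)) ->
    ip leb (fun x => \sum_(z <- zs) F z x) (fun x => \sum_(z <- zs) F z x)
      <= c * (5 / 2 * T).
  move=> c0 sF F0 Fc.
  (* F is only controlled at the lattice points that are cells of Omega *)
  pose G z := if z \in zs then F z else fun=> 0.
  have GE x : \sum_(z <- zs) F z x = \sum_(z <- zs) G z x.
    by rewrite big_seq [RHS]big_seq; apply: eq_bigr => z zzs; rewrite /G zzs.
  have -> : (fun x => \sum_(z <- zs) F z x) = (fun x => \sum_(z <- zs) G z x).
    by apply/funext.
  rewrite ip_sum_disjoint//; last 2 first.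
  - by move=> z; rewrite /G; case: ifP => [/sF//|_]; exact: sqint0.
  - move=> z z' x zz'; rewrite /G.
    have [/F0 z0|/F0 z0] := disj z z' x zz'.
      by case: ifP => _; rewrite ?z0 mul0r.
    by case: (z' \in zs); rewrite ?z0 mulr0.
  apply: le_trans (ler_wpM2l c0 PT); rewrite mulr_sumr.
  rewrite big_seq [leRHS]big_seq; apply: ler_sum => z zzs.
  by rewrite /G zzs.
exists v; split => //.
- rewrite -/T.
  have divE z x : f z x != 0 -> \sum_i 'd_ i (v i) x = P z x.
    move=> fzx.
    have xz : cell eps z x.
      by apply: contrapT => /f_out /eqP; rewrite (negbTE fzx).
    have [z' z'O xz'] : D x.
      apply: contrapT => xD; move/eqP: fzx; apply.
      by rewrite /f /psi0 patchE memNset ?mulr0.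
    have xz'' : cell eps z' x by exact: (rescale_cell eps0 oY).
    have zz' : z' = z := cell_inj eps0 xz'' xz.
    rewrite {}zz' in z'O xz'.
    have zzs : z \in zs by apply/zsP.
    have [_ _ _ divV _] := VP z; rewrite -divV; last first.
      move=> i; case: xz' => y oy <-; have := margin y oy i.
      have edelta t : eps * delta <= t -> 1 <= A * t.
        by move=> et; rewrite /A mulrC ler_pdivlMr ?mulr_gt0// mul1r.
      move=> /andP[h1 h2]; rewrite -(ler_pM2l eps0) in h1.
      rewrite -(ler_pM2l eps0) in h2.
      by split; apply: edelta; rewrite !mxE; lra.
    apply: eq_bigr => i _; rewrite dvx (bigD1_seq z)//= big1 ?addr0// => z'' z''z.
    by have [/V_out H|//] := disj z'' z x z''z; have [_ ->] := H i.
  have sdv i : sqint leb ('d_ i (v i)).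
    exact: test_function_sqint (test_function_derive i (tv i)).
  rewrite -ip_suml//.
  have -> : ip leb (fun x => \sum_i 'd_ i (v i) x) psi0 = \sum_(z <- zs) ip leb (P z) (f z).
    rewrite {1}psi0E ip_sumr//; last exact: sqint_sum.
    apply: eq_bigr => z _; apply: eq_Rintegral => x _.
    by have [->|/divE ->] := eqVneq (f z x) 0; rewrite ?mulr0.
  by rewrite TE mulr_sumr; apply: ler_sum => z _; have [] := fP z.
- move=> i; rewrite -/T -[leRHS]mul1r; apply: test_norm => //.
  + by move=> z zzs; exact: sVz.
  + by move=> z x /V_out H; have [] := H i.
  + move=> z; have [_ _ _ _ H] := VP z; have [+ _] := H i.
    move/le_trans; apply; rewrite ler_wpM2r ?ip_ge0// exprn_ile1// ltW//.
- move=> i j; rewrite -/T -mulrA dvE; apply: test_norm.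
  + by rewrite mulr_ge0// addr_ge0 ?sqr_ge0.
  + by move=> z zzs; exact: test_function_sqint (test_function_derive j (tV z i zzs)).
  + by move=> z x /V_out H; have [] := H i.
  + move=> z; have [_ _ _ _ H] := VP z; have [_] := H i.
    move=> /(_ j); rewrite (_ : 2 * A * L * eps = 2 * L / delta)//.
    by rewrite /A; field; rewrite !gt_eqF.
Qed.

End inf_sup.

Unset Implicit Arguments.

Theorem lemma2p1 (R : realType) (d : nat) (Omega omega : set 'rV[R]_d) :
  (2 <= d)%N -> admissible_domain Omega -> admissible_inclusion omega ->
  exists beta : R, 0 < beta /\
    forall eps : R, 0 < eps < 1 ->
      connected (Omega `\` closure (inclusions Omega omega eps)) ->
      (beta%:E <= infsup_div Omega (inclusions Omega omega eps))%E.
Proof.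
move=> d2 [bO _ oO _ _] aomega.
have [delta delta0 margin] := inclusion_margin aomega.
have [[oY _] _ _ _ _] := aomega.
have [L L0 sL] := @dstep_bounded R.
have d0 : (0 < d)%N by exact: ltn_trans d2.
pose C := 2 * ((2 * L / delta) ^+ 2 + 1).
have C0 : 0 <= C by rewrite mulr_ge0// addr_ge0 ?sqr_ge0.
(* d and d^2 count the components of v and of its gradient *)
pose K := d%:R * (1 + d%:R * C) * (5 / 2) : R.
have K0 : 0 < K.
  by rewrite !mulr_gt0 ?ltr0n// ltr_wpDr// mulr_ge0.
exists (3 / 8 / Num.sqrt K); split; first by rewrite !divr_gt0 ?sqrtr_gt0.
move=> eps eps01 _; apply: le_ereal_inf_tmp => _ [psi [psi2 psin0] <-].
have [v [tv divv vv dvv]] := test_field d0 bO oO oY delta0 margin sL eps01 psi2.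
set D := inclusions Omega omega eps in psi2 psin0 divv vv dvv *.
set psi0 := psi \_ D in divv vv dvv.
pose T := ip (@lebesgue_rV R d) psi0 psi0; rewrite -/T in divv vv dvv.
have spsi : sqint (@lebesgue_rV R d) psi0 by apply/L2_sqint.
have DO : D `<=` Omega.
  move=> x [z zO xz]; apply: zO; apply: subset_closure.
  by case: xz => y oy <-; exists y => //; exact: oY.
have T0 : 0 < T.
  rewrite lt_neqAle eq_sym ip_ge0 andbT; apply/eqP => T0; apply: psin0.
  apply: filterS (ip_eq0_ae spsi T0) => x + Dx.
  by rewrite /psi0 patchE mem_set.
set X := \sum_i _ in divv.
have X0 : 0 < X by apply: lt_le_trans divv; rewrite mulr_gt0.
have XE := Rintegral_weak_div oO tv DO psi2; rewrite -/X in XE.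
have sd i j : sqint (@lebesgue_rV R d) ('D_(basis_vec j) (v i)).
  exact: test_function_sqint (test_function_derive j (tv i)).
have nv : ~ ae_zero Omega (vfield v).
  move=> /(ae_zero_vfield oO tv) H; suff : X = 0 by move=> X00; rewrite X00 ltxx in X0.
  apply: big1 => i _.
  rewrite (@ip_ae_eq _ _ _ _ _ (fun=> 0)) ?ip0l//.
  - exact: sqint_measurable (sd i i).
  - exact: sqint_measurable spsi.
have NK : H1norm Omega (vfield v) ^+ 2 <= K * T.
  rewrite H1norm_vfield//.
  apply: (@le_trans _ _ (\sum_(j < d) (5 / 2 * T + \sum_(i < d) C * (5 / 2) * T))).
    apply: ler_sum => j _; apply: lerD; first exact: vv.
    by apply: ler_sum => i _; exact: dvv.
  rewrite sumr_const card_ord sumr_const card_ord.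
  rewrite -[leLHS]mulr_natl -[_ *+ d]mulr_natl /K le_eqVlt.
  by apply/orP; left; apply/eqP; ring.
have N0 : 0 <= H1norm Omega (vfield v) by exact: sqrtr_ge0.
have Np : 0 < H1norm Omega (vfield v).
  rewrite lt_neqAle eq_sym N0 andbT; apply/eqP => N00.
  have := H1norm_vfield oO tv; rewrite N00 expr0n /= => /esym /eqP.
  rewrite psumr_eq0; last first.
    by move=> j _; rewrite addr_ge0 ?ip_ge0//; apply: sumr_ge0 => i _; exact: ip_ge0.
  move=> /allP H; suff : X = 0 by move=> X00; rewrite X00 ltxx in X0.
  apply: big1 => i _; have := H i; rewrite mem_index_enum => /(_ isT) /=.
  rewrite paddr_eq0 ?ip_ge0//; last by apply: sumr_ge0 => j _; exact: ip_ge0.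
  move=> /andP[_]; rewrite psumr_eq0; last by move=> j _; exact: ip_ge0.
  move=> /allP/(_ i); rewrite mem_index_enum => /(_ isT) /= /eqP di0.
  have := ip_CS (sd i i) spsi; rewrite di0 mul0r => H0.
  by apply/eqP; rewrite -sqrf_eq0 eq_le H0 sqr_ge0.
have PE : L2norm (@lebesgue_rV R d) D psi = Num.sqrt T.
  by rewrite -[LHS]ger0_norm ?L2norm_ge0// -sqrtr_sqr L2norm_sqr.
apply: ereal_sup_ge; exists ((\int[@lebesgue_rV R d]_(x in D)
    (weak_div Omega (vfield v) x * psi x) /
  (H1norm Omega (vfield v) * L2norm (@lebesgue_rV R d) D psi))%:E).
  by exists (vfield v) => //; split => //; exact: Vspace_vfield.
rewrite lee_fin XE PE.
have sT : 0 < Num.sqrt T by rewrite sqrtr_gt0.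
have NK' : H1norm Omega (vfield v) <= Num.sqrt K * Num.sqrt T.
  rewrite -sqrtrM ?(ltW K0)// -[leLHS]ger0_norm// -sqrtr_sqr.
  by rewrite ler_sqrt// mulr_ge0 ?(ltW K0) ?(ltW T0).
rewrite ler_pdivlMr ?mulr_gt0//; apply: le_trans divv.
have sK : 0 < Num.sqrt K by rewrite sqrtr_gt0.
have -> : 3 / 8 / Num.sqrt K * (H1norm Omega (vfield v) * Num.sqrt T) =
   3 / 8 * ((H1norm Omega (vfield v) * Num.sqrt T) / Num.sqrt K) by ring.
rewrite ler_wpM2l// ler_pdivrMr//.
rewrite -{2}(sqr_sqrtr (ltW T0)) expr2 mulrAC ler_wpM2r ?(ltW sT)//.
by rewrite mulrC.
Qed.
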